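(* Consider Activated Random Walks on $\mathbb{Z}^d$, $d\geqslant1$, with a fixed biased jump distribution $p(\cdot)$, i.e. $\sum_y y\,p(y)\neq\boldsymbol{0}$. Let $\zeta_c=\zeta_c(\lambda)$ denote the critical density for sleep rate $\lambda$. Then $\zeta_c(\lambda)<1$ for every $\lambda\in(0,\infty)$, and $\zeta_c(\lambda)\to0$ as $\lambda\to0$.
   Context: Activated Random Walk (ARW) on $\mathbb{Z}^d$. Fix $d\geqslant1$, a sleep rate $0<\lambda<\infty$ and a jump distribution $p(\cdot)$, i.e. a probability distribution on $\mathbb{Z}^d$ supported on the nearest neighbors $\{\pm e_1,\dots,\pm e_d\}$ of the origin $\boldsymbol{0}$ and whose support generates the group $\mathbb{Z}^d$. Let $\mathbb{N}_0=\{0,1,2,\dots\}$ and $\mathbb{N}_{\mathfrak{s}}=\mathbb{N}_0\cup\{\mathfrak{s}\}$, ordered by $0<\mathfrak{s}<1<2<\cdots$, with $|\mathfrak{s}|=1$, $|n|=n$, $\mathfrak{s}+1=2$, $1\cdot\mathfrak{s}=\mathfrak{s}$ and $n\cdot\mathfrak{s}=n$ for $n\geqslant2$. A configuration is $\eta\in(\mathbb{N}_{\mathfrak{s}})^{\mathbb{Z}^d}$: site $x$ contains $\eta(x)$ active particles if $\eta(x)\in\mathbb{N}_0$ and one sleeping particle if $\eta(x)=\mathfrak{s}$. Evolution: at each site $x$ a clock rings at rate $(1+\lambda)\,\eta_t(x)\,\mathbf{1}_{\{\eta_t(x)\neq\mathfrak{s}\}}$. When it rings, with probability $\frac{\lambda}{1+\lambda}$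 the value $\eta(x)$ is replaced by $\eta(x)\cdot\mathfrak{s}$; otherwise, with probability $\frac{p(y-x)}{1+\lambda}$ for each $y$, $\eta(x)$ is replaced by $\eta(x)-1$ and $\eta(y)$ by $\eta(y)+1$. For a translation-ergodic distribution $\nu$ on $(\mathbb{N}_{\mathfrak{s}})^{\mathbb{Z}^d}$ with finite density $\int|\eta(\boldsymbol{0})|\nu(\mathrm{d}\eta)<\infty$ there is a process $(\eta_t)_{t\geqslant0}$ with these rates and $\eta_0\sim\nu$; its law $\mathbf{P}^{\nu}$ is characterized by $\mathbf{P}^{\nu}(\mathcal{A})=\lim_{V\uparrow\mathbb{Z}^d}\mathbf{P}^{\nu}_V(\mathcal{A})$ for every event $\mathcal{A}$ determined by $(\eta_s(x))_{x\in B,\,s\in[0,t]}$ with $B$ finite and $t<\infty$, where $\mathbf{P}^{\nu}_V$ is the law of the (finite) system started from $\eta_0\cdot\mathbf{1}_V$, $V$ finite. The system stays active if, for each site, there are arbitrarily large times at which the site has at least one active particle. It fixates if, for each site, there is a (random) time after which the site is always either vacant or occupied by exactly one sleeping particle. Critical density: given $d$, $p(\cdot)$, $\lambda$, the critical density $\zeta_c$ is the unique number such that, for every translation-ergodic distribution $\nu$ supported on $(\mathbb{N}_0)^{\mathbb{Z}^d}$ (all particles initially active) with finite density $\zeta$, $\mathbf{P}^\nu(\text{system stays active})$ equals $0$ if $\zeta<\zeta_c$ and $1$ if $\zeta>\zeta_c$ (existence of such a number is a known theorem). *)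

(* Defs.v *)
From HB Require Import structures.
From mathcomp Require Import all_boot all_order all_algebra finmap.
From mathcomp Require Import all_classical all_reals all_analysis measurable_realfun.

Set Implicit Arguments.
Unset Strict Implicit.
Unset Printing Implicit Defensive.

Import Order.TTheory GRing.Theory Num.Theory.
Import numFieldNormedType.Exports.

Local Open Scope classical_set_scope.
Local Open Scope ring_scope.

(* The set N_s: [Active n] is n active particles (so [Active 0] is a vacant
   site), [Sleeping] is one sleeping particle. *)
Inductive occupation := Active of nat | Sleeping.

HB.instance Definition _ := gen_eqMixin occupation.
HB.instance Definition _ := gen_choiceMixin occupation.
HB.instance Definition _ := isPointed.Build occupation (Active 0).

Definition nb_particles (k : occupation) : nat :=
  if k is Active n then n else 1.

Definition nb_active (k : occupation) : nat :=
  if k is Active n then n else 0.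

(* k + 1, with s + 1 = 2 *)
Definition incr (k : occupation) : occupation :=
  if k is Active n then Active n.+1 else Active 2.

(* k - 1, only used when [k] is [Active n] with 0 < n *)
Definition decr (k : occupation) : occupation :=
  if k is Active n then Active n.-1 else Active 0.

(* k * s, only used when [k] is [Active n] with 0 < n: 1 * s = s, and
   n * s = n for n >= 2 *)
Definition sleep (k : occupation) : occupation :=
  if k is Active 1 then Sleeping else k.

Notation site d := 'rV[int]_d.

Definition config (d : nat) := site d -> occupation.

Section jump_distribution.
Variables (R : realType) (d : nat).
Implicit Type p : site d -> R.

(* The sums over [setT] below have finitely many nonzero terms, because p is
   supported on the nearest neighbors of the origin. *)
Record jump_distribution p : Prop := {
  jump_ge0 : forall y, 0 <= p y ;
  jump_sum1 : \sum_(y \in [set: site d]) p y = 1 ;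
  jump_nearest : forall y, p y != 0 ->
    exists i : 'I_d, y = delta_mx 0 i \/ y = - delta_mx 0 i ;
  jump_generates : forall S : {pred site d}, zmod_closed S ->
    (forall y, p y != 0 -> y \in S) -> forall y, y \in S }.

Definition drift p : 'rV[R]_d :=
  \sum_(y \in [set: site d]) p y *: map_mx intr y.

Definition biased p : Prop := drift p != 0.

End jump_distribution.

Section configurations.
Variable d : nat.
Implicit Types (eta xi : config d) (x y : site d) (V : {fset site d}).

Definition cylinders : set (set (config d)) :=
  [set A | exists x k, A = [set eta | eta x = k]].

(* configurations with the product sigma-algebra *)
Definition configM := g_sigma_algebraType cylinders.

Definition translate x eta : config d := fun y => eta (x + y).

Definition restrict V eta : config d :=
  fun x => if x \in V then eta x else Active 0.

Definition sleep_at x eta : config d :=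
  fun z => if z == x then sleep (eta x) else eta z.

(* only used with x != y *)
Definition jump x y eta : config d :=
  fun z => if z == x then decr (eta x)
           else if z == y then incr (eta y) else eta z.

End configurations.

Section initial_law.
Variables (R : realType) (d : nat).
Implicit Type nu : probability (configM d) R.

Definition translation_ergodic nu : Prop :=
  (forall x (A : set (configM d)), measurable A ->
     nu (translate x @^-1` A) = nu A) /\
  (forall A : set (configM d), measurable A ->
     (forall x, translate x @^-1` A = A) -> nu A = 0%E \/ nu A = 1%E).

Definition supported_on_active nu : Prop :=
  nu [set eta | forall x, eta x <> Sleeping] = 1%E.

Definition density nu : \bar R :=
  (\int[nu]_eta (nb_particles (eta (0 : site d)))%:R%:E)%E.

End initial_law.

Section finite_system.
Variables (R : realType) (d : nat) (p : site d -> R) (lambda : R).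
Implicit Types (eta xi : config d).

Definition clock_rate eta (x : site d) : R :=
  (1 + lambda) * (nb_active (eta x))%:R.

(* probability that a ring of the clock at [x] turns [eta] into [xi] *)
Definition ring_prob (x : site d) eta xi : R :=
  lambda / (1 + lambda) * (`[< xi = sleep_at x eta >])%:R +
  \sum_(y \in [set: site d])
     p (y - x) / (1 + lambda) * (`[< xi = jump x y eta >])%:R.

(* The sums over sites are meant for configurations with finitely many
   particles. *)
Definition total_rate eta : R :=
  \sum_(x \in [set: site d]) clock_rate eta x.

(* Transition matrix of the chain of configurations seen at successive rings.
   A ring may leave the configuration unchanged (n * s = n for n >= 2), so
   this chain may jump from a configuration to itself. A configuration
   without active particles is absorbing. *)
Definition step_prob eta xi : R :=
  if total_rate eta == 0 then (`[< xi = eta >])%:R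
  else \sum_(x \in [set: site d])
         clock_rate eta x / total_rate eta * ring_prob x eta xi.

(* The process [X] on the probability space (Omega, P) is the system started
   from the finite configuration eta_0 1_V with eta_0 of law [nu]: a
   continuous-time Markov chain, given by the chain [Y] seen at rings and the
   holding times [T], which given [Y] are independent with [T i] exponential
   of parameter [total_rate (Y i)] (infinite if that rate is zero).
   As eta_0 1_V lives in a countable set, the identities [finite_law]
   determine the joint law of [Y] and [T]. *)
Record finite_system (nu : probability (configM d) R) (V : {fset site d})
    (disp : measure_display) (Omega : measurableType disp)
    (P : probability Omega R) (X : R -> Omega -> config d) : Prop := {
  finite_measurable : forall t x k, 0 <= t ->
    measurable [set w | X t w x = k] ;
  finite_jump_hold : exists (Y : nat -> Omega -> config d)
      (T : nat -> Omega -> \bar R),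
    [/\ forall n x k, measurable [set w | Y n w x = k],
        forall n, measurable_fun [set: Omega] (T n),
        forall n w, (0 <= T n w)%E,
        forall n (a : nat -> config d) (s : nat -> R),
          (forall i, 0 <= s i) ->
          P [set w | forall i, (i <= n)%N ->
                       Y i w = a i /\ ((s i)%:E < T i w)%E] =
          (nu [set eta | restrict V eta = a 0%N] *
           (\prod_(i < n) step_prob (a i) (a i.+1) *
            \prod_(i < n.+1) expR (- total_rate (a i) * s i))%:E)%E
      & forall n t w, 0 <= t ->
          (\sum_(i < n) T i w <= t%:E < \sum_(i < n.+1) T i w)%E ->
          X t w = Y n w] }.

End finite_system.

Section infinite_system.
Variables (R : realType) (d : nat) (p : site d -> R) (lambda : R).

(* events on trajectories determined by (eta_s(x)), x in B, s in [0,t] *)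
Definition local_event (B : {fset site d}) (t : R) : set (set (R -> config d)) :=
  <<s [set A | exists s x k,
         [/\ 0 <= s <= t, x \in B & A = [set u | u s x = k]]] >>.

(* [eta] is a realization of the process of law P^nu, with trajectories that
   are right-continuous at every site (for the discrete topology on N_s);
   [arw_limit] is P^nu(A) = lim P^nu_V(A) as the finite set V increases to
   Z^d. *)
Record arw_process (nu : probability (configM d) R)
    (disp : measure_display) (Omega : measurableType disp)
    (P : probability Omega R) (eta : R -> Omega -> config d) : Prop := {
  arw_measurable : forall t x k, 0 <= t ->
    measurable [set w | eta t w x = k] ;
  arw_right_continuous : forall w x t, 0 <= t ->
    \forall s \near t^'+, eta s w x = eta t w x ;
  arw_limit : forall (B : {fset site d}) (t : R) (A : set (R -> config d)),
    0 <= t -> local_event B t A ->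
    forall e : R, 0 < e -> exists V0 : {fset site d},
    forall V : {fset site d}, (V0 `<=` V)%fset ->
    forall (disp' : measure_display) (Omega' : measurableType disp')
      (P' : probability Omega' R) (X : R -> Omega' -> config d),
    finite_system p lambda nu V P' X ->
    (`|P' [set w | A (X^~ w)] - P [set w | A (eta^~ w)]| < e%:E)%E }.

Definition stays_active (u : R -> config d) : Prop :=
  forall (x : site d) (t0 : R), exists2 t,
    0 <= t /\ t0 <= t & (1 <= nb_active (u t x))%N.

(* P^nu(system stays active) = r. The law of an [arw_process] is unique, so
   this does not depend on its realization. *)
Definition prob_stays_active_is (nu : probability (configM d) R)
    (r : \bar R) : Prop :=
  exists (disp : measure_display) (Omega : measurableType disp)
    (P : probability Omega R) (eta : R -> Omega -> config d),
    arw_process nu P eta /\ P [set w | stays_active (eta^~ w)] = r.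

(* [zc] is unique: the product measures with Poisson marginals are ergodic
   and have all nonnegative densities. *)
Definition critical_density (zc : R) : Prop :=
  forall (nu : probability (configM d) R) (zeta : R),
    translation_ergodic nu -> supported_on_active nu ->
    density nu = zeta%:E ->
    (zeta < zc -> prob_stays_active_is nu 0%E) /\
    (zc < zeta -> prob_stays_active_is nu 1%E).

End infinite_system.

(* Main.v *)
(* Let [a > b] be the jump probabilities in a direction of positive drift and
   let [c] be the probability that a walk with these jumps is never killed, if
   it is killed at rate [lambda] at the nonpositive levels only; [c] is
   positive and tends to 1 as [lambda] tends to 0.  The critical density is at
   most [1 - c].  To see it, take an initial condition of density in
   [(1 - c, 1)] which is periodic in the direction of the drift, and a box of
   side [n].  By the abelian property the particles of the box may be moved one
   after the other, from the lowest level to the highest, each until it leaves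
   the box, meets an empty site which is still to be treated, or is told to
   sleep at a site already treated: each of them succeeds with probability
   about [c], so that a number of particles of the order of the volume leaves
   the box.  The Green function of the walk bounds the second moment of the
   number of particles received by a boundary site; hence, with a probability
   [v] that depends neither on [n] nor on [K], some boundary site receives more
   than [K] particles.  With such a pile any finite set can be toppled as often
   as we like.  Monotonicity in the number of particles carries these
   topplings over to the continuous-time dynamics in every larger finite
   volume: they are performed within a time that does not depend on the volume,
   and few of them are performed before a given time [s].  So with probability
   bounded below the given set is visited after time [s], the system does not
   fixate almost surely, and the density is at least critical. *)

From HB Require Import structures.
From mathcomp Require Import all_boot all_order all_algebra finmap.
From mathcomp Require Import all_classical all_reals all_analysis measurable_realfun.
From mathcomp Require Import ring lra zify.
Require Import Defs.

Set Implicit Arguments.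
Unset Strict Implicit.
Unset Printing Implicit Defensive.

Import Order.TTheory GRing.Theory Num.Theory.
Import numFieldNormedType.Exports.
Local Open Scope classical_set_scope.
Local Open Scope ring_scope.

(** * Independent digits of a uniform variable *)

(** The law of the infinite system is accessible only through [arw_limit], which speaks of all
    realizations of the finite systems; one has to be exhibited in each volume, and it is built on a
    product of two uniform variables. The first coordinate carries the stacks of instructions, the
    second the clocks: what can be toppled legally is an event of the first alone, and how fast it
    is toppled is estimated by integrating the second with the stacks frozen. Since subcritical
    activity has probability 0, a positive lower bound is a contradiction; but it has to survive
    both late times and the exhaustion of the lattice by finite sets. This is why the probability of
    a pile must not depend on its height, and why the time estimates, which come from discounted
    counts weighted in space, must be uniform in the volume. The pile is obtained at a deterministic
    site, so that it can be translated to a site from which the given set is reached. Layers of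
    rational density make the initial law a finite mixture, of which one component is kept at a
    constant cost. The limit 0 also uses [0 <= zc], which comes from the empty configuration. *)

Section pushforward_pack.
Context d d' (T1 : measurableType d) (T2 : measurableType d') (R : realType).

Definition pushm (m : {measure set T1 -> \bar R}) (f : T1 -> T2)
  (mf : measurable_fun [set: T1] f) : {measure set T2 -> \bar R}.
Proof. by refine (pushforward m f : {measure set _ -> \bar _}). Defined.

Lemma pushmE m f (mf : measurable_fun [set: T1] f) A :
  pushm m mf A = m (f @^-1` A).
Proof. by []. Qed.

End pushforward_pack.

Section uniform_space.
Context {R : realType}.
Local Notation OM := (measurableTypeR R).
Local Notation leb := (@lebesgue_measure R).

Definition unif : probability OM R := uniform_prob (@ltr01 R).

Lemma unifE (A : set OM) : measurable A -> unif A = leb (A `&` `[0, 1]%classic).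
Proof.
move=> mA; rewrite /unif /= /uniform_prob integral_uniform_pdf.
rewrite (eq_integral (fun=> 1%E)); last first.
  by move=> x; rewrite inE /= in_itv /= /uniform_pdf => -[_ ->]; rewrite subr0 invr1.
by rewrite integral_cst//= ?mul1e//; exact: measurableI.
Qed.

Definition affine2 (i : R) : OM -> OM := fun x => 2 * x - i.

Lemma measurable_affine2 i : measurable_fun [set: OM] (affine2 i).
Proof. by apply: measurable_funB => //; exact: mulrl_measurable. Qed.

Lemma leb_affine2 i (A : set OM) : measurable A ->
  leb (affine2 i @^-1` A) = ((2^-1)%:E * leb A)%E.
Proof.
move=> mA.
have h2 : 0 <= 2 :> R by [].
pose m' := mscale (NngNum h2) (pushm leb (measurable_affine2 i)).
have m'E B : m' B = (2%:E * leb (affine2 i @^-1` B))%E by [].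
have : leb A = m' A.
  apply: lebesgue_measure_unique => // _ [[a b]] _ <-.
  rewrite [RHS]m'E.
  have -> : affine2 i @^-1` `]a, b]%classic = `](a + i) / 2, (b + i) / 2]%classic.
    apply/seteqP; split => x /=; rewrite /affine2 !in_itv /=; lra.
  rewrite !lebesgue_measure_itv /= !lte_fin.
  have -> : ((a + i) / 2 < (b + i) / 2) = (a < b) by lra.
  case: ifP => _; last by rewrite mule0.
  by rewrite -!EFinB -EFinM; congr EFin; lra.
move=> ->; rewrite m'E muleA -EFinM mulVf ?mul1e//.
Qed.

Definition bit (x : OM) : bool := 2^-1 <= x.
Definition dbl (x : OM) : OM := 2 * x - (bit x)%:R.

Lemma measurable_bit : measurable_fun [set: OM] bit.
Proof. by apply: measurable_fun_ler => //. Qed.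

Lemma measurable_dbl : measurable_fun [set: OM] dbl.
Proof.
apply: measurable_funB; first exact: mulrl_measurable.
rewrite (_ : (fun x => _) = (fun x : OM => if bit x then 1 else 0 : R)); last first.
  by apply/funext => x; case: (bit x).
by apply: measurable_fun_ifT => //; exact: measurable_bit.
Qed.

(** On each half of the unit interval, [dbl] is an affine map of slope 2 onto the interval, up to
    the end point 1. *)
Lemma unif_half (i : bool) (A : set OM) : measurable A ->
  unif ([set x | bit x = i] `&` dbl @^-1` A) = ((2^-1)%:E * unif A)%E.
Proof.
move=> mA.
have mb : measurable [set x : OM | bit x = i].
  by rewrite -[X in measurable X]setTI; exact: (measurable_bit measurableT (Y := [set i])).
have mD : measurable (dbl @^-1` A).
  by rewrite -[X in measurable X]setTI; exact: measurable_dbl.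
rewrite unifE; last exact: measurableI.
rewrite unifE//.
case: i mb => mb.
  rewrite -(leb_affine2 1); last exact: measurableI.
  congr (leb _); apply/seteqP; split => x /=; rewrite /affine2 /dbl !in_itv /=.
    by move=> [[bx xA]] x01; move: xA; rewrite bx => xA; split => //; move: bx x01; rewrite /bit; lra.
  move=> [xA x01]; have -> : bit x by rewrite /bit; lra.
  by split => //; lra.
(* On the lower half [dbl] does not reach 1, so this null point is first removed from the other
   side. *)
have -> : leb (A `&` `[0, 1]%classic) = leb (A `&` `[0, 1[%classic).
  have -> : A `&` `[0, 1]%classic = (A `&` `[0, 1[%classic) `|` (A `&` [set 1]).
    rewrite -setIUr; congr (_ `&` _); apply/seteqP; split => x /=; rewrite !in_itv /=.
      by move=> /andP[x0]; rewrite le_eqVlt => /orP[/eqP->|x1]; [right|left; rewrite x0].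
    by move=> [/andP[-> /ltW->]//|->]; rewrite ler01 lexx.
  rewrite measureU; [|exact: measurableI|exact: measurableI|].
    rewrite [X in (_ + X)%E](_ : _ = 0%E) ?adde0//.
    apply: (@subset_measure0 _ _ _ leb _ [set 1]) => //; first exact: measurableI.
    exact: lebesgue_measure_set1.
  apply/seteqP; split => x //= -[[_]]; rewrite in_itv /= => /andP[_ x1] [_ x1'].
  by rewrite x1' ltxx in x1.
rewrite -(leb_affine2 0); last exact: measurableI.
congr (leb _); apply/seteqP; split => x /=; rewrite /affine2 /dbl !in_itv /=.
  by move=> [[bx xA]] x01; move: xA; rewrite bx => xA; split => //; move: bx x01; rewrite /bit => /negbT; rewrite -ltNge; lra.
move=> [xA x01]; have bx : bit x = false by apply/negbTE; rewrite /bit -ltNge; lra.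
by rewrite bx; split => //; lra.
Qed.

Lemma le_half_pow (x : R) : (forall n, `|x| <= 2^-1 ^+ n) -> x = 0.
Proof.
move=> h; apply/eqP; rewrite -normr_eq0 eq_le normr_ge0 andbT.
have c : (fun n => 2^-1 ^+ n : R) @ \oo --> (0 : R).
  by apply: cvg_expr; rewrite ger0_norm ?invr_ge0// invf_lt1// ltr1n.
by rewrite -(cvg_lim _ c)//; apply: limr_ge; [exact: cvgP c|exact: nearW].
Qed.

(* [evens] reads the binary digits of even rank; the digits of odd rank are
   the even ones of [dbl x]. *)
Fixpoint evens_upto (m : nat) (x : OM) : R :=
  if m is m'.+1 then ((bit x)%:R + evens_upto m' (dbl (dbl x))) / 2 else 0.

Lemma evens_upto_itv m x : 0 <= evens_upto m x <= 1.
Proof.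
elim: m x => [|m IH] x /=; first by rewrite lexx ler01.
by have := IH (dbl (dbl x)); case: (bit x) => /=; lra.
Qed.

Lemma evens_upto_nd x : nondecreasing_seq (evens_upto ^~ x).
Proof.
apply/nondecreasing_seqP => n; elim: n x => [|n IH] x.
  by have /andP[] := evens_upto_itv 1 x.
have E k y : evens_upto k.+1 y = ((bit y)%:R + evens_upto k (dbl (dbl y))) / 2 by [].
by rewrite (E n x) (E n.+1 x); have := IH (dbl (dbl x)); lra.
Qed.

Definition evens (x : OM) : OM := limn (evens_upto ^~ x).
Definition odds (x : OM) : OM := evens (dbl x).

Lemma cvg_evens x : evens_upto ^~ x @ \oo --> evens x.
Proof.
apply: nondecreasing_is_cvgn; first exact: evens_upto_nd.
by exists 1 => _ [n _ <-]; have /andP[] := evens_upto_itv n x.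
Qed.

Lemma evens_itv x : 0 <= evens x <= 1.
Proof.
have c := @cvg_evens x; apply/andP; split.
  apply: (limr_ge (cvgP _ c)); apply: nearW => n.
  by have /andP[] := evens_upto_itv n x.
apply: (limr_le (cvgP _ c)); apply: nearW => n.
by have /andP[] := evens_upto_itv n x.
Qed.

(** Dropping the first digit exchanges even and odd ranks, whence [odds] on the right. *)
Lemma evensE x : evens x = ((bit x)%:R + odds (dbl x)) / 2.
Proof.
have c : (fun n => evens_upto n.+1 x) @ \oo --> evens x.
  by have := @cvg_evens x; rewrite -(cvg_shiftS (evens_upto ^~ x)).
apply: (cvg_unique _ c) => //=.
apply: cvgMl; apply: cvgD; first exact: cvg_cst.
exact: cvg_evens.
Qed.

Lemma measurable_evens : measurable_fun [set: OM] evens.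
Proof.
apply: (@measurable_fun_cvg _ _ _ _ evens_upto) => [m|x _]; last exact: cvg_evens.
elim: m => [|m IH] //=.
apply: measurable_funM => //; apply: measurable_funD.
  rewrite (_ : (fun x => _) = (fun x : OM => if bit x then 1 else 0 : R)); last first.
    by apply/funext => x; case: (bit x).
  by apply: measurable_fun_ifT => //; exact: measurable_bit.
have m2 := measurableT_comp measurable_dbl measurable_dbl.
exact: (measurableT_comp IH m2).
Qed.

Lemma measurable_odds : measurable_fun [set: OM] odds.
Proof. by apply: measurableT_comp; [exact: measurable_evens|exact: measurable_dbl]. Qed.

Let lowset (a b : R) := evens @^-1` `]-oo, a] `&` odds @^-1` `]-oo, b].

Let mlow a b : measurable (lowset a b).
Proof.
apply: measurableI; rewrite -[X in measurable X]setTI.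
  exact: measurable_evens.
exact: measurable_odds.
Qed.

Let F a b := fine (unif (lowset a b)).

Let FE a b : unif (lowset a b) = (F a b)%:E.
Proof. by rewrite fineK// fin_num_measure. Qed.

Let F01 a b : 0 <= F a b <= 1.
Proof.
by rewrite -!lee_fin -FE measure_ge0 probability_le1.
Qed.

(** Conditioning on the first digit: the argument of [evens] is doubled, and the exchange of
    parities swaps the two arguments of the joint distribution function [F]. *)
Let Frec a b : F a b = (F b (2 * a) + F b (2 * a - 1)) / 2.
Proof.
have : unif (lowset a b) =
    ((2^-1)%:E * unif (lowset b (2 * a)) + (2^-1)%:E * unif (lowset b (2 * a - 1)))%E.
  rewrite -(unif_half false)// -(unif_half true)// -measureU.
  - congr (unif _); apply/seteqP; split => x; rewrite /lowset /= !in_itv /= [evens x]evensE.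
      rewrite -/(odds x); case: (bit x) => /= -[]; rewrite ?mulr1n ?mulr0n => ? ?;
        [right|left]; (split; [by []|split; [by []|]]); lra.
    by case=> -[->] [? ?] /=; split => //; lra.
  - apply: measurableI => //.
      by rewrite -[X in measurable X]setTI; exact: (measurable_bit measurableT (Y := [set false])).
    by rewrite -[X in measurable X]setTI; exact: measurable_dbl.
  - apply: measurableI => //.
      by rewrite -[X in measurable X]setTI; exact: (measurable_bit measurableT (Y := [set true])).
    by rewrite -[X in measurable X]setTI; exact: measurable_dbl.
  - by apply/seteqP; split => x //= [[-> _] []].
by rewrite !FE -!EFinM -EFinD => -[->]; lra.
Qed.

Let Flt0l a b : a < 0 -> F a b = 0.
Proof.
move=> a0; rewrite /F (_ : lowset a b = set0) ?measure0//.
apply/seteqP; split => x //; rewrite /lowset /= => -[]; rewrite !in_itv /=.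
by have /andP[e0 _] := evens_itv x; move=> /(le_trans e0); rewrite leNgt a0.
Qed.

Let Flt0r a b : b < 0 -> F a b = 0.
Proof.
move=> b0; rewrite /F (_ : lowset a b = set0) ?measure0//.
apply/seteqP; split => x //; rewrite /lowset /= => -[_]; rewrite in_itv /=.
by have /andP[e0 _] := evens_itv (dbl x); move=> /(le_trans e0); rewrite leNgt b0.
Qed.

Let Fge1l a b : 1 <= a -> F a b = F 1 b.
Proof.
move=> a1; congr (fine (unif _)); apply/seteqP; split => x; rewrite /lowset /= !in_itv /=;
  by have := evens_itv x; lra.
Qed.

Let Fge1r a b : 1 <= b -> F a b = F a 1.
Proof.
move=> a1; congr (fine (unif _)); apply/seteqP; split => x; rewrite /lowset /= !in_itv /=;
  by have := evens_itv (dbl x); rewrite -/(odds x); lra.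
Qed.

(* Both sides satisfy the same equation, which contracts their distance. *)
Let F_marginal a : 0 <= a <= 1 -> F a 1 = a.
Proof.
have F11 : F 1 1 = 1.
  rewrite /F (_ : lowset 1 1 = setT) ?probability_setT//.
  apply/seteqP; split => x // _; rewrite /lowset /= !in_itv /=.
  by have /andP[_ ->] := evens_itv x; have /andP[_ ->] := evens_itv (dbl x).
have Fsym b : 0 <= b <= 1 -> F 1 b = F b 1.
  by move=> b01; rewrite Frec Fge1r; [rewrite (_ : 2 * 1 - 1 = 1 :> R)|]; lra.
suff H n b : 0 <= b <= 1 -> `|F b 1 - b| <= 2^-1 ^+ n.
  by move=> a01; apply/subr0_eq/le_half_pow => n; exact: H.
elim: n b => [|n IH] b b01.
  by rewrite expr0 ler_norml; have := F01 b 1; lra.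
rewrite Frec exprS; set e := _ ^+ n in IH *; rewrite ler_norml.
have [b2|b2] := ltP (2 * b) 1.
  rewrite (Flt0r 1 (b := 2 * b - 1)); last lra.
  have b2' : 0 <= 2 * b <= 1 by lra.
  by rewrite Fsym//; have := IH _ b2'; rewrite ler_norml; lra.
rewrite Fge1r// F11 Fsym; last lra.
have b2' : 0 <= 2 * b - 1 <= 1 by lra.
by have := IH _ b2'; rewrite ler_norml; lra.
Qed.

(** The product satisfies the same recursion, [F_marginal] taking care of the case where one
    argument exceeds 1; each use of the recursion halves the distance between the two sides. *)
Let F_prod a b : 0 <= a <= 1 -> 0 <= b <= 1 -> F a b = a * b.
Proof.
suff H n a' b' : 0 <= a' <= 1 -> 0 <= b' <= 1 -> `|F a' b' - a' * b'| <= 2^-1 ^+ n.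
  by move=> a01 b01; apply/subr0_eq/le_half_pow => n; exact: H.
elim: n a' b' => [|n IH] {}a {}b a01 b01.
  rewrite expr0 ler_norml; have := F01 a b.
  have : 0 <= a * b <= 1 by rewrite mulr_ge0 ?mulr_ile1; lra.
  lra.
rewrite Frec exprS; set e := _ ^+ n in IH *; rewrite ler_norml.
have [a2|a2] := ltP (2 * a) 1.
  rewrite (Flt0r b (b := 2 * a - 1)); last lra.
  have a2' : 0 <= 2 * a <= 1 by lra.
  by have := IH _ _ b01 a2'; rewrite ler_norml; lra.
rewrite Fge1r// F_marginal//.
have a2' : 0 <= 2 * a - 1 <= 1 by lra.
by have := IH _ _ b01 a2'; rewrite ler_norml; lra.
Qed.

Lemma measure_unique_lower_rays (m1 m2 : {measure set OM -> \bar R}) :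
  (m1 setT < +oo)%E -> m1 setT = m2 setT ->
  (forall a, m1 `]-oo, a]%classic = m2 `]-oo, a]%classic) ->
  forall A, measurable A -> m1 A = m2 A.
Proof.
move=> fin eqT eqr A mA.
have rayE (m : {measure set OM -> \bar R}) a : (m setT < +oo)%E ->
    m `]a, +oo[%classic = (m setT - m `]-oo, a]%classic)%E.
  move=> finm; have fin' : (m `]-oo, a]%classic < +oo)%E.
    by apply: le_lt_trans finm; apply: le_measure; rewrite ?inE.
  by rewrite -setCitvl -setTD measureD// setTI.
apply: (@measure_unique _ R OM (@RGenOInfty.G R) (fun n : nat => `](- n%:R : R), +oo[%classic)) => //.
- exact: RGenOInfty.measurableE.
- move=> _ _ [x ->] [y ->]; exists (Num.max x y).
  by apply/seteqP; split => z /=; rewrite !in_itv /= !andbT gt_max; [by case=> -> ->|by move=> /andP].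
- by move=> n; exists (- n%:R).
- rewrite -subTset => x _; exists (Num.bound `|x|) => //=.
  rewrite in_itv /= andbT ltrNl; apply: le_lt_trans (archi_boundP (normr_ge0 x)).
  by rewrite -normrN ler_norm.
- move=> _ [a ->]; have fin2 : (m2 setT < +oo)%E by rewrite -eqT.
  by have := rayE m1 a fin; have := rayE m2 a fin2 => /= -> ->; rewrite eqT eqr.
- by move=> n; apply: le_lt_trans fin; apply: le_measure; rewrite ?inE.
Qed.

Lemma unif_ray a : 0 <= a <= 1 -> unif `]-oo, a]%classic = a%:E.
Proof.
move=> a01; rewrite unifE// (_ : _ `&` _ = `[0, a]%classic); last first.
  by apply/seteqP; split => x /=; rewrite !in_itv /=; lra.
by rewrite lebesgue_measure_itv /= lte_fin; case: ifPn => [_|]; [rewrite sube0|rewrite -leNgt => a0; congr EFin; lra].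
Qed.

Lemma unif_ray_lt0 a : a < 0 -> unif `]-oo, a]%classic = 0%E.
Proof.
move=> a01; rewrite unifE// (_ : _ `&` _ = set0) ?measure0//.
by apply/seteqP; split => x //=; rewrite !in_itv /=; lra.
Qed.

Lemma unif_ray_gt1 a : 1 < a -> unif `]-oo, a]%classic = 1%E.
Proof.
move=> a01; rewrite unifE// (_ : _ `&` _ = `[0, 1]%classic); last first.
  by apply/seteqP; split => x //=; rewrite !in_itv /=; lra.
by rewrite lebesgue_measure_itv /= lte_fin ltr01 sube0.
Qed.

Let low_prod a b :
  unif (lowset a b) = (unif `]-oo, a]%classic * unif `]-oo, b]%classic)%E.
Proof.
rewrite FE; have [a0|a0] := ltP a 0; first by rewrite Flt0l// unif_ray_lt0// mul0e.
have [b0|b0] := ltP b 0; first by rewrite Flt0r// [X in (_ * X)%E]unif_ray_lt0// mule0.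
have F1 c : 0 <= c <= 1 -> F 1 c = c by move=> c01; rewrite F_prod ?mul1r//; lra.
have [a1|a1] := leP a 1; have [b1|b1] := leP b 1.
- by rewrite F_prod ?unif_ray ?EFinM// ?a0 ?b0.
- by rewrite Fge1r ?ltW// F_marginal ?a0// [X in (_ * X)%E]unif_ray_gt1// unif_ray ?a0// mule1.
- by rewrite Fge1l ?ltW// F1 ?b0// [X in (X * _)%E]unif_ray_gt1// unif_ray ?b0// mul1e.
- by rewrite Fge1l ?ltW// Fge1r ?ltW// F1 ?ler01 ?lexx// !unif_ray_gt1// mule1.
Qed.

(** [low_prod] is the product formula on pairs of rays; uniqueness of measures extends it to Borel
    sets in one argument at a time, the other set being a parameter. *)
Lemma unif_evens_odds A B : measurable A -> measurable B ->
  unif (evens @^-1` A `&` odds @^-1` B) = (unif A * unif B)%E.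
Proof.
have mE C : measurable C -> measurable (evens @^-1` C).
  by move=> mC; rewrite -[X in measurable X]setTI; exact: measurable_evens.
have mO C : measurable C -> measurable (odds @^-1` C).
  by move=> mC; rewrite -[X in measurable X]setTI; exact: measurable_odds.
have scale (D : set OM) : measurable D -> exists k : {nonneg R}, unif D = k%:num%:E.
  move=> mD; have u0 : 0 <= fine (unif D) by rewrite fine_ge0.
  by exists (NngNum u0); rewrite /= fineK// fin_num_measure.
have fin : (unif setT < +oo)%E by rewrite probability_setT ltry.
have evens01 : evens @^-1` `]-oo, 1]%classic = setT.
  by rewrite -subTset => x _ /=; rewrite in_itv /=; have /andP[] := evens_itv x.
have odds01 : odds @^-1` `]-oo, 1]%classic = setT.
  by rewrite -subTset => x _ /=; rewrite in_itv /=; have /andP[] := evens_itv (dbl x).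
have ray1 : unif `]-oo, 1]%classic = 1%E by rewrite unif_ray// ler01 lexx.
have half b C : measurable C ->
    unif (evens @^-1` C `&` odds @^-1` `]-oo, b]%classic) =
    (unif C * unif `]-oo, b]%classic)%E.
  move=> mC; have mb := mO `]-oo, b]%classic (measurable_itv _).
  have [k kE] := scale `]-oo, b]%classic (measurable_itv _).
  rewrite kE muleC.
  pose m1 := pushm (mrestr unif mb) measurable_evens.
  pose m2 : {measure set OM -> \bar R} := mscale k unif.
  have m1E D : m1 D = unif (evens @^-1` D `&` odds @^-1` `]-oo, b]%classic) by [].
  have m2E D : m2 D = (unif `]-oo, b]%classic * unif D)%E by rewrite kE.
  rewrite -kE -m2E -m1E.
  apply: (@measure_unique_lower_rays m1 m2) => //.
  - by rewrite m1E preimage_setT setTI; apply: le_lt_trans (ltry 1); exact: probability_le1.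
  - by rewrite m1E m2E preimage_setT probability_setT mule1 -evens01 -[LHS]/(unif (lowset 1 b)) low_prod ray1 mul1e.
  - by move=> a; rewrite m1E m2E muleC -low_prod.
move=> mA mB.
have [k kE] := scale _ mA.
have mEA := mE _ mA.
pose m1 := pushm (mrestr unif mEA) measurable_odds.
pose m2 : {measure set OM -> \bar R} := mscale k unif.
have m1E D : m1 D = unif (odds @^-1` D `&` evens @^-1` A) by [].
have m2E D : m2 D = (unif A * unif D)%E by rewrite kE.
rewrite setIC -m1E -m2E.
apply: (@measure_unique_lower_rays m1 m2) => //.
- by rewrite m1E preimage_setT setTI; apply: le_lt_trans (ltry 1); exact: probability_le1.
- by rewrite m1E m2E preimage_setT probability_setT mule1 -odds01 setIC half// ray1 mule1.
- by move=> a; rewrite m1E m2E setIC half.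
Qed.

Definition digits (x : OM) : OM * OM := (evens x, odds x).

Lemma measurable_digits : measurable_fun [set: OM] digits.
Proof. by apply/measurable_fun_pair; [exact: measurable_evens|exact: measurable_odds]. Qed.

Lemma unif_digits (A : set (OM * OM)) : measurable A ->
  unif (digits @^-1` A) = (unif \x unif)%E A.
Proof.
move=> mA; rewrite -(pushmE unif measurable_digits); apply/esym.
apply: product_measure_unique => // B C mB mC.
by rewrite pushmE -unif_evens_odds.
Qed.

Lemma integral_digits (f : OM * OM -> \bar R) : measurable_fun setT f ->
  (forall z, 0 <= f z)%E ->
  (\int[unif]_x f (evens x, odds x) = \int[unif]_u \int[unif]_w f (u, w))%E.
Proof.
move=> mf f0; rewrite -(fubini_tonelli1 _ mf)//.
transitivity (\int[pushm unif measurable_digits]_z f z)%E.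
  by rewrite (ge0_integral_pushforward measurable_digits).
by apply: eq_measure_integral => A mA _ /=; rewrite -unif_digits.
Qed.

End uniform_space.

(** * Exponential variables, sampling from a finite law, sequences of independent digits *)

Section uniform_variables.
Context {R : realType}.
Local Notation OM := (measurableTypeR R).
Local Notation leb := (@lebesgue_measure R).
Local Notation P := (@unif R).

Lemma integral_probability_cst d (T : measurableType d) (Q : probability T R) (c : \bar R) :
  (\int[Q]_w c = c)%E.
Proof. by rewrite (integral_cst Q measurableT) [X in (_ * X)%E]probability_setT mule1. Qed.

(** The value 1 off the open unit interval keeps the variable positive everywhere, so that no
    holding time vanishes. *)
Definition expo (u : OM) : R := if 0 < u < 1 then - ln u else 1.

Lemma expo_gt0 u : 0 < expo u.
Proof.
rewrite /expo; case: ifP => // /andP[u0 u1].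
by rewrite oppr_gt0 ln_lt0// u0.
Qed.

Lemma measurable_expo : measurable_fun [set: OM] expo.
Proof.
apply: measurable_fun_ifT => //.
  by apply: measurable_and; apply: measurable_fun_ltr.
by apply: measurableT_comp => //; exact: measurable_ln.
Qed.

Lemma expo_tail s : 0 <= s -> P [set u | s < expo u] = (expR (- s))%:E.
Proof.
move=> s0.
have mS : measurable [set u | s < expo u].
  rewrite -[X in measurable X]setTI.
  apply: (@measurable_fun_ltr _ _ _ _ (fun=> s) expo _ _ measurableT [set true]) => //.
  exact: measurable_expo.
rewrite unifE//.
have le1 : expR (- s) <= 1 by rewrite -[leRHS]expR0 ler_expR oppr_le0.
have hS u : 0 < u < 1 -> (s < expo u) = (u < expR (- s)).
  move=> u01; rewrite /expo u01; have /andP[u0 u1] := u01.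
  by rewrite ltrNr -[u in RHS]lnK ?posrE// ltr_expR.
apply/eqP; rewrite eq_le; apply/andP; split.
  apply: (@le_trans _ _ (leb (`[0, expR (- s)[%classic `|` [set 1]))).
    apply: le_measure; rewrite ?inE//; first exact: measurableI.
      exact: measurableU.
    move=> u [/= su]; rewrite in_itv /= => /andP[u0 u1].
    have [->|n1] := eqVneq u 1; [by right|left].
    rewrite in_itv /= u0 /=; have [->|n0] := eqVneq u 0; first exact: expR_gt0.
    by rewrite -hS// lt0r n0 u0 lt_neqAle n1.
  have mco : measurable (`[0, expR (- s)[%classic : set OM) by [].
  have m1 : measurable ([set 1] : set OM) by [].
  apply: (le_trans (measureU2 leb mco m1)).
  rewrite [leLHS](_ : _ = ((expR (- s))%:E + 0)%E); [by rewrite adde0|congr (_ + _)%E].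
    by rewrite [LHS]lebesgue_measure_itv /= lte_fin expR_gt0 sube0.
  exact: lebesgue_measure_set1.
rewrite (_ : (expR (- s))%:E = leb `]0, expR (- s)[%classic); last first.
  by rewrite lebesgue_measure_itv /= lte_fin expR_gt0 sube0.
apply: le_measure; rewrite ?inE//; first exact: measurableI.
move=> u /=; rewrite !in_itv /= => /andP[u0 u1].
have u1' := lt_le_trans u1 le1.
by rewrite hS ?u0 ?u1' //= (ltW u0) (ltW u1').
Qed.

Lemma integral_powR (k : R) : 0 < k -> (\int[leb]_(u in `[0%R, 1%R]) (u `^ k)%:E = ((1 + k)^-1)%:E)%E.
Proof.
move=> k0.
pose F (u : R) := (1 + k)^-1 * u `^ (1 + k).
have k1 : 0 < 1 + k by lra.
have cp l (x : R) : 0 < x -> {for x, continuous (@powR R ^~ l : R -> R)}.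
  move=> x0; apply: differentiable_continuous; apply/derivable1_diffP.
  by apply: derivable_powR; rewrite in_itv /= x0.
have c0 l : 0 < l -> (u `^ l @[u --> (0:R)^'+] --> (0 : R) `^ l).
  by move=> l0; rewrite powR0 ?gt_eqF//; exact: powR_cvg0.
have cL l (x : R) : 0 < x -> (u `^ l @[u --> x^'-] --> x `^ l).
  by move=> x0; apply: cvg_at_left_filter; exact: cp.
rewrite (@continuous_FTC2 _ (@powR R ^~ k) F)//.
- by rewrite /F powR0 ?gt_eqF// mulr0 sube0 powR1 mulr1.
- apply/continuous_within_itvP => //; split; [|exact: c0|exact: cL].
  by move=> x; rewrite in_itv /= => /andP[x0 _]; exact: cp.
- split.
  + move=> x; rewrite in_itv /= => /andP[x0 _]; rewrite /F.
    by apply: derivableM => //; apply: derivable_powR; rewrite in_itv /= x0.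
  + by apply: cvgMr; exact: c0.
  + by apply: cvgMr; exact: cL.
- move=> x; rewrite in_itv /= => /andP[x0 _].
  rewrite derive1E; rewrite deriveM//; last by apply: derivable_powR; rewrite in_itv /= x0.
  rewrite derive_cst scaler0 addr0 -derive1E powR_derive1 ?in_itv /= ?x0//.
  by rewrite scalerA mulVf ?gt_eqF// scale1r (_ : 1 + k - 1 = k)//; lra.
Qed.

(** On the open unit interval [expo] is minus the logarithm, so the integrand is the power of
    exponent [k]. *)
Lemma laplace_expo (k : R) : 0 <= k -> (\int[P]_u (expR (- (k * expo u)))%:E = ((1 + k)^-1)%:E)%E.
Proof.
rewrite le_eqVlt => /orP[/eqP<-|k0].
  under eq_integral do rewrite mul0r oppr0 expR0.
  by rewrite integral_probability_cst addr0 invr1.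
have mf : measurable_fun [set: OM] (fun u : OM => (expR (- (k * expo u)))%:E).
  apply/measurable_EFinP; apply: measurableT_comp => //; apply: measurableT_comp => //.
  by apply: measurable_funM => //; exact: measurable_expo.
rewrite integral_uniform//.
rewrite subr0 invr1 mul1e -integral_powR//.
apply: eq_integral_itv_bounded.
- by apply/measurable_EFinP; exact: measurable_funTS.
- by apply: measurable_funTS; exact: measurable_powR.
- move=> u; rewrite in_itv /= => u01.
  by rewrite /expo u01 mulrN opprK /powR gt_eqF//; case/andP: u01.
Qed.

(** Inversion of the distribution function; [x0] is returned once the weights are exhausted, a null
    event for uniform [u] when they sum to 1. *)
Fixpoint sample (T : Type) (s : seq T) (w : T -> R) (x0 : T) (u : R) : T :=
  if s is x :: s' then if u < w x then x else sample s' w x0 (u - w x) else x0.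

Lemma measurable_sample (T : Type) d (T' : measurableType d) (f : T -> T') s w x0 a :
  measurable_fun [set: OM] (fun u : OM => f (sample s w x0 (u - a))).
Proof.
elim: s a => [|x s IH] a /=; first exact: measurable_cst.
rewrite (_ : (fun u => _) = (fun u : OM => if u - a < w x then f x
    else f (sample s w x0 (u - (a + w x))))); last first.
  by apply/funext => u; rewrite opprD addrA; case: ifP.
apply: measurable_fun_ifT => //.
by apply: measurable_fun_ltr => //; exact: measurable_funB.
Qed.

Lemma integral_sample (T : Type) (s : seq T) (w : T -> R) x0 (f : T -> \bar R) :
  (forall x, 0 <= f x)%E -> (forall x, 0 <= w x) -> \sum_(x <- s) w x = 1 ->
  (\int[P]_u f (sample s w x0 u) = \sum_(x <- s) (w x)%:E * f x)%E.
Proof.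
move=> f0 w0 w1.
have mf := @measurable_sample T _ (\bar R) f _ w x0.
have mf0 := mf s 0; rewrite (_ : (fun u : OM => _) = (fun u => f (sample s w x0 u))) in mf0;
  last by apply/funext => u; rewrite subr0.
(* The interval starts at an arbitrary [a], so that the induction can pass to what follows the first
   weight. *)
have H a : (\int[leb]_(u in `[a, (a + \sum_(x <- s) w x)%R[) f (sample s w x0 (u - a)%R)
    = \sum_(x <- s) (w x)%:E * f x)%E.
  elim: s a {w1 mf0} => [|x s IH] a /=.
    by rewrite !big_nil addr0 set_itvco0 integral_set0.
  rewrite !big_cons; set S := \sum_(x <- s) _ in IH *.
  have S0 : 0 <= S by apply: sumr_ge0.
  rewrite (@itv_bndbnd_setU _ _ (BLeft a) (BLeft (a + w x))); last 2 first.
  - by rewrite bnd_simp lerDl.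
  - by rewrite bnd_simp addrA lerDl.
  rewrite ge0_integral_setU//=; last 2 first.
  - exact: (measurable_funTS (mf (x :: s) a)).
  - apply/disj_setPS => u /=; rewrite !in_itv /= => -[/andP[_ u1] /andP[u2 _]].
    by move: u1; rewrite ltNge u2.
  congr (_ + _)%E.
    rewrite (eq_integral (fun=> f x)); last first.
      by move=> u; rewrite inE /= in_itv /= => /andP[_]; rewrite -ltrBlDl => ->.
    rewrite integral_cst// muleC; congr (_ * _)%E.
    rewrite [LHS]lebesgue_measure_itv /= lte_fin ltrDl.
    case: ltP => [_|w0']; first by rewrite -EFinB (addrC a) addrK.
    by congr EFin; apply/eqP; rewrite eq_le w0.
  rewrite addrA -(IH (a + w x)); apply: eq_integral => u.
  rewrite inE /= in_itv /= => /andP[]; rewrite -lerBrDl leNgt => /negbTE -> _.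
  by rewrite opprD addrA.
rewrite integral_uniform// subr0 invr1 mul1e -integral_itv_bndo_bndc; last exact: measurable_funTS.
have := H 0; rewrite w1 add0r => <-.
by apply: eq_integral => u _; rewrite subr0.
Qed.

(** Each [odds] leaves infinitely many binary digits, so a single uniform variable yields an
    infinite independent sequence. *)
Definition digit n (w : OM) : OM := evens (iter n odds w).

Lemma measurable_iter_odds n : measurable_fun [set: OM] (iter n odds).
Proof.
elim: n => [|n IH]; first exact: measurable_id.
by apply: measurableT_comp IH; exact: measurable_odds.
Qed.

Lemma measurable_digit n : measurable_fun [set: OM] (digit n).
Proof. by apply: measurableT_comp (measurable_iter_odds n); exact: measurable_evens. Qed.

Lemma digitS n w : digit n.+1 w = digit n (odds w).
Proof. by rewrite /digit iterSr. Qed.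

Lemma probability_digits n (A : nat -> set OM) : (forall i, measurable (A i)) ->
  P [set w | forall i, (i < n)%N -> A i (digit i w)] = (\prod_(i < n) P (A i))%E.
Proof.
elim: n A => [|n IH] A mA.
  by rewrite big_ord0 (_ : [set w | _] = setT) ?probability_setT// -subTset.
rewrite big_ord_recl -(IH (fun i => A i.+1))//.
rewrite -unif_evens_odds//.
  congr (P _); apply/seteqP; split => [w /= H|w /= [H0 H] [|i]//]; last first.
    by rewrite ltnS => /H; rewrite digitS.
  by split => [|i ni]; [exact: (H 0%N)|rewrite -digitS; exact: (H i.+1)].
have -> : [set w | forall i, (i < n)%N -> A i.+1 (digit i w)] =
    \bigcap_(i in `I_n) (digit i @^-1` A i.+1).
  by apply/seteqP; split.
apply: fin_bigcap_measurable => // i _.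
by rewrite -[X in measurable X]setTI; exact: measurable_digit.
Qed.

End uniform_variables.

(** * Topplings and the abelian property *)

Notation dir d := ('I_d * bool)%type.
Notation instr d := (option (dir d)).
Notation history d := (seq (site d * instr d)).
Notation stack d := (site d -> nat -> instr d).

Section toppling.
Variable d : nat.
Implicit Types (x y z : site d) (e : dir d) (i : instr d) (h : history d).
Implicit Types (eta : config d) (l : site d -> nat) (I : stack d).

Definition vec e : site d := if e.2 then delta_mx 0 e.1 else - delta_mx 0 e.1.

Lemma vec_inj : injective vec.
Proof.
have D (i : 'I_d) : (delta_mx 0 i : site d) 0 i = 1 by rewrite mxE !eqxx.
have D' (i j : 'I_d) : 0 <= (delta_mx 0 i : site d) 0 j by rewrite mxE; case: (_ && _).
move=> [i b] [j c]; rewrite /vec /=; case: b; case: c => E.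
- have := congr1 (fun v : site d => v 0 i) E; rewrite /= D mxE eqxx /=.
  by case: eqP => [->|].
- have := congr1 (fun v : site d => v 0 i) E; rewrite /= D !mxE.
  by case: (_ && _).
- have := congr1 (fun v : site d => v 0 j) E; rewrite /= D !mxE.
  by case: (_ && _).
- have := congr1 (fun v : site d => - v 0 i) E; rewrite /= !mxE !eqxx /= !opprK.
  by case: eqP => [->|].
Qed.

Lemma vec_neq0 e : vec e != 0.
Proof.
apply/eqP => E; have := congr1 (fun v : site d => v 0 e.1) E.
by rewrite /vec; case: e.2; rewrite !mxE !eqxx.
Qed.

Lemma addvec_neq x e : (x + vec e == x) = false.
Proof. by rewrite -subr_eq0 addrAC subrr add0r (negbTE (vec_neq0 e)). Qed.

Definition act eta x : nat := nb_active (eta x).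

Definition apply_instr x i eta : config d :=
  if i is Some e then jump x (x + vec e) eta else sleep_at x eta.

Definition run eta h := foldl (fun zeta xi => apply_instr xi.1 xi.2 zeta) eta h.

Definition cnt h x : nat := count (fun xi => xi.1 == x) h.

Definition bump l x : site d -> nat := fun y => (l y + (y == x))%N.

Fixpoint legal eta h : bool :=
  if h is (x, i) :: h' then (0 < act eta x)%N && legal (apply_instr x i eta) h' else true.

(* [h], started after [l y] topplings at each [y], uses the instructions of
   the stacks [I] in order *)
Fixpoint consistent I l h : bool :=
  if h is (x, i) :: h' then (I x (l x) == i) && consistent I (bump l x) h' else true.

Definition zero_count : site d -> nat := fun=> 0%N.

Lemma run_rcons eta h x i : run eta (rcons h (x, i)) = apply_instr x i (run eta h).
Proof. by rewrite /run -cats1 foldl_cat. Qed.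

Lemma cnt_rcons h x i : cnt (rcons h (x, i)) = bump (cnt h) x.
Proof.
by apply/funext => y; rewrite /cnt /bump -cats1 count_cat /= addn0 eq_sym.
Qed.

Lemma legal_cat eta h1 h2 : legal eta (h1 ++ h2) = legal eta h1 && legal (run eta h1) h2.
Proof. by elim: h1 eta => [|[x i] h1 IH] eta //=; rewrite IH andbA. Qed.

Lemma legal_rcons eta h x i :
  legal eta (rcons h (x, i)) = legal eta h && (0 < act (run eta h) x)%N.
Proof. by rewrite -cats1 legal_cat /= andbT. Qed.

Lemma consistent_cat I l h1 h2 :
  consistent I l (h1 ++ h2) = consistent I l h1 && consistent I (fun y => l y + cnt h1 y)%N h2.
Proof.
elim: h1 l => [|[x i] h1 IH] l /=.
  by congr (consistent I _ h2); apply/funext => y; rewrite addn0.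
rewrite IH andbA; congr (_ && consistent I _ h2); apply/funext => y.
by rewrite /bump /cnt /= eq_sym addnA.
Qed.

Lemma consistent_rcons I h x i :
  consistent I zero_count (rcons h (x, i)) = consistent I zero_count h && (I x (cnt h x) == i).
Proof. by rewrite -cats1 consistent_cat /= andbT. Qed.

(* The configuration as a function of the number [l y] of topplings performed
   at each site [y], hence independent of their order. *)
Definition arrivals I l x : nat :=
  \sum_(e : dir d) \sum_(j < l (x - vec e)%R) (I (x - vec e)%R j == Some e).
Definition departures I l x : nat := \sum_(j < l x) (I x j != None).
Definition just_slept I l x : bool := (0 < l x)%N && (I x (l x).-1 == None).
Definition occ (n : nat) (b : bool) := if (n == 1)%N && b then Sleeping else Active n.
Definition odometer_config (n0 : site d -> nat) I l : config d :=
  fun x => occ (n0 x + arrivals I l x - departures I l x) (just_slept I l x).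
(** Under this bound the truncated subtraction in [odometer_config] is exact, and a site last told
    to sleep holds at least one particle. *)
Definition admissible (n0 : site d -> nat) I l := forall x,
  (departures I l x + just_slept I l x <= n0 x + arrivals I l x)%N.

Lemma arrivals_bump I l x z : arrivals I (bump l x) z =
  (arrivals I l z + (if I x (l x) is Some e then z == (x + vec e)%R else false))%N.
Proof.
rewrite /arrivals.
have -> : (if I x (l x) is Some e then z == (x + vec e)%R else false) =
    (\sum_(e : dir d) ((z - vec e == x)%R && (I x (l x) == Some e)))%N :> nat.
  case E : (I x (l x)) => [e|]; last by rewrite big1 // => e _; rewrite andbF.
  rewrite (bigD1 e) //= eqxx andbT subr_eq big1 ?addn0// => e' ne.
  by apply/eqP; rewrite eqb0 negb_and orbC; apply/orP; left; apply: contra ne => /eqP[->].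
rewrite -big_split /=; apply: eq_bigr => e _; rewrite /bump.
case: eqP => [->|_] /=; last by rewrite !addn0.
by rewrite addn1 big_ord_recr.
Qed.

Lemma departures_bump I l x z : departures I (bump l x) z =
  (departures I l z + ((z == x) && (I x (l x) != None)))%N.
Proof.
rewrite /departures /bump; case: eqP => [->|_] /=; last by rewrite !addn0.
by rewrite addn1 big_ord_recr.
Qed.

Lemma just_slept_bump I l x z : just_slept I (bump l x) z =
  if z == x then I x (l x) == None else just_slept I l z.
Proof. by rewrite /just_slept /bump; case: eqP => [->|_]; rewrite ?addn1 ?addn0. Qed.

(** The core of the abelian property. An instruction to sleep read by several particles leaves
    [just_slept] true without effect: the number of particles cannot come down to 1 without another
    toppling there, which resets it. An arrival wakes a sleeper because the number is then at least
    2. *)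
Lemma odometer_config_bump n0 I l x : admissible n0 I l ->
  (0 < act (odometer_config n0 I l) x)%N ->
  odometer_config n0 I (bump l x) = apply_instr x (I x (l x)) (odometer_config n0 I l)
  /\ admissible n0 I (bump l x).
Proof.
move=> ok ax.
have okx := ok x.
move: ax; rewrite /act /odometer_config.
set n := (n0 x + _ - _)%N; set b := just_slept _ _ _ in okx * => ax.
have n_gt0 : (0 < n)%N by move: ax; rewrite /occ; case: ifP => //= /andP[/eqP->].
have occx : occ n b = Active n by move: ax; rewrite /occ; case: ifP.
split.
- apply/funext => z; rewrite arrivals_bump departures_bump just_slept_bump.
  have okz := ok z.
  case E : (I x (l x)) => [e|]; rewrite /= ?andbF ?andbT ?addn0.
  + rewrite /jump; case: (eqVneq z x) => [->|zx].
      by rewrite eq_sym addvec_neq -/n -/b occx /= addn0 /occ andbF /n addn1 subnS.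
    case: (eqVneq z (x + vec e)) => [<-|zy]; last by rewrite !addn0.
    rewrite !addn0 addn1.
    set m := (n0 z + _)%N in okz *; set D := departures _ _ _ in okz *.
    have -> : (n0 z + (arrivals I l z).+1 - D = (m - D).+1)%N.
      by rewrite /m; case: just_slept okz => /=; lia.
    rewrite /occ; case: just_slept okz => /=; last by rewrite !andbF.
    rewrite !andbT => okz; case: eqP => [E0|_]; first lia.
    by case: eqP => [->|_].
  + rewrite /sleep_at; case: eqP => [->|//].
    by rewrite -/n -/b occx /occ andbT /=; case: (n) => [|[|]].
- move=> z; rewrite arrivals_bump departures_bump just_slept_bump.
  have okz := ok z; case E : (I x (l x)) => [e|]; rewrite /= ?andbF ?andbT ?addn0.
  + case: (eqVneq z x) => [->|zx].
      by rewrite addn0 eq_sym addvec_neq addn0; move: n_gt0; rewrite /n; lia.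
    by rewrite addn0; lia.
  + case: (eqVneq z x) => [->|zx] //=.
    by move: n_gt0; rewrite /n; lia.
Qed.

Lemma run_odometer n0 I h : legal (fun x => Active (n0 x)) h ->
  consistent I zero_count h ->
  run (fun x => Active (n0 x)) h = odometer_config n0 I (cnt h) /\ admissible n0 I (cnt h).
Proof.
elim/last_ind: h => [_ _|h [x i] IH].
  have A x : arrivals I (cnt [::]) x = 0%N by rewrite /arrivals big1 // => e _; rewrite big_ord0.
  have D x : departures I (cnt [::]) x = 0%N by rewrite /departures big_ord0.
  split; last by move=> x; rewrite D /just_slept.
  by apply/funext => x; rewrite /odometer_config A D addn0 subn0 /just_slept /= /occ andbF.
rewrite legal_rcons consistent_rcons => /andP[lh ax] /andP[ch /eqP Ii].
have [E ok] := IH lh ch; rewrite E in ax.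
by rewrite run_rcons cnt_rcons E -Ii; have [-> ok'] := odometer_config_bump ok ax.
Qed.

(** With equal counts at [x] the departures and the last instruction there coincide, while the
    arrivals can only increase. *)
Lemma active_mono n0 n1 I l l' x :
  (forall y, (n0 y <= n1 y)%N) -> (forall y, (l y <= l' y)%N) -> l x = l' x ->
  (0 < act (odometer_config n0 I l) x)%N -> (0 < act (odometer_config n1 I l') x)%N.
Proof.
move=> n01 ll' lx; rewrite /act /odometer_config.
have -> : departures I l' x = departures I l x by rewrite /departures lx.
have -> : just_slept I l' x = just_slept I l x by rewrite /just_slept lx.
have : (arrivals I l x <= arrivals I l' x)%N.
  rewrite /arrivals; apply: leq_sum => e _.
  have F := big_mkord xpredT (fun j => I (x - vec e)%R j == Some e : nat).
  by rewrite -!F [leqRHS](big_cat_nat _ (ll' _))//= leq_addr.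
set A := arrivals I l x; set A' := arrivals I l' x; set D := departures _ _ _.
have := n01 x; rewrite /occ; case: just_slept; rewrite ?andbF ?andbT /=; last lia.
by case: eqP => // h1 h2 h3 /= h4; case: eqP => /=; lia.
Qed.

End toppling.
Arguments zero_count {d}.

(** * Stacks of instructions and the chain of configurations *)

Section more_uniform.
Context {R : realType}.
Local Notation OM := (measurableTypeR R).
Local Notation P := (@unif R).

Lemma measurable_sample_eq (T : Type) (s : seq T) (w : T -> R) x0 x :
  measurable [set u : OM | sample s w x0 u = x].
Proof.
pose f y := `[< y = x >].
have := @measurable_sample R T _ bool f s w x0 0.
rewrite (_ : (fun u : OM => _) = (fun u => f (sample s w x0 u))); last first.
  by apply/funext => u; rewrite subr0.
move=> /(_ measurableT [set true] I); rewrite setTI.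
congr measurable; apply/seteqP; split => u /=; first by move=> /asboolP.
by move=> ux; apply/asboolP.
Qed.

Lemma sample_mem (T : eqType) (s : seq T) (w : T -> R) x0 u :
  x0 \in s -> sample s w x0 u \in s.
Proof.
move=> xs; suff : sample s w x0 u \in x0 :: s by rewrite in_cons => /orP[/eqP->|].
elim: s u {xs} => [|x s IH] u /=; first by rewrite mem_head.
case: ifP => _; first by rewrite !in_cons eqxx orbT.
by have := IH (u - w x); rewrite !in_cons => /orP[->//|->]; rewrite !orbT.
Qed.

Lemma probability_sample (T : eqType) (s : seq T) (w : T -> R) x0 x :
  (forall x, 0 <= w x) -> \sum_(x <- s) w x = 1 -> uniq s -> x \in s ->
  P [set u | sample s w x0 u = x] = (w x)%:E.
Proof.
move=> w0 w1 us xs.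
have mS := @measurable_sample_eq T s w x0 x.
rewrite -[X in P X]setIT -integral_indic//.
transitivity (\int[P]_u (fun y => (y == x)%:R%:E) (sample s w x0 u))%E.
  apply: eq_integral => u _ /=; rewrite indicE; case: eqP => [ux|ux]; first by rewrite mem_set.
  by rewrite memNset.
rewrite (@integral_sample R T s w x0 (fun y => (y == x)%:R%:E))//.
rewrite (bigD1_seq x)//= eqxx mule1 big1 ?adde0// => y /negbTE->.
by rewrite mule0.
Qed.

Lemma probability_digits_with n (A : nat -> set OM) c B : (forall i, measurable (A i)) ->
  measurable B -> (c < n)%N -> A c = setT ->
  P [set w | forall i, (i < n)%N -> (if i == c then B else A i) (digit i w)] =
  (P B * P [set w | forall i, (i < n)%N -> A i (digit i w)])%E.
Proof.
move=> mA mB cn Ac.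
rewrite (@probability_digits R n (fun i => if i == c then B else A i)); last first.
  by move=> i; case: ifP.
rewrite probability_digits//.
rewrite (bigD1 (Ordinal cn))//= eqxx; congr (_ * _)%E.
rewrite [RHS](bigD1 (Ordinal cn))//= Ac [X in (X * _)%E]probability_setT mul1e.
by apply: eq_bigr => i ic; rewrite ifN.
Qed.

End more_uniform.

(** * The law of the instructions and of finite histories *)

Section instructions.
Context {R : realType} (d : nat).
Variables (p : site d -> R) (lambda : R).
Hypotheses (pJ : jump_distribution p) (lambda0 : 0 < lambda).
Implicit Types (x y z : site d) (e : dir d) (i : instr d) (h : history d).
Implicit Types (eta xi : config d).
Local Notation OM := (measurableTypeR R).
Local Notation P := (@unif R).

Definition iprob i : R :=
  if i is Some e then p (vec e) / (1 + lambda) else lambda / (1 + lambda).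

Lemma lambda1_gt0 : 0 < 1 + lambda. Proof. by rewrite addr_gt0. Qed.

Lemma iprob_ge0 i : 0 <= iprob i.
Proof.
have l1 := lambda1_gt0.
by case: i => [e|] /=; rewrite divr_ge0 ?(jump_ge0 pJ)// ltW.
Qed.

Lemma big_option (T : finType) (F : option T -> R) :
  \sum_i F i = F None + \sum_t F (Some t).
Proof.
rewrite (bigD1 None)//=; congr (_ + _).
by rewrite (reindex_omap Some id)//=; [apply: eq_bigl => t; rewrite eqxx|case].
Qed.

Lemma fsum_vec (U : nmodType) (F : site d -> U) : (forall y, p y = 0 -> F y = 0) ->
  \sum_(y \in [set: site d]) F y = \sum_e F (vec e).
Proof.
move=> F0; rewrite (fsbigE (map (@vec d) (enum {: dir d})))//=.
- rewrite big_map big_enum_cond /=; apply: eq_bigl => e; exact: in_setT.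
- by rewrite map_inj_uniq ?enum_uniq//; exact: vec_inj.
- move=> y _ yr; apply: F0; apply: contraNeq yr => py.
  have [i [->|->]] := jump_nearest pJ py.
    by apply/mapP; exists (i, true); rewrite ?mem_enum.
  by apply/mapP; exists (i, false); rewrite ?mem_enum.
Qed.

Lemma sum_jump : \sum_e p (vec e) = 1.
Proof. by rewrite -fsum_vec ?(jump_sum1 pJ). Qed.

Lemma sum_iprob : \sum_i iprob i = 1.
Proof.
rewrite big_option /= -mulr_suml sum_jump -mulrDl addrC divff// gt_eqF//.
exact: lambda1_gt0.
Qed.

Lemma ring_probE x eta xi :
  ring_prob p lambda x eta xi = \sum_i iprob i * (`[< xi = apply_instr x i eta >])%:R.
Proof.
rewrite /ring_prob big_option /=; congr (_ + _).
rewrite (reindex_fsbigT (+%R x))/=; last first.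
  by exists (fun y => y - x) => y /=; [rewrite [x + y]addrC addrK|rewrite addrC addrNK].
rewrite (fsum_vec (F := fun y => p (x + y - x) / (1 + lambda) * `[< xi = jump x (x + y) eta >]%:R)).
  by apply: eq_bigr => e _; rewrite [x + _]addrC addrK addrC.
by move=> y py; rewrite [x + y]addrC addrK py !mul0r.
Qed.

Definition instr_stack (w : OM) : stack d := fun x j =>
  sample (enum {: instr d}) iprob None (digit (choice.pickle (x, j)) w).

(** The instructions read by [h], as prescribed values at distinct indices of the sequence of
    digits; independence then gives the product formula. *)
Fixpoint constraints (l : site d -> nat) h : seq (nat * instr d) :=
  if h is (x, i) :: h' then (choice.pickle (x, l x), i) :: constraints (bump l x) h' else [::].

Lemma constraints_code l h x j : (j < l x)%N ->
  choice.pickle (x, j) \notin [seq c.1 | c <- constraints l h].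
Proof.
elim: h l => [|[y i] h IH] l jl //=; rewrite in_cons negb_or; apply/andP; split.
  by apply/eqP => /(pcan_inj pickleK_inv) [xy E]; move: jl; rewrite E xy ltnn.
by apply: IH; rewrite /bump; apply: leq_trans jl _; exact: leq_addr.
Qed.

Lemma constraints_uniq l h : uniq [seq c.1 | c <- constraints l h].
Proof.
elim: h l => [|[y i] h IH] l //=; rewrite IH andbT.
by apply: constraints_code; rewrite /bump eqxx addn1.
Qed.

Definition satisfies (cs : seq (nat * instr d)) (w : OM) :=
  forall c, c \in cs -> sample (enum {: instr d}) iprob None (digit c.1 w) = c.2.

Lemma consistentP l h w : consistent (instr_stack w) l h <-> satisfies (constraints l h) w.
Proof.
elim: h l => [|[x i] h IH] l /=; first by split => // _ c.
split => [/andP[/eqP Ii /IH S] c|S].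
  by rewrite in_cons => /orP[/eqP->//|/S].
apply/andP; split; first by apply/eqP; apply: (S (_, _)); rewrite mem_head.
by apply/IH => c ch; apply: S; rewrite in_cons ch orbT.
Qed.

Lemma probability_satisfies cs : uniq [seq c.1 | c <- cs] ->
  measurable (satisfies cs : set OM) /\ P (satisfies cs) = (\prod_(c <- cs) iprob c.2)%:E.
Proof.
pose samp (u : OM) := sample (enum {: instr d}) iprob None u.
(* The constraints are grouped by index; an index without constraint gets the full set. *)
pose A (cs : seq (nat * instr d)) (n : nat) : set OM := \bigcap_(c in [set` cs] `&` [set c | c.1 = n]) [set u | samp u = c.2].
have mA cs' n : measurable (A cs' n).
  apply: fin_bigcap_measurable; last by move=> c _; exact: measurable_sample_eq.
  by apply: finite_setI; left; exact: finite_seq.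
have AE cs' N : (forall c, c \in cs' -> (c.1 < N)%N) ->
    satisfies cs' = [set w | forall n, (n < N)%N -> A cs' n (digit n w)].
  move=> lN; apply/seteqP; split => w /= S.
    by move=> n nN c [cs'c /= <-]; exact: S.
  by move=> c cs'c; exact: (S _ (lN _ cs'c) c).
have [N lN] : exists N, forall c, c \in cs -> (c.1 < N)%N.
  exists (\max_(c <- cs) c.1).+1 => c ccs; rewrite ltnS.
  by rewrite (big_rem c)//= leq_maxl.
move=> ucs; split.
  rewrite (AE _ _ lN).
  have -> : [set w | forall n, (n < N)%N -> A cs n (digit n w)] =
    \bigcap_(n in `I_N) (digit n @^-1` A cs n) by apply/seteqP; split.
  apply: fin_bigcap_measurable => // i _.
  by rewrite -[X in measurable X]setTI; exact: measurable_digit.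
elim: cs ucs lN => [|[c i] cs IH] /= ucs lN.
  rewrite big_nil (_ : satisfies _ = setT) ?probability_setT//.
  by rewrite -subTset => w _ c.
move: ucs => /andP[cN ucs].
have lN' c' : c' \in cs -> (c'.1 < N)%N by move=> h; apply: lN; rewrite in_cons h orbT.
rewrite big_cons EFinM -IH// (AE _ _ lN) (AE _ _ lN').
rewrite -(@probability_sample _ _ (enum {: instr d}) iprob None)//; first last.
- by rewrite mem_enum.
- exact: enum_uniq.
- by rewrite big_enum /= sum_iprob.
- exact: iprob_ge0.
rewrite -(probability_digits_with (c := c))//; last 3 first.
- exact: measurable_sample_eq.
- by apply: (lN (c, i)); rewrite mem_head.
- rewrite -subTset => u _ c' [/= c'cs E]; exfalso; move/negP: cN; apply.
  by apply/mapP; exists c'.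
congr (P _); apply/seteqP; split => w /= H n nN; have := H n nN.
- case: eqP => [->|nc] Hn.
    by apply: (Hn (c, i)); split => //=; rewrite mem_head.
  by move=> c' [/= c'cs c'n]; apply: Hn; split => //=; rewrite in_cons c'cs orbT.
- case: eqP => [->|nc] Hn c' [/=].
    rewrite in_cons => /orP[/eqP->//|c'cs] c'c.
    by exfalso; move/negP: cN; apply; apply/mapP; exists c'.
  rewrite in_cons => /orP[/eqP-> /= cn|c'cs c'n]; first by rewrite cn in nc.
  by apply: Hn; split.
Qed.

Definition consistent_set h : set OM := [set w | consistent (instr_stack w) zero_count h].

Lemma measurable_consistent h : measurable (consistent_set h).
Proof.
have [m _] := probability_satisfies (constraints_uniq zero_count h).
by congr measurable: m; apply/seteqP; split => w /consistentP.
Qed.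

Definition history_prob h : R := \prod_(xi <- h) iprob xi.2.

Lemma probability_consistent h : P (consistent_set h) = (history_prob h)%:E.
Proof.
have [_ E] := probability_satisfies (constraints_uniq zero_count h).
rewrite (_ : consistent_set h = satisfies (constraints zero_count h)); last first.
  by apply/seteqP; split => w /consistentP.
rewrite E; congr EFin; rewrite /history_prob; elim: h zero_count {E} => [|[x i] h IH] l /=.
  by rewrite !big_nil.
by rewrite !big_cons IH.
Qed.

Lemma measurable_instr_stack x j i : measurable [set w : OM | instr_stack w x j = i].
Proof.
have := @measurable_digit R (choice.pickle (x, j)) measurableT _ (measurable_sample_eq (enum {: instr d}) iprob None i).
by rewrite setTI.
Qed.

End instructions.

Lemma measurable_countable_choice d d' (T : measurableType d) (T' : measurableType d')
  (C : countType) (X : T -> C) (G : C -> T -> T') :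
  (forall c, measurable [set w | X w = c]) ->
  (forall c, measurable_fun [set: T] (G c)) ->
  measurable_fun [set: T] (fun w => G (X w) w).
Proof.
move=> mX mG _ B mB; rewrite setTI.
have -> : (fun w => G (X w) w) @^-1` B =
    \bigcup_(c in [set: C]) ([set w | X w = c] `&` G c @^-1` B).
  apply/seteqP; split => [w Bw|w [c _ [<-]]//]; by exists (X w).
apply: countable_bigcupT_measurable; first exact: countableP.
move=> c; apply: measurableI => //.
by rewrite -[X in measurable X]setTI; exact: mG.
Qed.

Lemma measurable_countable_set d (T : measurableType d) (C : countType) (X : T -> C)
  (A : C -> set T) :
  (forall c, measurable [set w | X w = c]) -> (forall c, measurable (A c)) ->
  measurable [set w | A (X w) w].
Proof.
move=> mX mA.
have -> : [set w | A (X w) w] = \bigcup_(c in [set: C]) ([set w | X w = c] `&` A c).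
  apply/seteqP; split => [w Bw|w [c _ [/= <-]]//]; by exists (X w).
apply: countable_bigcupT_measurable; first exact: countableP.
by move=> c; exact: measurableI.
Qed.

Section even_odd_integral.
Context {R : realType}.
Local Notation OM := (measurableTypeR R).
Local Notation P := (@unif R).

Lemma ge0_integral_evens_odds (f g : OM -> \bar R) :
  measurable_fun setT f -> measurable_fun setT g ->
  (forall x, 0 <= f x)%E -> (forall x, 0 <= g x)%E ->
  (\int[P]_w (f (evens w) * g (odds w)) = \int[P]_w f w * \int[P]_w g w)%E.
Proof.
move=> mf mg f0 g0.
rewrite (@integral_digits R (fun z => f z.1 * g z.2)%E); last 2 first.
- by apply: emeasurable_funM; apply: measurableT_comp.
- by move=> z; rewrite mule_ge0.
under eq_integral => u _ do rewrite /= ge0_integralZl//.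
by rewrite ge0_integralZr// integral_ge0.
Qed.

Lemma ge0_integral_evens (f : OM -> \bar R) : measurable_fun setT f ->
  (forall x, 0 <= f x)%E -> (\int[P]_w f (evens w) = \int[P]_w f w)%E.
Proof.
move=> mf f0; have := @ge0_integral_evens_odds f (fun=> 1%E) mf (measurable_cst _) f0 (fun=> lee01).
rewrite integral_probability_cst mule1 => <-.
by apply: eq_integral => w _; rewrite mule1.
Qed.

Lemma ge0_integral_odds (f : OM -> \bar R) : measurable_fun setT f ->
  (forall x, 0 <= f x)%E -> (\int[P]_w f (odds w) = \int[P]_w f w)%E.
Proof.
move=> mf f0; have := @ge0_integral_evens_odds (fun=> 1%E) f (measurable_cst _) mf (fun=> lee01) f0.
rewrite integral_probability_cst mul1e => <-.
by apply: eq_integral => w _; rewrite mul1e.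
Qed.

End even_odd_integral.

(** * The chain of histories and the law of its paths *)

Section chain.
Context {R : realType} (d : nat).
Variables (p : site d -> R) (lambda : R).
Hypotheses (pJ : jump_distribution p) (lambda0 : 0 < lambda).
Implicit Types (x y : site d) (h g : history d).
Implicit Types (eta xi : config d).
Local Notation OM := (measurableTypeR R).
Local Notation P := (@unif R).
Local Notation istack := (instr_stack p lambda).
Local Notation iprob := (iprob p lambda).
Local Notation rate := (total_rate lambda).

Definition finite_active eta := finite_set [set x | act eta x != 0%N].

Definition active_sites eta : seq (site d) := fset_set [set x | act eta x != 0%N].

Lemma mem_active_sites eta x : finite_active eta -> (x \in active_sites eta) = (act eta x != 0%N).
Proof.
by move=> f; rewrite /active_sites in_fset_set//; apply/idP/idP; rewrite inE.
Qed.

Lemma finite_active_apply x i eta : finite_active eta -> finite_active (apply_instr x i eta).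
Proof.
move=> f; case: i => [e|] /=.
- apply: (@sub_finite_set _ _ ([set x | act eta x != 0%N] `|` [set x; x + vec e])).
    move=> z; rewrite /act /jump /=; case: (eqVneq z x) => [->|_]; first by right; left.
    by case: (eqVneq z (x + vec e)) => [->|_]; [right; right|left].
  by rewrite finite_setU; split => //; exact: finite_set2.
- apply: (@sub_finite_set _ _ ([set x | act eta x != 0%N] `|` [set x])).
    by move=> z; rewrite /act /sleep_at /=; case: (eqVneq z x) => [->|_]; [right|left].
  by rewrite finite_setU; split => //; exact: finite_set1.
Qed.

Lemma finite_active_run eta h : finite_active eta -> finite_active (run eta h).
Proof.
elim/last_ind: h => [//|h [x i] IH] /IH f.
by rewrite run_rcons; exact: finite_active_apply.
Qed.

Lemma clock_rate_ge0 eta x : 0 <= clock_rate lambda eta x.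
Proof. by rewrite /clock_rate mulr_ge0// ltW// lambda1_gt0. Qed.

Lemma total_rateE eta : finite_active eta ->
  rate eta = \sum_(x <- active_sites eta) clock_rate lambda eta x.
Proof.
move=> f; rewrite /total_rate (fsbigE (active_sites eta))//=.
- by apply: eq_bigl => x; rewrite in_setT.
- exact: fset_uniq.
- move=> x _; rewrite mem_active_sites// negbK /clock_rate => /eqP.
  by rewrite /act => ->; rewrite mulr0.
Qed.

Lemma total_rate_ge0 eta : 0 <= rate eta.
Proof. by apply: fsumr_ge0 => x _; exact: clock_rate_ge0. Qed.

Definition site_weight eta x : R := clock_rate lambda eta x / rate eta.

Lemma site_weight_ge0 eta x : 0 <= site_weight eta x.
Proof. by rewrite divr_ge0 ?clock_rate_ge0// total_rate_ge0. Qed.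

Lemma sum_site_weight eta : finite_active eta -> rate eta != 0 ->
  \sum_(x <- active_sites eta) site_weight eta x = 1.
Proof. by move=> f r0; rewrite -mulr_suml -total_rateE// divff. Qed.

Lemma step_probE eta xi : finite_active eta ->
  step_prob p lambda eta xi =
  if rate eta == 0 then (`[< xi = eta >])%:R
  else \sum_(x <- active_sites eta) site_weight eta x *
         \sum_i iprob i * (`[< xi = apply_instr x i eta >])%:R.
Proof.
move=> f; rewrite /step_prob; case: ifP => // _.
rewrite (fsbigE (active_sites eta))//=.
- apply: eq_big => x; first by rewrite in_setT.
  by move=> _; rewrite ring_probE.
- exact: fset_uniq.
- move=> x _; rewrite mem_active_sites// negbK /clock_rate => /eqP.
  by rewrite /act => ->; rewrite mulr0 !mul0r.
Qed.

Section from_config.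
Variable eta0 : config d.
Hypothesis fin0 : finite_active eta0.

Let fin h : finite_active (run eta0 h) := @finite_active_run eta0 h fin0.

(** Taking an active site as default makes the chosen site active for every [u], and not only almost
    surely, when the rate is nonzero. *)
Definition next_site h (u : OM) : site d :=
  sample (active_sites (run eta0 h)) (site_weight (run eta0 h))
    (head 0 (active_sites (run eta0 h))) u.

Lemma next_site_active h u : rate (run eta0 h) != 0 -> next_site h u \in active_sites (run eta0 h).
Proof.
rewrite total_rateE// /next_site; case: (active_sites _) => [|x s] r0.
  by rewrite big_nil eqxx in r0.
by apply: (@sample_mem _ _ (x :: s)); rewrite mem_head.
Qed.

(** The state is the history and not the configuration, because the next unread instruction of a
    stack depends on the number of past topplings. *)
Definition next_history (w1 : OM) h (u : OM) : history d :=
  if rate (run eta0 h) == 0 then h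
  else rcons h (next_site h u, istack w1 (next_site h u) (cnt h (next_site h u))).

Lemma measurable_next h g : measurable [set w : OM * OM | next_history w.1 h w.2 = g].
Proof.
rewrite /next_history; case r0: (rate (run eta0 h) == 0).
  by have [->|hg] := eqVneq h g; [rewrite (_ : [set _ | _] = setT) -?subTset|
     rewrite (_ : [set _ | _] = set0) -?subset0// => w /eqP; rewrite (negbTE hg)].
have mx x : measurable [set w : OM * OM | next_site h w.2 = x].
  have := @measurable_snd _ _ OM OM measurableT _ (measurable_sample_eq (active_sites (run eta0 h)) (site_weight (run eta0 h)) (head 0 (active_sites (run eta0 h))) x).
  by rewrite setTI.
pose A x := [set w : OM * OM | rcons h (x, istack w.1 x (cnt h x)) = g].
apply: (measurable_countable_set (A := A) mx) => x.
pose B i := [set w : OM * OM | rcons h (x, i) = g].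
apply: (measurable_countable_set (A := B) (X := fun w => istack w.1 x (cnt h x))) => i.
  have := @measurable_fst _ _ OM OM measurableT _ (measurable_instr_stack p lambda x (cnt h x) i).
  by rewrite setTI.
rewrite /B; have [->|hg] := eqVneq (rcons h (x, i)) g.
  by rewrite (_ : [set _ | _] = setT) -?subTset.
by rewrite (_ : [set _ | _] = set0) -?subset0// => w /eqP; rewrite (negbTE hg).
Qed.

(* One step of the chain when the stacks of instructions are fixed. *)
Lemma integral_next w1 h (phi : OM -> \bar R) (G : history d -> OM -> \bar R) :
  measurable_fun setT phi -> (forall u, 0 <= phi u)%E ->
  (forall g, measurable_fun setT (G g)) -> (forall g w, 0 <= G g w)%E ->
  (\int[P]_w (phi (evens (odds w)) * G (next_history w1 h (evens w)) (odds (odds w))) =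
   \int[P]_w phi w *
     (if rate (run eta0 h) == 0%R then \int[P]_w G h w
      else \sum_(x <- active_sites (run eta0 h)) (site_weight (run eta0 h) x)%:E *
             \int[P]_w G (rcons h (x, istack w1 x (cnt h x))) w))%E.
Proof.
move=> mphi phi0 mG G0; rewrite /next_history; have [r0|r0] := eqVneq (rate (run eta0 h)) 0.
  rewrite (@integral_digits R (fun z => phi (evens z.2) * G h (odds z.2))%E); last 2 first.
  - apply: emeasurable_funM; apply: measurableT_comp => //.
      by apply: measurableT_comp => //; exact: measurable_evens.
    by apply: measurableT_comp => //; exact: measurable_odds.
  - by move=> z; rewrite mule_ge0.
  by rewrite /= integral_probability_cst ge0_integral_evens_odds.
pose K x := rcons h (x, istack w1 x (cnt h x)).
rewrite (@integral_digits R (fun z => phi (evens z.2) * G (K (next_site h z.1)) (odds z.2))%E); last 2 first.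
- apply: emeasurable_funM.
    do 2 apply: measurableT_comp => //.
    exact: measurable_evens.
  apply: (measurable_countable_choice (X := fun z : OM * OM => next_site h z.1) (G := fun x z => G (K x) (odds z.2))).
    move=> x; have := @measurable_fst _ _ OM OM measurableT _ (measurable_sample_eq (active_sites (run eta0 h)) (site_weight (run eta0 h)) (head 0 (active_sites (run eta0 h))) x).
    by rewrite setTI.
  move=> x; apply: measurableT_comp => //.
  by apply: measurableT_comp => //; exact: measurable_odds.
- by move=> z; rewrite mule_ge0.
under eq_integral => u _ do rewrite /= ge0_integral_evens_odds//.
rewrite (@integral_sample R _ _ _ (head 0 (active_sites (run eta0 h))) (fun x => \int[P]_x0 phi x0 * \int[P]_w G (K x) w)%E).
- rewrite ge0_sume_distrr; last by move=> x _; rewrite mule_ge0 ?lee_fin ?site_weight_ge0// integral_ge0.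
  by apply: eq_bigr => x _; rewrite muleCA.
- by move=> x; rewrite mule_ge0// integral_ge0.
- exact: site_weight_ge0.
- exact: sum_site_weight.
Qed.

(** The stacks, in the first coordinate, are never consumed; a step uses up two digits of the
    second, one for the site and one for the holding time. *)
Definition tail2 (w : OM * OM) : OM * OM := (w.1, odds (odds w.2)).

Lemma measurable_tail2 : measurable_fun setT tail2.
Proof.
apply/measurable_fun_pair => //=; apply: measurableT_comp; first exact: measurable_odds.
by apply: measurableT_comp => //; exact: measurable_odds.
Qed.

Fixpoint hist n h (w : OM * OM) : history d :=
  if n is m.+1 then hist m (next_history w.1 h (evens w.2)) (tail2 w) else h.

Definition hold h (w : OM * OM) : \bar R :=
  if rate (run eta0 h) == 0 then +oo%E
  else (expo (evens (odds w.2)) / rate (run eta0 h))%:E.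

Fixpoint holding n h (w : OM * OM) : \bar R :=
  if n is m.+1 then holding m (next_history w.1 h (evens w.2)) (tail2 w) else hold h w.

Lemma measurable_next_evens h g :
  measurable [set w : OM * OM | next_history w.1 h (evens w.2) = g].
Proof.
have m : measurable_fun setT (fun w : OM * OM => (w.1, evens w.2)).
  by apply/measurable_fun_pair => //=; apply: measurableT_comp => //; exact: measurable_evens.
by have := m measurableT _ (measurable_next h g); rewrite setTI.
Qed.

Lemma measurable_hist n h g : measurable [set w | hist n h w = g].
Proof.
elim: n h => [|n IH] h /=.
  have [->|hg] := eqVneq h g; first by rewrite (_ : [set _ | _] = setT) -?subTset.
  by rewrite (_ : [set _ | _] = set0) -?subset0// => w /eqP; rewrite (negbTE hg).
apply: (measurable_countable_set (X := fun w : OM * OM => next_history w.1 h (evens w.2))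
  (A := fun c => [set w | hist n c (tail2 w) = g])); first exact: measurable_next_evens.
by move=> c; have := measurable_tail2 measurableT (IH c); rewrite setTI.
Qed.

Lemma measurable_hold h : measurable_fun setT (hold h).
Proof.
rewrite /hold; case: (rate _ == 0); first exact: measurable_cst.
apply/measurable_EFinP; apply: measurable_funM => //.
do 2 (apply: measurableT_comp; first by [exact: measurable_expo|exact: measurable_evens]).
by apply: measurableT_comp => //; exact: measurable_odds.
Qed.

Lemma measurable_holding n h : measurable_fun setT (holding n h).
Proof.
elim: n h => [|n IH] h /=; first exact: measurable_hold.
apply: (measurable_countable_choice (X := fun w : OM * OM => next_history w.1 h (evens w.2))
  (G := fun c w => holding n c (tail2 w))); first exact: measurable_next_evens.
by move=> c; apply: measurableT_comp => //; exact: measurable_tail2.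
Qed.

Lemma holding_gt0 n h w : (0 < holding n h w)%E.
Proof.
elim: n h w => [|n IH] h w /=; last exact: IH.
rewrite /hold; case: ifPn => // r0.
by rewrite lte_fin divr_gt0// ?expo_gt0// lt0r r0 total_rate_ge0.
Qed.

(** Restricting an integral to the stacks that agree with [h] makes the next instruction fresh; by
    [cind_split] the integral then branches over its possible values. *)
Definition cind h (w : OM) : \bar R := (\1_(consistent_set p lambda h) w)%:E.

Lemma cindE h w : cind h w = ((consistent (istack w) zero_count h)%:R)%:E.
Proof.
rewrite /cind indicE (_ : (_ \in _) = consistent (istack w) zero_count h)//.
by apply/idP/idP; rewrite inE.
Qed.

Lemma measurable_cind h : measurable_fun setT (cind h).
Proof. by apply/measurable_EFinP; apply: measurable_indic; exact: measurable_consistent. Qed.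

Lemma cind_rcons h x w i :
  cind (rcons h (x, i)) w = if istack w x (cnt h x) == i then cind h w else 0%E.
Proof.
rewrite !cindE consistent_rcons.
by case: eqP => _; rewrite ?andbT ?andbF.
Qed.

Lemma cind_split h x w (K : instr d -> \bar R) :
  (cind h w * K (istack w x (cnt h x)) =
   \sum_(i : instr d) cind (rcons h (x, i)) w * K i)%E.
Proof.
rewrite (bigD1 (istack w x (cnt h x)))//= cind_rcons eqxx big1 ?adde0// => i.
by rewrite cind_rcons eq_sym => /negbTE->; rewrite mul0e.
Qed.

Definition joint_integral (F : OM * OM -> \bar R) : \bar R :=
  (\int[P]_u \int[P]_w F (u, w))%E.

(* One step of the chain when the instructions read so far are those of [h]. *)
Lemma joint_integral_next h (phi : OM -> \bar R) (G : history d -> OM * OM -> \bar R) :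
  measurable_fun setT phi -> (forall u, 0 <= phi u)%E ->
  (forall g, measurable_fun setT (G g)) -> (forall g w, 0 <= G g w)%E ->
  joint_integral (fun w => cind h w.1 * (phi (evens (odds w.2)) *
     G (next_history w.1 h (evens w.2)) (tail2 w)))%E =
  (\int[P]_w phi w *
     (if rate (run eta0 h) == 0%R then joint_integral (fun w => cind h w.1 * G h w)
      else \sum_(x <- active_sites (run eta0 h)) (site_weight (run eta0 h) x)%:E *
           \sum_(i : instr d) joint_integral (fun w => cind (rcons h (x, i)) w.1 * G (rcons h (x, i)) w)))%E.
Proof.
move=> mphi phi0 mG G0; rewrite /joint_integral.
pose GI g u := (\int[P]_w G g (u, w))%E.
have mGI g : measurable_fun setT (GI g) by apply: measurable_fun_fubini_tonelli_F.
have GI0 g u : (0 <= GI g u)%E by apply: integral_ge0.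
have c0 g u : (0 <= cind g u)%E by rewrite lee_fin.
have mpair (u : OM) : measurable_fun setT (fun w : OM => (u, w)) by apply/measurable_fun_pair.
have cGI g u : (\int[P]_w (cind g u * G g (u, w)) = cind g u * GI g u)%E.
  by rewrite ge0_integralZl//; apply: measurableT_comp.
pose S u := (if rate (run eta0 h) == 0%R then GI h u
  else \sum_(x <- active_sites (run eta0 h)) (site_weight (run eta0 h) x)%:E *
         GI (rcons h (x, istack u x (cnt h x))) u)%E.
have inner u : (\int[P]_w (cind h u * (phi (evens (odds w)) *
    G (next_history u h (evens w)) (tail2 (u, w)))) = \int[P]_w phi w * (cind h u * S u))%E.
  rewrite ge0_integralZl//; last 2 first.
  - apply: emeasurable_funM => /=.
      apply: measurableT_comp => //; apply: measurableT_comp; first exact: measurable_evens.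
      exact: measurable_odds.
    apply: (measurable_countable_choice (X := fun w : OM => next_history u h (evens w))
      (G := fun c w => G c (tail2 (u, w)))).
      move=> c; have := mpair u measurableT _ (measurable_next_evens h c).
      by rewrite setTI.
    move=> c; apply: measurableT_comp => //; apply: measurableT_comp => //.
    exact: measurable_tail2.
  - by move=> w _; rewrite mule_ge0.
  rewrite (@integral_next u h phi (fun g w => G g (u, w)))//; last first.
    by move=> g; apply: measurableT_comp.
  by rewrite muleCA.
have SE u : (cind h u * S u = if rate (run eta0 h) == 0%R then cind h u * GI h u
    else \sum_(x <- active_sites (run eta0 h)) (site_weight (run eta0 h) x)%:E *
         \sum_(i : instr d) cind (rcons h (x, i)) u * GI (rcons h (x, i)) u)%E.
  rewrite /S; case: ifP => // _.
  rewrite ge0_sume_distrr; last by move=> x _; rewrite mule_ge0 ?lee_fin ?site_weight_ge0.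
  apply: eq_bigr => x _; rewrite muleCA.
  by rewrite (cind_split h x u (fun i => GI (rcons h (x, i)) u)).
have mcGI g : measurable_fun setT (fun u => cind g u * GI g u)%E.
  by apply: emeasurable_funM => //; exact: measurable_cind.
under eq_integral => u _ do rewrite inner SE.
case: (rate (run eta0 h) == 0%R).
  rewrite ge0_integralZl//; [|by move=> u _; exact: mule_ge0|exact: integral_ge0].
  by congr (_ * _)%E; apply: eq_integral => u _; rewrite cGI.
have m1 x : measurable_fun setT (fun u => \sum_(i : instr d)
    cind (rcons h (x, i)) u * GI (rcons h (x, i)) u)%E.
  by apply: emeasurable_sum => i.
have p1 x u : (0 <= \sum_(i : instr d) cind (rcons h (x, i)) u * GI (rcons h (x, i)) u)%E.
  by apply: sume_ge0 => i _; exact: mule_ge0.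
have w0 x : (0 <= (site_weight (run eta0 h) x)%:E)%E by rewrite lee_fin site_weight_ge0.
rewrite ge0_integralZl//; last 3 first.
- by apply: emeasurable_sum => x; apply: emeasurable_funM.
- by move=> u _; apply: sume_ge0 => x _; exact: mule_ge0.
- exact: integral_ge0.
congr (_ * _)%E.
rewrite ge0_integral_sum//; last 2 first.
- by move=> x; apply: emeasurable_funM.
- by move=> x u _; exact: mule_ge0.
apply: eq_bigr => x _; rewrite ge0_integralZl//; congr (_ * _)%E.
rewrite ge0_integral_sum//; last by move=> i u _; exact: mule_ge0.
by apply: eq_bigr => i _; apply: eq_integral => u _; rewrite cGI.
Qed.

Lemma measurable_run n h a : measurable [set w | run eta0 (hist n h w) = a].
Proof.
apply: (measurable_countable_set (X := hist n h) (A := fun g => [set w | run eta0 g = a])).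
  exact: measurable_hist.
move=> g; have [ra|ra] := pselect (run eta0 g = a).
  by rewrite (_ : [set _ | _] = setT) -?subTset.
by rewrite (_ : [set _ | _] = set0) -?subset0.
Qed.

Definition path_event n h (a : nat -> config d) (s : nat -> R) : set (OM * OM) :=
  [set w | forall i, (i <= n)%N ->
     run eta0 (hist i h w) = a i /\ ((s i)%:E < holding i h w)%E].

Lemma measurable_path_event n h a s : measurable (path_event n h a s).
Proof.
have -> : path_event n h a s = \bigcap_(i in `I_n.+1)
    ([set w | run eta0 (hist i h w) = a i] `&` [set w | ((s i)%:E < holding i h w)%E]).
  by apply/seteqP; split => w H i ni; exact: (H i ni).
apply: fin_bigcap_measurable => // i _; apply: measurableI; first exact: measurable_run.
rewrite -[X in measurable X]setTI; apply: emeasurable_fun_o_infty => //.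
exact: measurable_holding.
Qed.

Definition survive h (s : R) (u : OM) : bool :=
  (rate (run eta0 h) == 0) || (s * rate (run eta0 h) < expo u).

Lemma measurable_survive h s : measurable [set u | survive h s u].
Proof.
rewrite /survive; case: (rate (run eta0 h) == 0) => /=.
  by rewrite (_ : [set _ | _] = setT) -?subTset.
rewrite -[X in measurable X]setTI.
by apply: (measurable_fun_ltr (measurable_cst _) measurable_expo measurableT (Y := [set true])).
Qed.

Lemma surviveE h s w : survive h s (evens (odds w.2)) = (s%:E < hold h w)%E.
Proof.
rewrite /survive /hold; have [r0|r0] := eqVneq (rate (run eta0 h)) 0 => /=.
  by rewrite ltry.
by rewrite lte_fin ltr_pdivlMr// lt0r r0 total_rate_ge0.
Qed.

Lemma probability_survive h s : 0 <= s ->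
  P [set u | survive h s u] = (expR (- rate (run eta0 h) * s))%:E.
Proof.
move=> s0; rewrite /survive; have [->|r0] := eqVneq (rate (run eta0 h)) 0 => /=.
  by rewrite oppr0 mul0r expR0 (_ : [set _ | _] = setT) ?probability_setT// -subTset.
by rewrite expo_tail ?mulr_ge0 ?total_rate_ge0// mulNr mulrC.
Qed.

Definition survival_ind h s u : \bar R := (\1_[set u | survive h s u] u)%:E.

Lemma survival_indE h s u : survival_ind h s u = (survive h s u)%:R%:E.
Proof.
rewrite /survival_ind indicE (_ : (_ \in _) = survive h s u)//.
by apply/idP/idP; rewrite inE.
Qed.

Lemma measurable_survival_ind h s : measurable_fun setT (survival_ind h s).
Proof. by apply/measurable_EFinP; apply: measurable_indic; exact: measurable_survive. Qed.

Lemma integral_survival_ind h s : 0 <= s ->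
  (\int[P]_u survival_ind h s u = (expR (- rate (run eta0 h) * s))%:E)%E.
Proof.
move=> s0; rewrite integral_indic ?setIT; [exact: probability_survive|by []|].
exact: measurable_survive.
Qed.

Definition path_ind n h a s (w : OM * OM) : \bar R := (\1_(path_event n h a s) w)%:E.

Lemma path_ind0 h a s w : path_ind 0 h a s w =
  ((`[< run eta0 h = a 0%N >])%:R%:E * survival_ind h (s 0%N) (evens (odds w.2)))%E.
Proof.
have E : (w \in path_event 0 h a s) =
    `[< run eta0 h = a 0%N >] && survive h (s 0%N) (evens (odds w.2)).
  rewrite surviveE; apply/idP/idP; rewrite ?inE /path_event /=.
    by move=> /(_ 0%N isT) /= [/asboolP ->].
  by move=> /andP[/asboolP ra sh] [|i].
by rewrite /path_ind indicE E survival_indE -EFinM -natrM mulnb.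
Qed.

Lemma path_indS n h a s w : path_ind n.+1 h a s w =
  ((`[< run eta0 h = a 0%N >])%:R%:E * (survival_ind h (s 0%N) (evens (odds w.2)) *
    path_ind n (next_history w.1 h (evens w.2)) (fun i => a i.+1) (fun i => s i.+1) (tail2 w)))%E.
Proof.
set g := next_history _ _ _; set a' := fun i => a i.+1; set s' := fun i => s i.+1.
have E : (w \in path_event n.+1 h a s) = [&& `[< run eta0 h = a 0%N >],
    survive h (s 0%N) (evens (odds w.2)) & tail2 w \in path_event n g a' s'].
  rewrite surviveE; apply/idP/idP; rewrite ?inE /path_event /=.
    move=> H; have [/asboolP-> ->] /= := H 0%N isT.
    by rewrite inE /= => i ni; exact: (H i.+1 ni).
  by move=> /and3P[/asboolP ra sh]; rewrite inE /= => H [|i] ni //; exact: H.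
by rewrite /path_ind !indicE E survival_indE -!EFinM -!natrM !mulnb.
Qed.

Lemma eq_joint_integral F G : (forall w, F w = G w) -> joint_integral F = joint_integral G.
Proof. by move=> FG; congr joint_integral; apply/funext. Qed.

Lemma joint_integral0 : joint_integral (fun=> 0%E) = 0%E.
Proof. by rewrite /joint_integral integral_probability_cst integral_probability_cst. Qed.

Lemma joint_integral_prod (f g : OM -> \bar R) :
  measurable_fun setT f -> measurable_fun setT g ->
  (forall u, 0 <= f u)%E -> (forall u, 0 <= g u)%E ->
  joint_integral (fun w => f w.1 * g w.2)%E = (\int[P]_u f u * \int[P]_u g u)%E.
Proof.
move=> mf mg f0 g0; rewrite /joint_integral.
transitivity (\int[P]_u (f u * \int[P]_w g w))%E.
  by apply: eq_integral => u _; rewrite /= ge0_integralZl.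
by rewrite ge0_integralZr// integral_ge0.
Qed.

Lemma integral_cind h : (\int[P]_u cind h u = (history_prob p lambda h)%:E)%E.
Proof.
rewrite integral_indic// ?setIT; first exact: probability_consistent.
exact: measurable_consistent.
Qed.

Lemma cind_ge0 h u : (0 <= cind h u)%E. Proof. by rewrite lee_fin. Qed.

Lemma history_prob_rcons h x i :
  history_prob p lambda (rcons h (x, i)) = history_prob p lambda h * iprob i.
Proof. by rewrite /history_prob -cats1 big_cat big_seq1. Qed.

(** Stated from any history, weighted by the probability of its instructions, so that the induction
    can append a toppling; the empty history gives the law required by [finite_system]. *)
Lemma joint_integral_path n h a s : (forall i, 0 <= s i) ->
  joint_integral (fun w => cind h w.1 * path_ind n h a s w)%E =
  (history_prob p lambda h * ((`[< run eta0 h = a 0%N >])%:R *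
    (\prod_(i < n) step_prob p lambda (a i) (a i.+1) *
    \prod_(i < n.+1) expR (- rate (a i) * s i))))%:E.
Proof.
move=> s0.
have Z m g b r : run eta0 g <> b 0%N ->
    joint_integral (fun w => cind g w.1 * path_ind m g b r w)%E = 0%E.
  move=> rb; rewrite -joint_integral0; apply: eq_joint_integral => w.
  by case: m => [|m]; rewrite ?path_ind0 ?path_indS asboolF// mul0e mule0.
have [ra|ra] := pselect (run eta0 h = a 0%N); last by rewrite Z// asboolF// mul0r mulr0.
elim: n h a s s0 ra => [|n IH] h a s s0 ra.
  rewrite asboolT// big_ord0 mul1r mul1r big_ord1.
  rewrite (@eq_joint_integral _ (fun w => cind h w.1 * survival_ind h (s 0%N) (evens (odds w.2)))%E); last first.
    by move=> w; rewrite path_ind0 asboolT// mul1e.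
  have mS := measurable_survival_ind h (s 0%N).
  have S0 u : (0 <= survival_ind h (s 0%N) u)%E by rewrite lee_fin.
  have mE := @measurable_evens R; have mO := @measurable_odds R.
  rewrite (@joint_integral_prod (cind h) (fun w2 => survival_ind h (s 0%N) (evens (odds w2)))).
  - rewrite integral_cind EFinM; congr (_ * _)%E.
    rewrite -ra -integral_survival_ind//.
    rewrite (@ge0_integral_odds _ (survival_ind h (s 0%N) \o evens)); last 2 first.
    - exact: measurableT_comp.
    - by move=> u; exact: S0.
    exact: ge0_integral_evens.
  - exact: measurable_cind.
  - by apply: measurableT_comp => //; exact: measurableT_comp.
  - exact: cind_ge0.
  - by [].
pose a' i := a i.+1; pose s' i := s i.+1.
have s'0 i : 0 <= s' i by exact: s0.
rewrite (@eq_joint_integral _ (fun w => cind h w.1 * (survival_ind h (s 0%N) (evens (odds w.2)) *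
    path_ind n (next_history w.1 h (evens w.2)) a' s' (tail2 w)))%E); last first.
  by move=> w; rewrite path_indS asboolT// mul1e.
rewrite (@joint_integral_next h _ (fun g => path_ind n g a' s')); last 4 first.
- exact: measurable_survival_ind.
- by move=> u; rewrite lee_fin.
- by move=> g; apply/measurable_EFinP; apply: measurable_indic; exact: measurable_path_event.
- by move=> g w; rewrite lee_fin.
rewrite integral_survival_ind// ra asboolT// mul1r.
have IH' g : joint_integral (fun w => cind g w.1 * path_ind n g a' s' w)%E =
  (history_prob p lambda g * ((`[< run eta0 g = a 1%N >])%:R *
    (\prod_(i < n) step_prob p lambda (a i.+1) (a i.+2) *
    \prod_(i < n.+1) expR (- rate (a i.+1) * s i.+1))))%:E.
  have [rg|rg] := pselect (run eta0 g = a' 0%N); first by rewrite IH.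
  by rewrite Z// asboolF// mul0r mulr0.
rewrite big_ord_recl [X in _ * (_ * X)]big_ord_recl.
rewrite step_probE//; last by rewrite -ra.
rewrite /=.
set E0 := expR _; set PS := \prod_(i < n) _; set PE := \prod_(i < n.+1) _.
case: ifP => r0.
  rewrite IH' ra -EFinM; congr EFin.
  rewrite -/PS -/PE (_ : `[< a 0%N = a 1%N >] = `[< a 1%N = a 0%N >]); last first.
    by apply: asbool_equiv_eq; split => ->.
  by ring.
under eq_bigr => x _ do under eq_bigr => i _ do rewrite IH' run_rcons history_prob_rcons /= ra.
under eq_bigr => x _ do rewrite sumEFin -EFinM.
rewrite sumEFin -EFinM; congr EFin.
rewrite -/PS -/PE.
transitivity (E0 * (\sum_(x <- active_sites (a 0%N)) site_weight (a 0%N) x *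
    \sum_i iprob i * `[< a 1%N = apply_instr x i (a 0%N) >]%:R) *
    (history_prob p lambda h * (PS * PE))); last by ring.
rewrite -mulrA mulr_suml; congr (_ * _); apply: eq_bigr => x _.
rewrite -mulrA mulr_suml; congr (_ * _); apply: eq_bigr => i _.
rewrite (_ : `[< a 1%N = apply_instr x i (a 0%N) >] = `[< apply_instr x i (a 0%N) = a 1%N >]).
  by ring.
by apply: asbool_equiv_eq; split => ->.
Qed.

End from_config.
End chain.

(** * The finite system *)

Section mixture.
Context {R : realType} (d : nat).
Variables (L : nat) (conf : nat -> config d).

Let w0 : 0 <= (L.+1%:R^-1 : R). Proof. by rewrite invr_ge0. Qed.

Definition mixture : set (configM d) -> \bar R :=
  mscale (NngNum w0) (msum (fun j => \d_(conf j : configM d)) L.+1).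

HB.instance Definition _ := Measure.on mixture.

Lemma mixtureE (A : set (configM d)) :
  mixture A = (\sum_(j < L.+1) (L.+1%:R^-1)%:E * (\1_A (conf j))%:E)%E.
Proof.
rewrite /mixture /mscale /= /msum ge0_sume_distrr//.
Qed.

Lemma mixture_setT : mixture setT = 1%E.
Proof.
rewrite mixtureE; under eq_bigr => j _ do rewrite indicT mule1.
rewrite sumEFin big_const_ord iter_addr_0 -[_ *+ _]mulr_natr mulVf//.
Qed.

HB.instance Definition _ := Measure_isProbability.Build _ _ _ mixture mixture_setT.

End mixture.

Section construction.
Context {R : realType} (d : nat).
Variables (p : site d -> R) (lambda : R).
Hypotheses (pJ : jump_distribution p) (lambda0 : 0 < lambda).
Variables (L : nat) (conf : nat -> config d) (V : {fset site d}).
Implicit Types (x y : site d) (h g : history d).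
Local Notation OM := (measurableTypeR R).
Local Notation P := (@unif R).
Local Notation rate := (total_rate lambda).
Local Notation Q := (P \x P)%E.

Let w0 : 0 <= (L.+1%:R^-1 : R). Proof. by rewrite invr_ge0. Qed.

Definition start_config j : config d := restrict V (conf j).

Lemma finite_active_init j : finite_active (start_config j).
Proof.
apply: (@sub_finite_set _ _ [set` V]); last exact: finite_fset.
by move=> x /=; rewrite /act /start_config /restrict; case: ifP.
Qed.

Definition choice_of (u : OM) : nat := sample (iota 0 L.+1) (fun=> L.+1%:R^-1 : R) 0%N u.

Definition start (w : OM * OM) : OM * OM := (w.1, odds w.2).

Lemma measurable_start : measurable_fun setT start.
Proof.
by apply/measurable_fun_pair => //=; apply: measurableT_comp => //; exact: measurable_odds.
Qed.

Lemma measurable_choice j : measurable [set w : OM * OM | choice_of (evens w.2) = j].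
Proof.
have m : measurable_fun setT (fun w : OM * OM => evens w.2).
  by apply: measurableT_comp => //; exact: measurable_evens.
by have := m measurableT _ (measurable_sample_eq (iota 0 L.+1) (fun=> L.+1%:R^-1 : R) 0%N j); rewrite setTI.
Qed.

Lemma joint_integral_start (F : nat -> OM * OM -> \bar R) :
  (forall j, measurable_fun setT (F j)) -> (forall j w, 0 <= F j w)%E ->
  joint_integral (fun w => F (choice_of (evens w.2)) (start w)) =
  (\sum_(j < L.+1) (L.+1%:R^-1)%:E * joint_integral (F j))%E.
Proof.
move=> mF F0; rewrite /joint_integral.
have mpair (u : OM) : measurable_fun setT (fun w : OM => (u, w)) by apply/measurable_fun_pair.
have inner (u : OM) : (\int[P]_w F (choice_of (evens w)) (u, odds w) =
    \sum_(j < L.+1) (L.+1%:R^-1)%:E * \int[P]_w F j (u, w))%E.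
  rewrite (@integral_digits R (fun z => F (choice_of z.1) (u, z.2))); last 2 first.
  - apply: (measurable_countable_choice (X := fun z : OM * OM => choice_of z.1)
      (G := fun j z => F j (u, z.2))).
      move=> j; have := @measurable_fst _ _ OM OM measurableT _ (measurable_sample_eq (iota 0 L.+1) (fun=> L.+1%:R^-1 : R) 0%N j).
      by rewrite setTI.
    by move=> j; apply: measurableT_comp => //; apply: measurableT_comp.
  - by move=> z.
  rewrite (@integral_sample R _ (iota 0 L.+1) (fun=> L.+1%:R^-1) 0%N (fun j => \int[P]_w F j (u, w))%E)//.
  - by rewrite -(big_mkord xpredT (fun j => (L.+1%:R^-1)%:E * \int[P]_w F j (u, w))%E) /index_iota subn0.
  - by move=> j; exact: integral_ge0.
  - by rewrite big_const_seq count_predT size_iota iter_addr_0 -[_ *+ _]mulr_natr mulVf.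
under eq_integral => u _ do rewrite inner.
have mG j : measurable_fun setT (fun u => \int[P]_w F j (u, w))%E.
  exact: measurable_fun_fubini_tonelli_F.
rewrite ge0_integral_sum//; last 2 first.
- by move=> j; apply: emeasurable_funM.
- by move=> j u _; rewrite mule_ge0// integral_ge0.
apply: eq_bigr => j _; rewrite ge0_integralZl//.
by move=> u _; exact: integral_ge0.
Qed.

Lemma product_joint_integral (S : set (OM * OM)) : measurable S ->
  Q S = joint_integral (fun w => (\1_S w)%:E).
Proof.
move=> mS; rewrite -[X in Q X]setIT -integral_indic//.
rewrite fubini_tonelli1//.
by apply/measurable_EFinP; exact: measurable_indic.
Qed.

Definition chain_config n (w : OM * OM) : config d :=
  let eta0 := start_config (choice_of (evens w.2)) in
  run eta0 (hist p lambda eta0 n [::] (start w)).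

Definition chain_hold n (w : OM * OM) : \bar R :=
  holding p lambda (start_config (choice_of (evens w.2))) n [::] (start w).

Lemma measurable_chain_site n x k : measurable [set w | chain_config n w x = k].
Proof.
apply: (measurable_countable_set (X := fun w : OM * OM => choice_of (evens w.2))
  (A := fun j => [set w | run (start_config j) (hist p lambda (start_config j) n [::] (start w)) x = k])).
  exact: measurable_choice.
move=> j; have := measurable_start measurableT (Y := [set w | run (start_config j) (hist p lambda (start_config j) n [::] w) x = k]).
rewrite setTI; apply.
apply: (measurable_countable_set (X := hist p lambda (start_config j) n [::])
  (A := fun g => [set w | run (start_config j) g x = k])); first exact: measurable_hist.
move=> g; have [ra|ra] := pselect (run (start_config j) g x = k).
  by rewrite (_ : [set _ | _] = setT) -?subTset.
by rewrite (_ : [set _ | _] = set0) -?subset0.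
Qed.

Lemma measurable_chain_hold n : measurable_fun setT (chain_hold n).
Proof.
apply: (measurable_countable_choice (X := fun w : OM * OM => choice_of (evens w.2))
  (G := fun j w => holding p lambda (start_config j) n [::] (start w))).
  exact: measurable_choice.
move=> j; apply: measurableT_comp; last exact: measurable_start.
exact: measurable_holding.
Qed.

Lemma chain_hold_gt0 n w : (0 < chain_hold n w)%E.
Proof. exact: holding_gt0. Qed.

Definition ring_time n w : \bar R := (\sum_(i < n) chain_hold i w)%E.

Lemma ring_time_le m n w : (m <= n)%N -> (ring_time m w <= ring_time n w)%E.
Proof.
move=> /subnKC <-; elim: (n - m)%N => [|k IH]; first by rewrite addn0.
apply: (le_trans IH); rewrite addnS /ring_time big_ord_recr /=.
by rewrite leeDl// ltW// chain_hold_gt0.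
Qed.

Definition window (t : R) w n := (ring_time n w <= t%:E < ring_time n.+1 w)%E.

Lemma window_uniq t w m n : window t w m -> window t w n -> m = n.
Proof.
move=> /andP[m1 m2] /andP[n1 n2]; apply/eqP; rewrite eqn_leq; apply/andP; split.
  rewrite leqNgt; apply/negP => /(@ring_time_le _ _ w) nm.
  by have := lt_le_trans n2 (le_trans nm m1); rewrite ltxx.
rewrite leqNgt; apply/negP => /(@ring_time_le _ _ w) nm.
by have := lt_le_trans m2 (le_trans nm n1); rewrite ltxx.
Qed.

(** At negative times, or after an accumulation of rings, there is no window and the vacant
    configuration is a default value; [finite_jump_hold] prescribes the values inside the
    windows. *)
Definition process (t : R) w : config d :=
  if pselect (exists n, window t w n) is left e then chain_config (xchoose e) w
  else fun=> Active 0.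

Lemma processE t w n : window t w n -> process t w = chain_config n w.
Proof.
move=> tn; rewrite /process; case: pselect => [e|[]]; last by exists n.
by rewrite (window_uniq (xchooseP e) tn).
Qed.

Lemma measurable_window t n : measurable [set w | window t w n].
Proof.
have mr m : measurable_fun setT (ring_time m) by apply: emeasurable_sum => i; exact: measurable_chain_hold.
rewrite (_ : [set _ | _] = [set w | (ring_time n w <= t%:E)%E] `&` [set w | (t%:E < ring_time n.+1 w)%E]).
  apply: measurableI; rewrite -[X in measurable X]setTI.
    by apply: emeasurable_fun_infty_c.
  by apply: emeasurable_fun_o_infty.
by apply/seteqP; split => w /= /andP.
Qed.

Lemma measurable_process t x k : measurable [set w | process t w x = k].
Proof.
have -> : [set w | process t w x = k] =
    (\bigcup_n ([set w | window t w n] `&` [set w | chain_config n w x = k])) `|`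
    (if `[< k = Active 0 >] then ~` \bigcup_n [set w | window t w n] else set0).
  apply/seteqP; split => w /=.
    rewrite /process; case: pselect => [e|ne] E.
      by left; exists (xchoose e) => //; split => //; exact: xchooseP.
    right; rewrite asboolT//= => -[n _ tn]; apply: ne; by exists n.
  case=> [[n _ [/= tn]]|]; first by rewrite (processE tn).
  case: asboolP => //= -> ne; rewrite /process; case: pselect => // -[n tn].
  by exfalso; apply: ne; exists n.
apply: measurableU.
  by apply: bigcup_measurable => n _; apply: measurableI; [exact: measurable_window|exact: measurable_chain_site].
case: ifP => _ //; apply: measurableC; apply: bigcup_measurable => n _.
exact: measurable_window.
Qed.

Lemma finite_system_process :
  finite_system p lambda (@mixture R d L conf) V Q process.
Proof.
split; first by move=> t x k _; exact: measurable_process.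
exists chain_config, chain_hold; split.
- by move=> n x k; exact: measurable_chain_site.
- exact: measurable_chain_hold.
- by move=> n w; rewrite ltW// chain_hold_gt0.
- move=> n a s s0.
  pose A j := path_event p lambda (start_config j) n [::] a s.
  have -> : [set w | forall i, (i <= n)%N -> chain_config i w = a i /\ ((s i)%:E < chain_hold i w)%E] =
    [set w | A (choice_of (evens w.2)) (start w)] by apply/seteqP; split.
  have mA j : measurable (A j) by exact: measurable_path_event.
  pose S := [set w | A (choice_of (evens w.2)) (start w)].
  transitivity (joint_integral (fun w => (\1_S w)%:E)).
    apply: product_joint_integral.
    apply: (measurable_countable_set (X := fun w : OM * OM => choice_of (evens w.2)) (A := fun j => start @^-1` A j)).
      exact: measurable_choice.
    by move=> j; have := measurable_start measurableT (mA j); rewrite setTI.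
  pose F j w : \bar R := (\1_(A j) w)%:E.
  rewrite (@eq_joint_integral _ _ (fun w => F (choice_of (evens w.2)) (start w))); last first.
    by move=> w; rewrite /F !indicE; congr (_%:R%:E).
  rewrite joint_integral_start; last 2 first.
  - by move=> j; apply/measurable_EFinP; exact: measurable_indic.
  - by move=> j w; rewrite lee_fin.
  rewrite [X in (X * _)%E](mixtureE L conf) ge0_sume_distrl; last by move=> j _; rewrite mule_ge0 ?lee_fin.
  apply: eq_bigr => j _; rewrite -muleA; congr (_ * _)%E.
  rewrite (@eq_joint_integral _ _ (fun w => cind p lambda [::] w.1 * path_ind p lambda (start_config j) n [::] a s w)%E); last first.
    by move=> w; rewrite cindE mul1e.
  rewrite joint_integral_path//; last exact: finite_active_init.
  rewrite /history_prob big_nil mul1r EFinM; congr (_ * _)%E.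
- by move=> n t w _ tn; exact: (@processE t w n).
Qed.

End construction.

(** * Bounds on the topplings in time *)

Section remaining.
Variable d : nat.
Implicit Types (x y : site d) (alpha : seq (site d)) (l : site d -> nat).

Definition unbump l x : site d -> nat := fun y => (l y - (y == x))%N.

(* The number of topplings of the sequence [alpha] which are not among the
   topplings counted by [l]: the first of them is at a site toppled by [l]
   exactly as often as by the initial segment of [alpha] that precedes it. *)
Fixpoint remaining alpha l : nat :=
  if alpha is x :: alpha' then
    if (0 < l x)%N then remaining alpha' (unbump l x) else (size alpha)
  else 0.

Lemma unbumpK l x y : (0 < l y)%N -> unbump (bump l x) y =1 bump (unbump l y) x.
Proof.
move=> ly z; rewrite /unbump /bump; have [->|zy] := eqVneq z y; last lia.
by case: eqP => ? /=; lia.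
Qed.

Lemma eq_remaining alpha l l' : l =1 l' -> remaining alpha l = remaining alpha l'.
Proof. by move=> /funext ->. Qed.

Lemma remaining_bump alpha l x : (remaining alpha (bump l x) <= remaining alpha l)%N.
Proof.
elim: alpha l => //= y alpha IH l; case: (posnP (l y)) => ly.
  case: ifP => // _; apply: leqW.
  move: (unbump _ _) => l'; elim: alpha l' {IH} => //= z alpha IH l'.
  by case: ifP => // _; apply: leqW.
by rewrite {1}/bump addn_gt0 ly /= (eq_remaining _ (unbumpK x ly)).
Qed.

Lemma remaining_size alpha l : (remaining alpha l <= size alpha)%N.
Proof.
elim: alpha l => //= y alpha IH l; case: ifP => // _; exact: leqW.
Qed.

Lemma remaining0 alpha l : remaining alpha l = 0%N -> forall y, (count_mem y alpha <= l y)%N.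
Proof.
elim: alpha l => //= x alpha IH l; case: ifP => // lx /IH H y.
by have := H y; rewrite /unbump eq_sym; case: eqP => [<-|_]; lia.
Qed.

(** The equality at [x] and the inequality elsewhere are those that [active_mono] requires in order
    to find [x] active. *)
Lemma remaining_gt0 alpha l : (0 < remaining alpha l)%N -> exists beta x gamma,
  [/\ alpha = beta ++ x :: gamma, forall y, (count_mem y beta <= l y)%N,
      count_mem x beta = l x & (remaining alpha (bump l x) < remaining alpha l)%N].
Proof.
elim: alpha l => //= x alpha IH l; case: (posnP (l x)) => lx.
  move=> _; exists [::], x, alpha; split => //.
  by rewrite /bump lx eqxx /= ltnS remaining_size.
move=> /IH[beta [y [gamma [-> Hb Hy Hr]]]]; exists (x :: beta), y, gamma; split => //=.
- by move=> z; have := Hb z; rewrite /unbump /= [z == x]eq_sym; case: (eqVneq x z) => [<-|_] /=; lia.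
- by rewrite /= Hy /unbump [y == x]eq_sym; case: (eqVneq x y) => [<-|_] /=; lia.
- by rewrite {1}/bump addn_gt0 lx /= (eq_remaining _ (unbumpK y lx)).
Qed.

End remaining.

Section weighted_sum.
Context {R : realType} (d : nat).
Implicit Types (x y z : site d) (eta : config d) (phi : site d -> R).

Definition finite_particles eta := finite_set [set z | nb_particles (eta z) != 0%N].

Definition weighted_particles phi eta : R :=
  \sum_(z \in [set: site d]) phi z * (nb_particles (eta z))%:R.

Lemma weighted_particlesE phi eta (s : seq (site d)) : uniq s ->
  (forall z, nb_particles (eta z) != 0%N -> z \in s) ->
  weighted_particles phi eta = \sum_(z <- s) phi z * (nb_particles (eta z))%:R.
Proof.
move=> us sE; rewrite /weighted_particles (fsbigE s)//=.
  by apply: eq_bigl => z; rewrite in_setT.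
move=> z _ zs; case: (eqVneq (nb_particles (eta z)) 0%N) => [->|/sE]; first by rewrite mulr0.
by rewrite (negbTE zs).
Qed.

Lemma weighted_particles_apply phi eta x i : finite_particles eta -> (0 < act eta x)%N ->
  finite_particles (apply_instr x i eta) /\
  weighted_particles phi (apply_instr x i eta) = weighted_particles phi eta +
    (if i is Some e then phi (x + vec e) - phi x else 0).
Proof.
move=> fin ax.
pose D := [set z | nb_particles (eta z) != 0%N] `|`
  (if i is Some e then [set x; x + vec e] else [set x]).
have finD : finite_set D.
  by rewrite finite_setU; split => //; case: i @D => [e|]; [exact: finite_set2|exact: finite_set1].
have [n nx] : exists n, eta x = Active n.+1.
  by move: ax; rewrite /act; case: (eta x) => [[|n]|] //= _; exists n.
have D' z : nb_particles (apply_instr x i eta z) != 0%N -> D z.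
  have [zx|zx] := eqVneq z x; first by move=> _; rewrite /D zx; right; case: (i) => [e|] //; left.
  case: i @D finD => [e|] D finD; rewrite /D /=.
    have [zy|zy] := eqVneq z (x + vec e); first by move=> _; right; right.
    by rewrite /jump (negbTE zx) (negbTE zy); left.
  by rewrite /sleep_at (negbTE zx); left.
split; first exact: sub_finite_set D' finD.
pose s : seq (site d) := fset_set D.
have sE z : (z \in s) = (z \in D) by rewrite /s in_fset_set.
rewrite !(@weighted_particlesE phi _ s) ?fset_uniq//; last 2 first.
- by move=> z hz; rewrite sE inE; left.
- by move=> z /D' Dz; rewrite sE inE.
have xs : x \in s.
  by rewrite sE inE /D; right; case: (i) => [e|] //=; left.
have ys e : i = Some e -> x + vec e \in s.
  by move=> ie; rewrite sE inE /D ie; right; right.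
have us : uniq s by exact: fset_uniq.
move: xs ys us; clearbody s => {sE D' finD D} xs ys us.
rewrite (bigD1_seq x)//= [in RHS](bigD1_seq x)//=.
case: i ys => [e|] ys /=; last first.
  rewrite {1}/sleep_at eqxx addr0 nx; congr (_ * _%:R + _); first by case: (n).
  by apply: eq_bigr => z /negbTE zx; rewrite /sleep_at zx.
have {}ys := ys e erefl.
have yx : x + vec e != x by rewrite addvec_neq.
have yf : x + vec e \in [seq z <- s | z != x] by rewrite mem_filter yx.
have uf := filter_uniq (fun z => z != x) us.
rewrite -!(big_filter s (fun z => z != x)) (bigD1_seq _ yf uf) [in RHS](bigD1_seq _ yf uf) /=.
rewrite !big_filter_cond.
rewrite /jump !eqxx (negbTE yx) nx /=.
have -> : nb_particles (incr (eta (x + vec e))) = (nb_particles (eta (x + vec e))).+1.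
  by case: (eta (x + vec e)).
rewrite [X in _ + (_ + X) = _](eq_bigr (fun z => phi z * (nb_particles (eta z))%:R)); last first.
  by move=> z /andP[/negbTE zx /negbTE zy]; rewrite zx zy.
by rewrite -!natr1; ring.
Qed.

End weighted_sum.

(** Arithmetic for the induction step of [cover_discount_integral]: [J] topplings remain, the next
    ring performs a useful one with probability [pi], [kap] and [kap'] are consecutive error terms,
    and [tr] is the discount rate over the total rate. *)
Lemma cover_step1 (R : realFieldType) (A kap kap' J pi : R) :
  kap * J - kap' * J <= kap * pi ->
  1 - (A + kap') * J <= 1 - (A + kap) * (J - pi) - A * pi.
Proof. lra. Qed.

Lemma cover_step2 (R : realFieldType) (A kap' J pi X tr : R) :
  0 <= tr -> X < 0 -> tr <= A * pi -> 1 - (A + kap') * J <= X - A * pi ->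
  1 - (A + kap') * J <= 0.
Proof. lra. Qed.

Lemma cover_step3 (R : realFieldType) (A kap' J pi X tr : R) :
  0 <= tr -> tr <= A * pi -> 1 - (A + kap') * J <= X - A * pi -> X <= 1 ->
  1 - (A + kap') * J <= (1 + tr)^-1 * X.
Proof.
move=> tr0 trA XJ X1; rewrite [leRHS]mulrC ler_pdivlMr; last by lra.
apply: (@le_trans _ _ ((X - tr) * (1 + tr))); first by apply: ler_wpM2r; lra.
have H1 : 0 <= tr * (1 - X) by apply: mulr_ge0; lra.
have H2 : 0 <= tr * tr by apply: mulr_ge0.
have -> : (X - tr) * (1 + tr) = X - tr * (1 - X) - tr * tr by ring.
by lra.
Qed.

(** * Discounted numbers of topplings and discounted covering times *)

Section time_bounds.
Context {R : realType} (d : nat).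
Variables (p : site d -> R) (lambda : R).
Hypotheses (pJ : jump_distribution p) (lambda0 : 0 < lambda).
Implicit Types (x y : site d) (h g : history d) (eta : config d).
Local Notation OM := (measurableTypeR R).
Local Notation P := (@unif R).
Local Notation istack := (instr_stack p lambda).
Local Notation iprob := (iprob p lambda).
Local Notation rate := (total_rate lambda).
Variable eta0 : config d.
Hypothesis fin0 : finite_particles eta0.

Lemma finite_active_particles eta : finite_particles eta -> finite_active eta.
Proof.
apply: sub_finite_set => z /=; rewrite /act; by case: (eta z) => [[|n]|].
Qed.

Let fina : finite_active eta0 := finite_active_particles fin0.

Lemma legal_particles (phi : site d -> R) h : legal eta0 h -> finite_particles (run eta0 h) /\
  ((forall z, phi z = 1) -> weighted_particles phi (run eta0 h) = weighted_particles phi eta0).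
Proof.
elim/last_ind: h => [//|h [x i] IH]; rewrite legal_rcons => /andP[/IH[f E] ax].
rewrite run_rcons; have [f' E'] := weighted_particles_apply phi i f ax.
split => // phi1; rewrite E' E//; case: i {f' E'} => [e|]; last by rewrite addr0.
by rewrite !phi1 subrr addr0.
Qed.

Lemma active_weight_le (phi : site d -> R) eta : finite_particles eta -> (forall z, 0 <= phi z) ->
  \sum_(y <- active_sites eta) phi y * (act eta y)%:R <= weighted_particles phi eta.
Proof.
move=> f phi0; have fa := finite_active_particles f.
pose s : seq (site d) := fset_set [set z | nb_particles (eta z) != 0%N].
have us : uniq s by exact: fset_uniq.
have sE z : nb_particles (eta z) != 0%N -> z \in s by rewrite /s in_fset_set// inE.
rewrite (@weighted_particlesE _ _ _ _ s)//.
have -> : \sum_(y <- active_sites eta) phi y * (act eta y)%:R = \sum_(y <- s) phi y * (act eta y)%:R.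
  transitivity (\sum_(y \in [set: site d]) phi y * (act eta y)%:R).
    rewrite (fsbigE (active_sites eta))//=.
    - by apply: eq_bigl => y; rewrite in_setT.
    - exact: fset_uniq.
    - by move=> y _; rewrite mem_active_sites// negbK => /eqP->; rewrite mulr0.
  rewrite (fsbigE s)//=; first by apply: eq_bigl => y; rewrite in_setT.
  move=> y _ ys; rewrite /act; case E: (eta y) => [[|n]|]; rewrite /= ?mulr0//.
  by have := sE y; rewrite E /= (negbTE ys) => /(_ isT).
apply: ler_sum => y _; apply: ler_wpM2l => //; rewrite ler_nat /act.
by case: (eta y).
Qed.

(* The discount at rate [theta] over the holding time after [h]. *)
Definition decay (theta : R) h (u : OM) : R := expR (- (theta / rate (run eta0 h) * expo u)).

Lemma measurable_decay theta h : measurable_fun setT (decay theta h).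
Proof.
do 2 apply: measurableT_comp => //.
by apply: measurable_funM => //; exact: measurable_expo.
Qed.

Lemma decay_ge0 theta h u : 0 <= decay theta h u. Proof. exact: expR_ge0. Qed.

Lemma decay_le1 theta h u : 0 <= theta -> decay theta h u <= 1.
Proof.
move=> t0; rewrite -[leRHS]expR0 ler_expR oppr_le0 mulr_ge0//.
  by rewrite divr_ge0// total_rate_ge0.
by rewrite ltW// expo_gt0.
Qed.

Lemma integral_decay theta h : 0 <= theta ->
  (\int[P]_u (decay theta h u)%:E = ((1 + theta / rate (run eta0 h))^-1)%:E)%E.
Proof. by move=> t0; apply: laplace_expo; rewrite divr_ge0// total_rate_ge0. Qed.

(** The sum, over the topplings at [x] among the next [N], of the discount accumulated at the time
    of each. For a suitable [theta] its mean is bounded uniformly in [N]. *)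
Fixpoint ring_discount (theta : R) x N h (w : OM * OM) : R :=
  if N is N'.+1 then
    if rate (run eta0 h) == 0 then 0 else
      let g := next_history p lambda eta0 w.1 h (evens w.2) in
      decay theta h (evens (odds w.2)) *
        ((cnt g x - cnt h x)%:R + ring_discount theta x N' g (tail2 w))
  else 0.

Lemma measurable_ring_discount theta x N h : measurable_fun setT (ring_discount theta x N h).
Proof.
elim: N h => [|N IH] h /=; first exact: measurable_cst.
case: (rate (run eta0 h) == 0); first exact: measurable_cst.
apply: measurable_funM.
  apply: measurableT_comp; first exact: measurable_decay.
  apply: measurableT_comp; first exact: measurable_evens.
  by apply: measurableT_comp => //; exact: measurable_odds.
apply: (measurable_countable_choice (X := fun w : OM * OM => next_history p lambda eta0 w.1 h (evens w.2))
  (G := fun g w => (cnt g x - cnt h x)%:R + ring_discount theta x N g (tail2 w))).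
  by move=> g; exact: measurable_next_evens.
move=> g; apply: measurable_funD => //; apply: measurableT_comp => //.
exact: measurable_tail2.
Qed.

Lemma ring_discount_ge0 theta x N h w : 0 <= ring_discount theta x N h w.
Proof.
elim: N h w => [//|N IH] h w /=; case: ifP => // _.
by rewrite mulr_ge0 ?decay_ge0// addr_ge0.
Qed.

Lemma joint_integralD (F G : OM * OM -> \bar R) :
  measurable_fun setT F -> measurable_fun setT G ->
  (forall w, 0 <= F w)%E -> (forall w, 0 <= G w)%E ->
  joint_integral (fun w => F w + G w)%E = (joint_integral F + joint_integral G)%E.
Proof.
move=> mF mG F0 G0; rewrite /joint_integral.
have mpair (u : OM) : measurable_fun setT (fun w : OM => (u, w)) by apply/measurable_fun_pair.
rewrite -ge0_integralD//; last 4 first.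
- by move=> u _; exact: integral_ge0.
- exact: measurable_fun_fubini_tonelli_F.
- by move=> u _; exact: integral_ge0.
- exact: measurable_fun_fubini_tonelli_F.
apply: eq_integral => u _; rewrite ge0_integralD//; exact: measurableT_comp.
Qed.

Lemma active_rate_gt0 eta y : finite_active eta -> y \in active_sites eta -> 0 < rate eta.
Proof.
move=> f ya; rewrite total_rateE// (bigD1_seq y)//= ?fset_uniq// ltr_pwDl//.
  rewrite /clock_rate mulr_gt0 ?(lambda1_gt0 lambda0)// ltr0n lt0n.
  by have := ya; rewrite mem_active_sites.
by apply: sumr_ge0 => z _; apply: clock_rate_ge0.
Qed.

(* A toppling at [y] adds at most [2 * phi y] to the weight of the particles,
   and each active particle is toppled at rate [1 + lambda]: the discount rate
   [2 * (1 + lambda)] compensates this growth. *)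
Lemma joint_integral_ring_discount x (phi : site d -> R) :
  (forall z, 0 <= phi z) -> 1 <= phi x -> (forall z e, phi (z + vec e) <= 2 * phi z) ->
  forall N h, legal eta0 h ->
  (joint_integral (fun w => cind p lambda h w.1 *
      (ring_discount (2 * (1 + lambda)) x N h w)%:E) <=
   (history_prob p lambda h * weighted_particles phi (run eta0 h))%:E)%E.
Proof.
move=> phi0 phix phi2; set theta := 2 * _.
have theta0 : 0 <= theta by rewrite mulr_ge0// ltW// (lambda1_gt0 lambda0).
have hp0 h : 0 <= history_prob p lambda h by apply: prodr_ge0 => xi _; exact: iprob_ge0.
have wp0 eta : 0 <= weighted_particles phi eta.
  by apply: fsumr_ge0 => z _; rewrite mulr_ge0.
elim=> [|N IH] h lh.
  rewrite (@eq_joint_integral _ _ (fun=> 0%E)); last by move=> w; rewrite mule0.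
  by rewrite joint_integral0 lee_fin mulr_ge0.
have [r0|r0] := eqVneq (rate (run eta0 h)) 0.
  rewrite (@eq_joint_integral _ _ (fun=> 0%E)); last by move=> w; rewrite /= r0 eqxx mule0.
  by rewrite joint_integral0 lee_fin mulr_ge0.
pose G g w : \bar R := ((cnt g x - cnt h x)%:R + ring_discount theta x N g w)%:E.
rewrite (@eq_joint_integral _ _ (fun w => cind p lambda h w.1 *
   ((decay theta h (evens (odds w.2)))%:E *
     G (next_history p lambda eta0 w.1 h (evens w.2)) (tail2 w)))%E); last first.
  by move=> w; rewrite /= (negbTE r0) EFinM.
set eta := run eta0 h in r0 *; have [feta _] := legal_particles phi lh.
have faeta : finite_active eta by apply: finite_active_particles.
rewrite (@joint_integral_next _ _ _ _ pJ lambda0 _ fina h (fun u => (decay theta h u)%:E) G); last 4 first.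
- by apply/measurable_EFinP; exact: measurable_decay.
- by move=> u; rewrite lee_fin decay_ge0.
- by move=> g; apply/measurable_EFinP; apply: measurable_funD => //; exact: measurable_ring_discount.
- by move=> g w; rewrite lee_fin addr_ge0// ring_discount_ge0.
rewrite integral_decay// -/eta (negbTE r0).
have r_gt0 : 0 < rate eta by rewrite lt0r r0 total_rate_ge0.
have step y i : y \in active_sites eta ->
    (joint_integral (fun w => cind p lambda (rcons h (y, i)) w.1 * G (rcons h (y, i)) w) <=
     (history_prob p lambda h * iprob i * (weighted_particles phi eta + 2 * phi y))%:E)%E.
  move=> ya; have ay : (0 < act eta y)%N by rewrite lt0n -mem_active_sites.
  rewrite (@eq_joint_integral _ _ (fun w => cind p lambda (rcons h (y, i)) w.1 * ((y == x)%:R)%:E +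
    cind p lambda (rcons h (y, i)) w.1 * (ring_discount theta x N (rcons h (y, i)) w)%:E)%E); last first.
    move=> w; rewrite /G EFinD ge0_muleDr ?lee_fin ?ring_discount_ge0//.
    by rewrite cnt_rcons /bump addKn eq_sym.
  have mc := measurable_cind pJ lambda0 (rcons h (y, i)).
  have mc1 : measurable_fun setT (fun w : OM * OM => cind p lambda (rcons h (y, i)) w.1).
    exact: measurableT_comp.
  rewrite joint_integralD; last 4 first.
  - exact: emeasurable_funM.
  - by apply: emeasurable_funM => //; apply/measurable_EFinP; exact: measurable_ring_discount.
  - by move=> w; rewrite mule_ge0 ?cind_ge0 ?lee_fin.
  - by move=> w; rewrite mule_ge0 ?cind_ge0 ?lee_fin ?ring_discount_ge0.
  rewrite (@joint_integral_prod _ (cind p lambda (rcons h (y, i))) (fun=> ((y == x)%:R)%:E))//; last first.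
    by move=> u; exact: cind_ge0.
  rewrite integral_cind// integral_probability_cst.
  have lr : legal eta0 (rcons h (y, i)) by rewrite legal_rcons lh.
  apply: (le_trans (leeD2l _ (IH _ lr))).
  rewrite run_rcons -/eta history_prob_rcons -EFinM -EFinD lee_fin -mulrDr.
  apply: ler_wpM2l; first by rewrite mulr_ge0// iprob_ge0.
  have [_ ->] := weighted_particles_apply phi i feta ay.
  (* One [phi y] pays for the toppling that is counted when [y] is [x], the other for the gain of
     weight in a jump. *)
  have b1 : (y == x)%:R <= phi y by case: eqP => [->|_].
  have := phi0 y; case: i {lr mc mc1} => [e|] yy; last by lra.
  by have := phi2 y e; lra.
apply: (@le_trans _ _ (((1 + theta / rate eta)^-1)%:E * \sum_(y <- active_sites eta)
   (site_weight lambda eta y)%:E * \sum_(i : instr d)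
   (history_prob p lambda h * iprob i * (weighted_particles phi eta + 2 * phi y))%:E)%E).
  apply: lee_wpmul2l; first by rewrite lee_fin invr_ge0 addr_ge0// divr_ge0// ltW.
  rewrite !big_seq; apply: lee_sum => y ya.
  apply: lee_wpmul2l; first by rewrite lee_fin site_weight_ge0.
  by apply: lee_sum => i _; exact: step.
under eq_bigr => y _ do rewrite sumEFin -EFinM.
rewrite sumEFin -EFinM lee_fin.
under eq_bigr => y _ do rewrite -mulr_suml -mulr_sumr (sum_iprob pJ lambda0) mulr1.
have -> : \sum_(y <- active_sites eta) site_weight lambda eta y *
   (history_prob p lambda h * (weighted_particles phi eta + 2 * phi y)) =
   history_prob p lambda h * (weighted_particles phi eta *
     \sum_(y <- active_sites eta) site_weight lambda eta y +
     2 * ((1 + lambda) / rate eta) * \sum_(y <- active_sites eta) phi y * (act eta y)%:R).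
  rewrite mulrDr !mulr_sumr -big_split /=; apply: eq_bigr => y _.
  by rewrite /site_weight /clock_rate -/(act eta y); ring.
rewrite sum_site_weight// mulr1.
have := active_weight_le feta phi0.
set S := \sum_(y <- _) _; set W := weighted_particles _ _; set c := (1 + lambda) / rate eta.
move=> SW; have c0 : 0 <= c by rewrite divr_ge0 ?ltW// (lambda1_gt0 lambda0).
have -> : theta / rate eta = 2 * c by rewrite /theta /c mulrA.
rewrite mulrCA ler_wpM2l// mulrC ler_pdivrMr; last by lra.
have : c * S <= c * W by exact: ler_wpM2l.
by rewrite -/W -/S; lra.
Qed.

Lemma cnt_next x w1 h u : exists b : bool,
  cnt (next_history p lambda eta0 w1 h u) x = (cnt h x + b)%N.
Proof.
rewrite /next_history; case: ifP => _; first by exists false; rewrite addn0.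
by rewrite cnt_rcons /bump; eexists.
Qed.

(** Each of [k] topplings made by time [s] is discounted by at least [expR (- (theta * s))]. With
    the bound on the mean, this is Markov's inequality for the event of many early topplings. *)
Lemma ring_discount_lower theta x : 0 <= theta -> forall m N k (s : R) h w, (m <= N)%N ->
  (cnt h x + k <= cnt (hist p lambda eta0 m h w) x)%N ->
  (\sum_(i < m) holding p lambda eta0 i h w <= s%:E)%E ->
  k%:R * expR (- (theta * s)) <= ring_discount theta x N h w.
Proof.
move=> t0; elim=> [|m IH] N k s h w mN.
  rewrite /= -[leqRHS]addn0 leq_add2l leqn0 => /eqP-> _.
  by rewrite mul0r ring_discount_ge0.
case: N mN => // N mN; rewrite big_ord_recl.
rewrite [hist _ _ _ _ _ _]/= => kc /=.
rewrite /hold; have [r0|r0] := eqVneq (rate (run eta0 h)) 0.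
  (* A vanishing rate means an infinite holding time, against the bound by [s]. *)
  rewrite addye; first by rewrite leye_eq.
  by rewrite gt_eqF// (lt_le_trans ltNy0) ?sume_ge0// => i _; rewrite ltW// holding_gt0.
set T := expo _ / _; set g := next_history _ _ _ _ _ _ in kc *.
have T0 : 0 <= T by rewrite divr_ge0 ?total_rate_ge0// ltW// expo_gt0.
rewrite -leeBrDl// -EFinB => sT.
have [b gb] := cnt_next x w.1 h (evens w.2); rewrite -/g in gb.
have st : 0 <= s - T.
  rewrite -lee_fin; apply: le_trans sT; apply: sume_ge0 => i _.
  by rewrite ltW// holding_gt0.
have := IH N (k - b)%N (s - T) g (tail2 w) mN.
have -> : (cnt g x + (k - b) <= cnt (hist p lambda eta0 m g (tail2 w)) x)%N.
  have [kb|kb] := leqP k b; last by rewrite gb -addnA subnKC// ltnW.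
  have -> : (k - b)%N = 0%N by apply/eqP; rewrite subn_eq0.
  rewrite addn0; clear; elim: m g (tail2 w) => //= m IH g v.
  apply: leq_trans (IH _ _); have [c ->] := cnt_next x v.1 g (evens v.2).
  exact: leq_addr.
move=> /(_ isT sT) Z.
rewrite gb addKn.
have dE : decay theta h (evens (odds w.2)) = expR (- (theta * T)).
  by rewrite /decay /T; congr (expR (- _)); rewrite mulrA mulrAC.
rewrite dE; set D := expR (- (theta * T)).
have -> : expR (- (theta * s)) = D * expR (- (theta * (s - T))).
  by rewrite /D -expRD; congr expR; ring.
rewrite mulrCA; apply: ler_wpM2l; first exact: expR_ge0.
set E := expR _ in Z *.
have E0 : 0 <= E by exact: expR_ge0.
have E1 : E <= 1 by rewrite -[leRHS]expR0 ler_expR oppr_le0 mulr_ge0.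
apply: (@le_trans _ _ (b%:R + (k - b)%:R * E)); last by rewrite lerD2l.
have [kb|kb] := leqP k b.
  have k1 : k%:R <= b%:R :> R by rewrite ler_nat.
  have : k%:R * E <= k%:R * 1 by rewrite ler_wpM2l.
  have : 0 <= (k - b)%:R * E by rewrite mulr_ge0.
  by rewrite mulr1; lra.
rewrite natrB ?(ltnW kb)//.
have : b%:R * E <= b%:R * 1 by rewrite ler_wpM2l.
by rewrite mulr1; lra.
Qed.

(** The discount at the time when the topplings of [alpha] are all done, set to 0 when [N] rings do
    not suffice; the truncation makes it a finite recursion. *)
Fixpoint cover_discount (theta : R) alpha N h (w : OM * OM) : R :=
  if remaining alpha (cnt h) == 0%N then 1 else
  if N is N'.+1 then decay theta h (evens (odds w.2)) *
    cover_discount theta alpha N' (next_history p lambda eta0 w.1 h (evens w.2)) (tail2 w)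
  else 0.

Lemma measurable_cover_discount theta alpha N h :
  measurable_fun setT (cover_discount theta alpha N h).
Proof.
elim: N h => [|N IH] h /=; case: (_ == 0%N); try exact: measurable_cst.
apply: measurable_funM.
  apply: measurableT_comp; first exact: measurable_decay.
  apply: measurableT_comp; first exact: measurable_evens.
  by apply: measurableT_comp => //; exact: measurable_odds.
apply: (measurable_countable_choice (X := fun w : OM * OM => next_history p lambda eta0 w.1 h (evens w.2))
  (G := fun g w => cover_discount theta alpha N g (tail2 w))).
  by move=> g; exact: measurable_next_evens.
by move=> g; apply: measurableT_comp => //; exact: measurable_tail2.
Qed.

Lemma cover_discount_ge0 theta alpha N h w : 0 <= cover_discount theta alpha N h w.
Proof.
elim: N h w => [|N IH] h w /=; case: ifP => //.
by rewrite mulr_ge0// decay_ge0.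
Qed.

Lemma cover_discount_le1 theta alpha N h w : 0 <= theta -> cover_discount theta alpha N h w <= 1.
Proof.
move=> t0; elim: N h w => [|N IH] h w /=; case: ifP => // _.
by rewrite mulr_ile1 ?decay_ge0 ?cover_discount_ge0 ?decay_le1.
Qed.

Lemma cover_discount_time theta alpha : 0 <= theta -> forall N h w (t : R),
  expR (- (theta * t)) < cover_discount theta alpha N h w ->
  (forall g, (0 < remaining alpha (cnt g))%N -> consistent (istack w.1) zero_count g ->
     legal eta0 g -> rate (run eta0 g) != 0) ->
  consistent (istack w.1) zero_count h -> legal eta0 h ->
  exists2 m, (m <= N)%N & remaining alpha (cnt (hist p lambda eta0 m h w)) = 0%N /\
    (\sum_(i < m) holding p lambda eta0 i h w <= t%:E)%E.
Proof.
move=> t0 N h w t + ract.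
elim: N h w t ract => [|N IH] h w t ract /=; case: eqP => [r0|/eqP r0].
- move=> e1 _ _; exists 0%N => //=; split => //; rewrite big_ord0 lee_fin leNgt; apply/negP => t1.
  by move: e1; rewrite -[ltRHS]expR0 ltr_expR oppr_lt0 ltNge mulr_ge0_le0// ltW.
- by rewrite ltNge expR_ge0.
- move=> e1 _ _; exists 0%N => //=; split => //; rewrite big_ord0 lee_fin leNgt; apply/negP => t1.
  by move: e1; rewrite -[ltRHS]expR0 ltr_expR oppr_lt0 ltNge mulr_ge0_le0// ltW.
- set g := next_history _ _ _ _ _ _ => e1 ch lh.
  have rn : rate (run eta0 h) != 0 by apply: ract => //; rewrite lt0n.
  set T := expo (evens (odds w.2)) / rate (run eta0 h).
  have dE : decay theta h (evens (odds w.2)) = expR (- (theta * T)).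
    by rewrite /decay /T; congr (expR (- _)); rewrite mulrA mulrAC.
  have e2 : expR (- (theta * (t - T))) < cover_discount theta alpha N g (tail2 w).
    have -> : - (theta * (t - T)) = theta * T + - (theta * t) by ring.
    by rewrite expRD -ltr_pdivlMl ?expR_gt0// -expRN -dE.
  have xa := next_site_active fina (evens w.2) rn.
  have cg : consistent (istack (tail2 w).1) zero_count g.
    by rewrite /g /next_history (negbTE rn) consistent_rcons ch /=.
  have lg : legal eta0 g.
    rewrite /g /next_history (negbTE rn) legal_rcons lh lt0n -mem_active_sites//.
    exact: finite_active_run.
  have [m mN [rm tm]] := IH g (tail2 w) (t - T) ract e2 cg lg.
  exists m.+1 => //; split => //.
  rewrite big_ord_recl /= /hold (negbTE rn) -/T.
  by rewrite -leeBrDl// -EFinB.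
Qed.

(** At the site given by [remaining_gt0] the dynamics has performed exactly the topplings of an
    initial segment of [ha], and elsewhere at least as many; the legality of the next toppling of
    [ha] is carried over by [active_mono]. *)
Lemma remaining_active (n0 n1 : site d -> nat) (ha h : history d) w1 :
  eta0 = (fun x => Active (n1 x)) -> (forall x, (n0 x <= n1 x)%N) ->
  legal (fun x => Active (n0 x)) ha -> consistent (istack w1) zero_count ha ->
  legal eta0 h -> consistent (istack w1) zero_count h ->
  (0 < remaining (map fst ha) (cnt h))%N -> exists2 x, (0 < act (run eta0 h) x)%N &
    (remaining (map fst ha) (bump (cnt h) x) < remaining (map fst ha) (cnt h))%N.
Proof.
move=> etaE n01 lha cha lh ch /remaining_gt0[beta [x [gamma [alphaE bl bx Jx]]]].
exists x => //; set alpha := map fst ha in alphaE *.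
pose hb := take (size beta) ha.
have hbE : map fst hb = beta by rewrite map_take -/alpha alphaE take_size_cat.
have := alphaE; rewrite /alpha -[in LHS](cat_take_drop (size beta) ha) map_cat -/hb hbE.
move=> /eqP; rewrite eqseq_cat// eqxx /= => /eqP.
case E : (drop (size beta) ha) => [//|[y i] hg] /= [yx _].
have haE : ha = hb ++ (x, i) :: hg by rewrite -yx -E cat_take_drop.
move: lha cha; rewrite haE legal_cat consistent_cat => /andP[lb /= /andP[ab _]] /andP[cb _].
have cntb y' : cnt hb y' = count_mem y' beta by rewrite -hbE count_map.
have [E0 _] := run_odometer lb cb; rewrite E0 in ab.
have [E1 _] := run_odometer (I := istack w1) (n0 := n1) (h := h) (ltac:(by rewrite -etaE)) ch.
rewrite etaE E1; apply: active_mono ab => //; last by rewrite cntb.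
by move=> y'; rewrite cntb.
Qed.

(* The site of the first toppling of [ha] which remains to be done is active
   by monotonicity, and is toppled next_history with probability at least [1 / K]. *)
Lemma cover_discount_integral theta (n0 n1 : site d -> nat) (ha : history d) w1 (K : R) :
  0 <= theta -> 1 <= K -> weighted_particles (fun=> 1) eta0 <= K ->
  eta0 = (fun x => Active (n1 x)) -> (forall x, (n0 x <= n1 x)%N) ->
  legal (fun x => Active (n0 x)) ha -> consistent (istack w1) zero_count ha ->
  forall N h, legal eta0 h -> consistent (istack w1) zero_count h ->
  ((1 - (theta / (1 + lambda) + K / N.+1%:R) * (remaining (map fst ha) (cnt h))%:R)%:E <=
    \int[P]_w (cover_discount theta (map fst ha) N h (w1, w))%:E)%E.
Proof.
move=> t0 K1 wK etaE n01 lha cha; have l1 := lambda1_gt0 lambda0.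
set alpha := map fst ha.
(* The two error terms per remaining toppling: an active site rings at rate at least [1 + lambda],
   so waiting for it costs at most [theta / (1 + lambda)] of discount; and it takes at most [K]
   rings on average, so that by Markov's inequality [K / N.+1] covers the case where [N] rings are
   too few. *)
have A0 : 0 <= theta / (1 + lambda) by rewrite divr_ge0// ltW.
have K0 : 0 < K by lra.
have int_ge0 N h : (0 <= \int[P]_w (cover_discount theta alpha N h (w1, w))%:E)%E.
  by apply: integral_ge0 => w _; rewrite lee_fin cover_discount_ge0.
elim=> [|N IH] h lh ch.
  have [J0|J0] := eqVneq (remaining alpha (cnt h)) 0%N.
    rewrite J0 mulr0 subr0 (_ : (fun w => _) = fun=> 1%E) ?integral_probability_cst//.
    by apply/funext => w; rewrite /= J0.
  apply: le_trans (int_ge0 _ _); rewrite lee_fin.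
  have J1 : 1 <= (remaining alpha (cnt h))%:R :> R by rewrite ler1n lt0n.
  rewrite subr_le0; apply: (@le_trans _ _ (1 * 1)); first by rewrite mulr1.
  by apply: ler_pM => //; rewrite divr1; lra.
have [J0|J0] := posnP (remaining alpha (cnt h)).
  rewrite J0 mulr0 subr0 (_ : (fun w => _) = fun=> 1%E) ?integral_probability_cst//.
  by apply/funext => w; rewrite /= J0.
have [x xact Jx] := remaining_active etaE n01 lha cha lh ch J0.
set eta := run eta0 h in xact *; have [feta Eeta] := legal_particles (fun=> 1) lh.
have faeta : finite_active eta by apply: finite_active_particles.
have xa : x \in active_sites eta by rewrite mem_active_sites// -lt0n.
have r_gt0 := active_rate_gt0 faeta xa.
have rK : rate eta <= (1 + lambda) * K.
  rewrite total_rateE//.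
  have -> : \sum_(y <- active_sites eta) clock_rate lambda eta y =
      (1 + lambda) * \sum_(y <- active_sites eta) 1 * (act eta y)%:R.
    by rewrite mulr_sumr; apply: eq_bigr => y _; rewrite mul1r.
  rewrite ler_pM2l//; apply: le_trans wK; rewrite -Eeta//.
  exact: (@active_weight_le (fun=> 1)).
set pi := site_weight lambda eta x.
have piE : (1 + lambda) / rate eta <= pi.
  rewrite /pi /site_weight /clock_rate ler_pM2r ?invr_gt0//.
  by rewrite -[leLHS]mulr1 ler_pM2l// ler1n.
set kap := K / N.+1%:R; set kap' := K / N.+2%:R; set J := (remaining alpha (cnt h))%:R : R.
set A := theta / (1 + lambda).
have J_gt0 : 0 < J by rewrite ltr0n.
have [k1|k1] := leP 1 (kap' * J).
  apply: le_trans (int_ge0 _ _); rewrite lee_fin.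
  have : 0 <= A * J by rewrite mulr_ge0// ltW.
  by rewrite -/J -/A -/kap'; move: (A * J) (A) (kap' * J) k1 (mulrDl A kap' J) => u ? v k1 -> ?; rewrite subr_le0; apply: le_trans k1 _; rewrite lerDr.
(* [X] averages the induction hypothesis over the next site: with probability [pi] one toppling
   fewer remains. *)
pose b := A + kap; pose X := 1 - b * (J - pi).
have kap0 : 0 <= kap by rewrite divr_ge0// ltW.
have b0 : 0 <= b by rewrite addr_ge0.
have Kpi : 1 <= K * pi.
  apply: (@le_trans _ _ (K * ((1 + lambda) / rate eta))); last by rewrite ler_pM2l.
  by rewrite mulrA ler_pdivlMr// mul1r mulrC.
have XJ : 1 - (A + kap') * J <= X - A * pi.
  (* This is where the form [K / N.+1] of the error is used: [kap - kap'] equals [kap * kap' / K],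
     and [kap' * J < 1 <= K * pi]. *)
  have : kap * J - kap' * J <= kap * pi.
    have -> : kap * J - kap' * J = kap * (kap' * J / K).
      rewrite /kap /kap' -[N.+2%:R]natr1; have Np : 0 < N.+1%:R :> R by [].
      move: (N.+1%:R) Np => n np; have n10 : 0 < n + 1 by exact: addr_gt0.
      by field; rewrite !gt_eqF.
    apply: ler_wpM2l => //; rewrite ler_pdivrMr// [leRHS]mulrC.
    by apply: le_trans Kpi; exact: ltW.
  exact: cover_step1.
have Api : theta / rate eta <= A * pi.
  apply: (@le_trans _ _ (A * ((1 + lambda) / rate eta))); last exact: ler_wpM2l.
  by rewrite /A mulrA mulfVK// gt_eqF.
have [X0|X0] := ltP X 0.
  apply: le_trans (int_ge0 _ _); rewrite lee_fin -/J.
  by apply: cover_step2 X0 Api XJ; rewrite divr_ge0// ltW.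
rewrite /= -/alpha gtn_eqF//.
under eq_integral => w _ do rewrite EFinM.
rewrite (@integral_next _ _ _ _ lambda0 _ fina w1 h (fun u => (decay theta h u)%:E)
  (fun g w => (cover_discount theta alpha N g (w1, w))%:E)); last 4 first.
- by apply/measurable_EFinP; exact: measurable_decay.
- by move=> u; rewrite lee_fin decay_ge0.
- move=> g; apply/measurable_EFinP; apply: measurableT_comp; first exact: measurable_cover_discount.
  exact/measurable_fun_pair.
- by move=> g w; rewrite lee_fin cover_discount_ge0.
rewrite integral_decay// -/eta gt_eqF//.
apply: (@le_trans _ _ (((1 + theta / rate eta)^-1)%:E * X%:E)%E).
  rewrite -EFinM lee_fin -/J -/A -/kap'.
  apply: (cover_step3 _ Api XJ); first by rewrite divr_ge0// ltW.
  have piJ : pi <= 1.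
    rewrite /pi -[leRHS](@sum_site_weight _ _ lambda _ faeta) ?gt_eqF// (bigD1_seq x)//= ?fset_uniq// lerDl.
    by apply: sumr_ge0 => y _; exact: site_weight_ge0.
  by rewrite /X gerBl mulr_ge0// subr_ge0 (le_trans piJ)// ler1n.
apply: lee_wpmul2l; first by rewrite lee_fin invr_ge0 addr_ge0// divr_ge0// ltW.
have sw := @sum_site_weight _ _ lambda _ faeta (ltac:(by rewrite gt_eqF)).
apply: (@le_trans _ _ (\sum_(y <- active_sites eta) (site_weight lambda eta y)%:E *
    (1 - b * (J - (y == x)%:R))%:E)%E).
  under eq_bigr => y _ do rewrite -EFinM.
  rewrite sumEFin lee_fin.
  have -> : \sum_(y <- active_sites eta) site_weight lambda eta y * (1 - b * (J - (y == x)%:R)) =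
     (1 - b * J) * \sum_(y <- active_sites eta) site_weight lambda eta y +
     b * \sum_(y <- active_sites eta) site_weight lambda eta y * (y == x)%:R.
    by rewrite !mulr_sumr -big_split /=; apply: eq_bigr => y _; ring.
  rewrite sw (bigD1_seq x)//= ?fset_uniq// eqxx /= big1 ?addr0; last first.
    by move=> y /negbTE->; rewrite mulr0.
  by rewrite /X -/pi le_eqVlt; apply/orP; left; apply/eqP; ring.
rewrite !big_seq; apply: lee_sum => y ya.
apply: lee_wpmul2l; first by rewrite lee_fin site_weight_ge0.
apply: le_trans (IH _ _ _); last 2 first.
- by rewrite legal_rcons lh lt0n -mem_active_sites.
- by rewrite consistent_rcons ch /=.
rewrite lee_fin lerD2l lerN2 -/A -/kap -/b; apply: ler_wpM2l => //.
rewrite cnt_rcons; have [->|yx] := eqVneq y x.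
  by rewrite lerBrDr natr1 ler_nat.
by rewrite subr0 ler_nat remaining_bump.
Qed.

End time_bounds.

(** * Late activity in finite volume, uniformly in the volume *)

Section activity.
Context {R : realType} (d : nat).
Variables (p : site d -> R) (lambda : R).
Hypotheses (pJ : jump_distribution p) (lambda0 : 0 < lambda).
Local Notation OM := (measurableTypeR R).
Local Notation P := (@unif R).
Local Notation istack := (instr_stack p lambda).
Local Notation Q := (P \x P)%E.

Lemma le_joint_integral (F G : OM * OM -> \bar R) :
  measurable_fun setT F -> measurable_fun setT G ->
  (forall w, 0 <= F w)%E -> (forall w, F w <= G w)%E ->
  (joint_integral F <= joint_integral G)%E.
Proof.
move=> mF mG F0 FG; have G0 w : (0 <= G w)%E by exact: le_trans (FG w).
have mpair (u : OM) : measurable_fun setT (fun w : OM => (u, w)) by apply/measurable_fun_pair.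
apply: ge0_le_integral => //.
- by move=> u _; exact: integral_ge0.
- exact: measurable_fun_fubini_tonelli_F.
- exact: measurable_fun_fubini_tonelli_F.
- by move=> u _; apply: ge0_le_integral => //; exact: measurableT_comp.
Qed.

Lemma joint_integralZl (c : R) (F : OM * OM -> \bar R) : 0 <= c ->
  measurable_fun setT F -> (forall w, 0 <= F w)%E ->
  joint_integral (fun w => c%:E * F w)%E = (c%:E * joint_integral F)%E.
Proof.
move=> c0 mF F0; rewrite /joint_integral.
have mpair (u : OM) : measurable_fun setT (fun w : OM => (u, w)) by apply/measurable_fun_pair.
transitivity (\int[P]_u (c%:E * \int[P]_w F (u, w)))%E.
  by apply: eq_integral => u _; rewrite ge0_integralZl//; exact: measurableT_comp.
rewrite ge0_integralZl//; first exact: measurable_fun_fubini_tonelli_F.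
by move=> u _; exact: integral_ge0.
Qed.

Lemma measurable_cst_set disp (T : measurableType disp) (A : Prop) : measurable [set _ : T | A].
Proof.
have [a|a] := pselect A; first by rewrite (_ : [set _ | _] = setT) -?subTset.
by rewrite (_ : [set _ | _] = set0) -?subset0.
Qed.

Section from_config.
Variable eta0 : config d.
Hypothesis fin0 : finite_particles eta0.
Local Notation hist := (hist p lambda eta0).
Local Notation holding := (holding p lambda eta0).
Local Notation next := (next_history p lambda eta0).

Let fina : finite_active eta0 := finite_active_particles fin0.

Definition covered (B : {fset site d}) k (t : R) N : set (OM * OM) :=
  [set w | exists2 m, (m <= N)%N &
     (forall x, x \in B -> (k <= cnt (hist m [::] w) x)%N) /\
     (\sum_(i < m) holding i [::] w <= t%:E)%E].

Lemma measurable_covered B k t N : measurable (covered B k t N).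
Proof.
have -> : covered B k t N = \bigcup_(m in `I_N.+1)
    ([set w | forall x, x \in B -> (k <= cnt (hist m [::] w) x)%N] `&`
     [set w | (\sum_(i < m) holding i [::] w <= t%:E)%E]).
  by apply/seteqP; split => [w [m mN H]|w [m mN H]]; exists m.
apply: bigcup_measurable => m _; apply: measurableI; last first.
  rewrite -[X in measurable X]setTI; apply: emeasurable_fun_infty_c => //.
  by apply: emeasurable_sum => i; exact: measurable_holding.
apply: (measurable_countable_set (X := hist m [::])
  (A := fun g => [set w | forall x, x \in B -> (k <= cnt g x)%N])); first exact: measurable_hist.
by move=> g; exact: measurable_cst_set.
Qed.

Lemma covered_early x (phi : site d -> R) k s N :
  (forall z, 0 <= phi z) -> 1 <= phi x -> (forall z e, phi (z + vec e) <= 2 * phi z) ->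
  ((k%:R * expR (- (2 * (1 + lambda) * s)))%:E * Q (covered [fset x]%fset k s N) <=
    (weighted_particles phi eta0)%:E)%E.
Proof.
move=> phi0 phix phi2; have mC := measurable_covered [fset x]%fset k s N.
have th0 : 0 <= 2 * (1 + lambda) by rewrite mulr_ge0// ltW// (lambda1_gt0 lambda0).
rewrite product_joint_integral// -joint_integralZl//; last first.
  by apply/measurable_EFinP; exact: measurable_indic.
have := @joint_integral_ring_discount _ _ _ _ pJ lambda0 _ fin0 x phi phi0 phix phi2 N [::] isT.
rewrite /history_prob big_nil mul1r /=; apply: le_trans; apply: le_joint_integral.
- by apply: emeasurable_funM => //; apply/measurable_EFinP; exact: measurable_indic.
- apply: emeasurable_funM; last by apply/measurable_EFinP; exact: measurable_ring_discount.
  by apply: measurableT_comp => //; exact: measurable_cind.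
- by move=> w; rewrite mule_ge0 ?lee_fin// mulr_ge0// expR_ge0.
move=> w; rewrite cindE mul1e indicE.
case: (boolP (w \in _)) => [|_]; last by rewrite mule0 lee_fin ring_discount_ge0.
rewrite inE => -[m mN [/(_ x)]]; rewrite inE eqxx => /(_ isT) kx ht.
rewrite mule1 lee_fin; exact: (ring_discount_lower lambda0 th0 mN).
Qed.

Definition coverable (n0 : site d -> nat) (B : {fset site d}) k M : set OM :=
  [set u | exists h, [/\ legal (fun x => Active (n0 x)) h, consistent (istack u) zero_count h,
     (size h <= M)%N & forall x, x \in B -> (k <= cnt h x)%N]].

Lemma measurable_coverable n0 B k M : measurable (coverable n0 B k M).
Proof.
have -> : coverable n0 B k M = \bigcup_(h in [set: history d])
   (consistent_set p lambda h `&` [set _ | [/\ legal (fun x => Active (n0 x)) h, (size h <= M)%N &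
     forall x, x \in B -> (k <= cnt h x)%N]]).
  by apply/seteqP; split => [w [h [? ? ? ?]]|w [h _ [? []]]]; exists h.
apply: countable_bigcupT_measurable; first exact: countableP.
move=> h; apply: measurableI; first exact: measurable_consistent.
exact: measurable_cst_set.
Qed.

(** The stacks are frozen in [coverable] and the clocks integrated. Outside [covered] the covering
    discount is at most [expR (- (theta * t))], and it never exceeds 1, so its mean minus this
    exponential bounds the conditional probability from below. *)
Lemma covered_coverable (n0 n1 : site d -> nat) B k M (K theta t : R) N :
  0 <= theta -> 1 <= K -> weighted_particles (fun=> 1) eta0 <= K ->
  eta0 = (fun x => Active (n1 x)) -> (forall x, (n0 x <= n1 x)%N) ->
  0 <= 1 - (theta / (1 + lambda) + K / N.+1%:R) * M%:R - expR (- (theta * t)) ->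
  ((1 - (theta / (1 + lambda) + K / N.+1%:R) * M%:R - expR (- (theta * t)))%:E *
    P (coverable n0 B k M) <= Q (covered B k t N))%E.
Proof.
move=> t0 K1 wK etaE n01; set c := _ - _ - _ => c0.
have mS := measurable_coverable n0 B k M; have mC := measurable_covered B k t N.
rewrite product_joint_integral// -[X in P X]setIT -integral_indic//.
rewrite -ge0_integralZl//; last first.
  by apply/measurable_EFinP; exact: measurable_indic.
have mI : measurable_fun setT (fun w => (\1_(covered B k t N) w)%:E : \bar R).
  by apply/measurable_EFinP; exact: measurable_indic.
have mpair (u : OM) : measurable_fun setT (fun w : OM => (u, w)) by apply/measurable_fun_pair.
apply: ge0_le_integral => //.
- by move=> u _; rewrite mule_ge0 ?lee_fin.
- by apply: emeasurable_funM => //; apply/measurable_EFinP; exact: measurable_indic.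
- pose F (w : OM * OM) : \bar R := (\1_(covered B k t N) w)%:E.
  by apply: (@measurable_fun_fubini_tonelli_F _ _ OM OM R P F) => // w; rewrite lee_fin.
move=> u _; rewrite indicE; case: (boolP (u \in _)) => [|_]; last first.
  by rewrite mule0 integral_ge0.
rewrite inE mule1 => -[h [lh ch hM hB]].
have L := @cover_discount_integral _ _ p lambda lambda0 _ fin0 theta n0 n1 h u K t0 K1 wK etaE n01 lh ch N [::] isT isT.
set al := map fst h in L.
have cE : (c%:E = (1 - (theta / (1 + lambda) + K / N.+1%:R) * M%:R)%:E - (expR (- (theta * t)))%:E)%E by [].
rewrite cE leeBlDr//.
have l1 := lambda1_gt0 lambda0.
apply: (@le_trans _ _ (\int[P]_w (cover_discount p lambda eta0 theta al N [::] (u, w))%:E)%E).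
  apply: le_trans L; rewrite lee_fin lerD2l lerN2; apply: ler_wpM2l.
    by rewrite addr_ge0// divr_ge0// ?ltW// (lt_le_trans ltr01).
  by rewrite ler_nat (leq_trans (remaining_size _ _))// size_map.
rewrite -[X in (_ <= _ + X)%E](integral_probability_cst P) -ge0_integralD//; last exact: (measurableT_comp mI (mpair u)).
apply: ge0_le_integral => //.
- by move=> w _; rewrite lee_fin cover_discount_ge0.
- apply/measurable_EFinP; exact: (measurableT_comp (measurable_cover_discount _ _ _ _ _ _ _) (mpair u)).
- by apply: emeasurable_funD => //; exact: (measurableT_comp mI (mpair u)).
move=> w _; rewrite -EFinD lee_fin.
have [C1|C1] := leP (cover_discount p lambda eta0 theta al N [::] (u, w)) (expR (- (theta * t))).
  by apply: le_trans C1 _; rewrite lerDr.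
suff -> : \1_(covered B k t N) (u, w) = 1 :> R.
  by rewrite (le_trans (cover_discount_le1 _ _ _ _ _ _ _ t0))// lerDl expR_ge0.
rewrite indicE mem_set//.
have ract g : (0 < remaining al (cnt g))%N -> consistent (istack u) zero_count g ->
    legal eta0 g -> total_rate lambda (run eta0 g) != 0.
  move=> rg cg lg; apply/negP => /eqP rate0.
  have := remaining_active etaE n01 lh ch lg cg rg.
  move=> [x ax _]; have [feta _] := legal_particles fin0 (fun=> 1 : R) lg.
  have xa : x \in active_sites (run eta0 g).
    by rewrite mem_active_sites ?lt0n//; [rewrite -lt0n|exact: finite_active_particles].
  have := active_rate_gt0 lambda0 (finite_active_particles feta) xa.
  by rewrite rate0 ltxx.
have [m mN [rm tm]] := cover_discount_time fin0 t0 C1 ract isT isT.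
exists m => //; split => // x xB; apply: leq_trans (hB x xB) _.
by have := remaining0 rm x; rewrite /al count_map.
Qed.

Lemma hist_last m h w : exists u, hist m.+1 h w = next w.1 (hist m h w) u.
Proof.
elim: m h w => [|m IH] h w; first by exists (evens w.2).
by have [u E] := IH (next w.1 h (evens w.2)) (tail2 w); exists u.
Qed.

(** Look just before the [k]-th toppling at [x]: it happens by time [t] and after time [s], and a
    site that is about to be toppled is active. *)
Lemma covered_window B k s t N w : (0 < k)%N -> covered B k t N w ->
  (forall x, x \in B -> ~ covered [fset x]%fset k s N w) ->
  forall x, x \in B -> exists2 q : rat, s <= ratr q <= t &
    exists2 n, (\sum_(i < n) holding i [::] w <= (ratr q)%:E < \sum_(i < n.+1) holding i [::] w)%E &
      (0 < act (run eta0 (hist n [::] w)) x)%N.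
Proof.
move=> k0 [m mN [mB mt]] nE x xB.
have ex : exists n, (k <= cnt (hist n [::] w) x)%N by exists m; exact: mB.
have [n nk nmin] := ex_minnP ex.
have nm : (n <= m)%N by apply: nmin; exact: mB.
case: n nk nmin nm => [|n] nk nmin nm; first by move: nk; rewrite leqNgt k0.
have Tle : (\sum_(i < n.+1) holding i [::] w <= t%:E)%E.
  apply: le_trans mt; move: nm => /subnKC <-; elim: (m - n.+1)%N => [|j IH]; first by rewrite addn0.
  by apply: (le_trans IH); rewrite addnS [leRHS]big_ord_recr /= leeDl// ltW// holding_gt0.
have Ts : (s%:E < \sum_(i < n.+1) holding i [::] w)%E.
  rewrite ltNge; apply/negP => Ts; apply: (nE x xB); exists n.+1; first exact: leq_trans nm mN.
  by split => // y; rewrite inE => /eqP->.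
have Tp : (0 <= \sum_(i < n) holding i [::] w)%E.
  by apply: sume_ge0 => i _; rewrite ltW// holding_gt0.
have Tlt : (\sum_(i < n) holding i [::] w < \sum_(i < n.+1) holding i [::] w)%E.
  rewrite big_ord_recr /= lteDl ?holding_gt0// fin_numElt (lt_le_trans ltNy0 Tp) /=.
  apply: le_lt_trans (ltry t); apply: le_trans Tle.
  by rewrite big_ord_recr /= leeDl// ltW// holding_gt0.
have [T0 T0E] : exists T0, (\sum_(i < n) holding i [::] w = T0%:E)%E.
  exists (fine (\sum_(i < n) holding i [::] w)%E); rewrite fineK// fin_numElt (lt_le_trans ltNy0 Tp).
  by rewrite (lt_le_trans Tlt)// (le_trans Tle)// leey.
have [T1 T1E] : exists T1, (\sum_(i < n.+1) holding i [::] w = T1%:E)%E.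
  exists (fine (\sum_(i < n.+1) holding i [::] w)%E); rewrite fineK// fin_numElt (lt_trans (lt_le_trans ltNy0 Tp) Tlt).
  by rewrite (le_lt_trans Tle)// ltry.
rewrite T0E T1E !lte_fin lee_fin in Ts Tle Tlt.
(* The window that ends with the [k]-th toppling meets the times after [s] in a nonempty open
   interval, which contains a rational. *)
have [q] : exists q : rat, ratr q \in `]Num.max s T0, T1[%R.
  by apply: rat_in_itvoo; rewrite gt_max Ts.
rewrite in_itv /= gt_max => /andP[/andP[qs q0] q1].
exists q; first by rewrite (ltW qs) (le_trans (ltW q1)).
exists n; first by rewrite T0E T1E lee_fin lte_fin (ltW q0).
have [u nE'] := hist_last n [::] w.
move: nk; rewrite nE' /next_history; case: ifP => [_|/negbT r0].
  by move=> /nmin; rewrite ltnn.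
rewrite cnt_rcons /bump; have [-> _|_] := eqVneq x; last by rewrite addn0 => /nmin; rewrite ltnn.
rewrite lt0n -mem_active_sites; last exact: finite_active_run.
exact: next_site_active.
Qed.

End from_config.

Section process_activity.
Variables (L : nat) (conf : nat -> config d) (V : {fset site d}).
Local Notation init := (start_config conf V).
Local Notation process := (process p lambda L conf V).

(** Rational times make this a countable combination of events at fixed times. *)
Definition active_during (B : {fset site d}) (s t : R) (u : R -> config d) : Prop :=
  forall x, x \in B -> exists2 q : rat, s <= ratr q <= t & (1 <= nb_active (u (ratr q) x))%N.

Lemma measurable_active_during B s t :
  measurable [set w | active_during B s t (process^~ w)].
Proof.
have -> : [set w | active_during B s t (process^~ w)] = \bigcap_(x in [set` B])
   \bigcup_(q in [set: rat]) ([set _ | s <= ratr q <= t] `&`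
     \bigcup_(k in [set: nat]) [set w | process (ratr q) w x = Active k.+1]).
  apply/seteqP; split => w H x xB.
    have [q qst] := H x xB; case E : (process _ _ _) => [[|n]|] //= _.
    by exists q => //; split => //; exists n.
  have [q _ [qst [k _ /= E]]] := H x xB; exists q => //; by rewrite E.
apply: fin_bigcap_measurable => // x _; apply: countable_bigcupT_measurable.
  exact: countableP.
move=> q; apply: measurableI; first exact: measurable_cst_set.
by apply: bigcup_measurable => k _; exact: measurable_process.
Qed.

(** Only component [j] of the mixture is kept; it is selected by a digit independent of the stacks
    and of the later clocks, which gives the factor [L.+1%:R^-1]. *)
Lemma process_active_lower B k s t N j : (j < L.+1)%N -> (0 < k)%N ->
  ((L.+1%:R^-1)%:E * Q (covered (init j) B k t N `\`
     \bigcup_(x in [set` B]) covered (init j) [fset x]%fset k s N) <=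
   Q [set w | active_during B s t (process^~ w)])%E.
Proof.
move=> jL k0; set G := _ `\` _.
have mG : measurable G.
  apply: measurableD; first exact: measurable_covered.
  by apply: fin_bigcup_measurable => // x _; exact: measurable_covered.
have mE := measurable_active_during B s t.
pose A i : set (OM * OM) := if i == j then G else set0.
have mA i : measurable (A i) by rewrite /A; case: ifP.
pose F i w : \bar R := (\1_(A i) w)%:E.
have mF i : measurable_fun setT (F i) by apply/measurable_EFinP; exact: measurable_indic.
have F0 i w : (0 <= F i w)%E by rewrite lee_fin.
rewrite product_joint_integral// product_joint_integral//.
apply: (@le_trans _ _ (joint_integral (fun w => F (choice_of L (evens w.2)) (start w)))).
  rewrite joint_integral_start// (bigD1 (Ordinal jL))//=.
  rewrite /F /A eqxx leeDl// sume_ge0// => i _; rewrite mule_ge0 ?lee_fin ?invr_ge0//.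
  by rewrite /joint_integral; apply: integral_ge0 => u _; apply: integral_ge0 => w _.
apply: le_joint_integral => //.
- apply: (measurable_countable_choice (X := fun w : OM * OM => choice_of L (evens w.2))
    (G := fun i w => F i (start w))); first exact: measurable_choice.
  by move=> i; apply: measurableT_comp => //; exact: measurable_start.
- by apply/measurable_EFinP; exact: measurable_indic.
move=> w; rewrite /F /A lee_fin; case: eqP => [ij|_]; last by rewrite indic0.
rewrite !indicE; case: (boolP (start w \in G)) => // /set_mem [cov ncov].
rewrite mem_set// => x xB.
have fin0 : finite_particles (init j).
  apply: (@sub_finite_set _ _ [set` V]); last exact: finite_fset.
  by move=> y /=; rewrite /start_config /restrict; case: ifP.
have nE y : y \in B -> ~ covered (init j) [fset y]%fset k s N (start w).
  by move=> yB cy; apply: ncov; exists y.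
have [q qst [n nq ax]] := covered_window fin0 k0 cov nE xB.
exists q => //; rewrite (@processE _ _ p _ lambda0 L conf V (ratr q) w n).
  by move: ax; rewrite /chain_config ij.
by rewrite /window /ring_time /chain_hold ij.
Qed.

End process_activity.

(** The ratio one half lets a jump at most double the weight, as the discount rate
    [2 * (1 + lambda)] allows, and makes the weight summable over the lattice: this is what makes
    the bound on early topplings independent of the volume. *)
Definition exp_weight (x z : site d) : R := \prod_i (2^-1) ^+ absz (z 0%R i - x 0%R i)%R.

Lemma exp_weight_ge0 x z : 0 <= exp_weight x z.
Proof. by apply: prodr_ge0 => i _; rewrite exprn_ge0. Qed.

Lemma exp_weight_self x : exp_weight x x = 1.
Proof. by rewrite /exp_weight big1// => i _; rewrite subrr. Qed.

Lemma exp_weight_vec x z e : exp_weight x (z + vec e) <= 2 * exp_weight x z.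
Proof.
rewrite /exp_weight (bigD1 e.1)//= [in leRHS](bigD1 e.1)//= mulrA.
have E i : i != e.1 -> (z + vec e) 0 i = z 0 i.
  by move=> ie; rewrite /vec; case: e.2; rewrite !mxE (negbTE ie) andbF ?subr0 ?addr0.
rewrite (eq_bigr (fun i => 2^-1 ^+ absz (z 0%R i - x 0%R i)%R)); last by move=> i /E->.
apply: ler_wpM2r; first by apply: prodr_ge0 => i _; rewrite exprn_ge0.
set a := absz _; set b := absz _.
have ab : (b <= a.+1)%N.
  by rewrite /a /b /vec; case: e.2; rewrite !mxE !eqxx /=; lia.
rewrite -ler_pdivrMl// -exprS.
by apply: ler_wiXn2l => //; rewrite invf_le1// ler1n.
Qed.

(** The sum over a large cube factorizes over the coordinates, and each factor is at most 3: 1 for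
    the centre and a geometric series on either side. *)
Lemma sum_exp_weight x (V : {fset site d}) : \sum_(z <- V) exp_weight x z <= 3 ^+ d.
Proof.
have sum_half m : \sum_(i < m) (2^-1 : R) ^+ i.+1 <= 1.
  suff -> : \sum_(i < m) (2^-1 : R) ^+ i.+1 = 1 - 2^-1 ^+ m by rewrite gerBl exprn_ge0.
  by elim: m => [|m IH]; [rewrite big_ord0 subrr|rewrite big_ord_recr /= IH exprS; field].
pose m := \max_(z <- V) \max_i absz ((z - x)%R 0%R i).
have mV z i : z \in V -> (absz ((z - x)%R 0%R i) <= m)%N.
  move=> zV; apply: leq_trans (leq_bigmax_seq _ zV isT).
  exact: (@leq_bigmax_cond _ xpredT (fun i => absz ((z - x)%R 0%R i)) i).
pose pt (f : {ffun 'I_d -> 'I_(m + m.+1)}) : site d := x + \row_i ((f i)%:Z - m%:Z).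
pose box := map pt (enum {: {ffun 'I_d -> 'I_(m + m.+1)}}).
have pt_inj : injective pt.
  move=> f g /addrI /rowP E; apply/ffunP => i; have := E i; rewrite !mxE => /addIr [].
  by move=> /ord_inj.
have ub : uniq box by rewrite map_inj_uniq ?enum_uniq.
have Vb z : z \in V -> z \in box.
  move=> zV; have lt i : (absz ((z - x)%R 0%R i + m%:Z)%R < m + m.+1)%N by have := mV z i zV; lia.
  apply/mapP; exists [ffun i => Ordinal (lt i)]; rewrite ?mem_enum//.
  apply/rowP => i; rewrite !mxE ffunE /=; have := mV z i zV; rewrite !mxE.
  by move: (z 0 i) (x 0 i) => a b; lia.
apply: (@le_trans _ _ (\sum_(z <- box) exp_weight x z)).
  rewrite [leRHS](bigID (mem V))/= -[leLHS]addr0; apply: lerD; last first.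
    by apply: sumr_ge0 => z _; exact: exp_weight_ge0.
  rewrite -[in leRHS]big_filter (perm_big [seq z <- box | z \in V])//.
  apply: uniq_perm; rewrite ?filter_uniq ?fset_uniq// => z.
  by rewrite mem_filter; apply/idP/andP => [zV|[]//]; rewrite Vb.
rewrite big_map big_enum /=.
have -> : \sum_f exp_weight x (pt f) =
    \sum_(f : {ffun 'I_d -> 'I_(m + m.+1)}) \prod_i (2^-1) ^+ absz ((f i)%:Z - m%:Z)%R.
  apply: eq_bigr => f _; apply: eq_bigr => i _; congr (_ ^+ _).
  by rewrite !mxE [_ - x _ _]addrC addKr.
rewrite -(bigA_distr_bigA (fun i (a : 'I_(m + m.+1)) => (2^-1 : R) ^+ absz (a%:Z - m%:Z)%R)) /=.
rewrite prodr_const card_ord; apply: lerXn2r; rewrite ?nnegrE//.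
  by apply: sumr_ge0 => a _; rewrite exprn_ge0.
rewrite big_split_ord /= big_ord_recl /=.
have -> : \sum_(i < m) (2^-1 : R) ^+ absz (i%:Z - m%:Z)%R = \sum_(i < m) 2^-1 ^+ i.+1.
  rewrite (reindex_inj rev_ord_inj) /=; apply: eq_bigr => i _; congr (_ ^+ _).
  by have := ltn_ord i; lia.
have -> : \sum_(i < m) (2^-1 : R) ^+ absz ((m + fintype.bump 0 i)%N%:Z - m%:Z)%R = \sum_(i < m) 2^-1 ^+ i.+1.
  by apply: eq_bigr => i _; congr (_ ^+ _); rewrite /fintype.bump /=; lia.
have -> : absz ((m + 0)%N%:Z - m%:Z)%R = 0%N by lia.
by rewrite expr0; have := sum_half m; lra.
Qed.

(** The order of the quantifiers is the point: [t] is chosen before the volume. Only the number of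
    rings [N] depends on [V], through the number of particles, and it does not appear in the
    conclusion. *)
Lemma process_active M eps (B : {fset site d}) (s : R) k : 0 < eps -> eps <= 1 -> (0 < k)%N ->
  exists2 t : R, 0 <= t & forall L (c : nat -> site d -> nat) j (V0 V : {fset site d}),
  (j < L.+1)%N -> (forall i x, (c i x <= 1)%N) -> (V0 `<=` V)%fset ->
  ((L.+1%:R^-1 : R)%:E * ((1 - eps)%:E *
      P (coverable (fun x => if x \in V0 then c j x else 0%N) B k M) -
      (#|` B|%:R * (3 ^+ d * expR (2 * (1 + lambda) * s) / k%:R))%:E) <=
    Q [set w | active_during B s t (process p lambda L (fun i x => Active (c i x)) V ^~ w)])%E.
Proof.
move=> e0 e1 k0; have l1 := lambda1_gt0 lambda0.
(* Three errors of at most [eps / 3] each: [theta] controls the discount lost over [M] topplings,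
   [t] the exponential [expR (- (theta * t))], and [N] below the shortage of rings. *)
pose theta := eps * (1 + lambda) / (3 * M.+1%:R).
have th0 : 0 < theta by rewrite divr_gt0 ?mulr_gt0.
pose t := 3 / eps / theta.
have t0 : 0 < t by rewrite divr_gt0// divr_gt0.
exists t; first exact: ltW.
move=> L c j V0 V jL c1 V0V.
pose conf i x := Active (c i x).
pose n0 x := if x \in V0 then c j x else 0%N.
pose n1 x := if x \in V then c j x else 0%N.
have n01 x : (n0 x <= n1 x)%N.
  by rewrite /n0 /n1; case: ifP => // /(fsubsetP V0V) ->.
have iE : start_config conf V j = fun x => Active (n1 x).
  by apply/funext => x; rewrite /start_config /restrict /n1; case: ifP.
have fin0 : finite_particles (start_config conf V j).
  apply: (@sub_finite_set _ _ [set` V]); last exact: finite_fset.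
  by move=> y /=; rewrite /start_config /restrict; case: ifP.
have wp x : weighted_particles (exp_weight x) (start_config conf V j) <= 3 ^+ d.
  apply: le_trans (sum_exp_weight x V).
  rewrite (@weighted_particlesE _ _ _ _ V) ?fset_uniq//; last first.
    by move=> z; rewrite /start_config /restrict; case: ifP.
  apply: ler_sum => z _; rewrite -[leRHS]mulr1; apply: ler_wpM2l; first exact: exp_weight_ge0.
  by rewrite iE /n1 lern1; case: ifP => _ //; exact: c1.
pose K : R := 1 + weighted_particles (fun=> 1 : R) (start_config conf V j).
have wp0 : 0 <= weighted_particles (fun=> 1 : R) (start_config conf V j).
  by apply: fsumr_ge0 => z _; rewrite mul1r.
pose N := Num.truncn (3 * K * M%:R / eps).
have c_ge : 1 - eps <= 1 - (theta / (1 + lambda) + K / N.+1%:R) * M%:R - expR (- (theta * t)).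
  have H1 : theta / (1 + lambda) * M%:R <= eps / 3.
    have -> : theta / (1 + lambda) * M%:R = eps / 3 * (M%:R / M.+1%:R).
      have Mp : 0 < M.+1%:R :> R by [].
      by rewrite /theta; move: (M.+1%:R) Mp => m1 Mp; field; rewrite !gt_eqF.
    rewrite -[leRHS]mulr1; apply: ler_wpM2l; first by rewrite divr_ge0// ltW.
    by rewrite ler_pdivrMr// mul1r ler_nat.
  have H2 : K / N.+1%:R * M%:R <= eps / 3.
    have KM : 0 <= 3 * K * M%:R / eps by rewrite divr_ge0 ?mulr_ge0 ?addr_ge0// ltW.
    rewrite mulrAC ler_pdivrMr//.
    have := ltW (truncnS_gt (3 * K * M%:R / eps)); rewrite -/N ler_pdivrMr// => H.
    by rewrite -(ler_pM2l (x := 3))//; move: H; rewrite !mulrA; lra.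
  have H3 : expR (- (theta * t)) <= eps / 3.
    have -> : theta * t = 3 / eps by rewrite /t mulrCA divff ?mulr1// gt_eqF.
    rewrite expRN -[leRHS]invrK; rewrite lef_pV2 ?posrE ?expR_gt0 ?invr_gt0 ?divr_gt0//.
    rewrite invf_div; apply: le_trans (expR_ge1Dx _); lra.
  rewrite [X in _ <= _ - X - _]mulrDl; move: H1 H2 H3.
  set a := _ * M%:R; set b := _ * M%:R; set c3 := expR _ => H1 H2 H3.
  have : eps / 3 * 3 = eps by rewrite mulfVK.
  move: (eps / 3) H1 H2 H3 => e3 H1 H2 H3 H4; lra.
have K1 : 1 <= K by rewrite lerDl.
apply: le_trans (process_active_lower conf V B s t N jL k0).
apply: lee_wpmul2l; first by rewrite lee_fin invr_ge0.
set EB := \bigcup_(x in _) _; set C := covered (start_config conf V j) B k t N.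
have mC : measurable C by exact: measurable_covered.
have mEB : measurable EB by apply: fin_bigcup_measurable => // x _; exact: measurable_covered.
have EBle : (Q EB <= (#|` B|%:R * (3 ^+ d * expR (2 * (1 + lambda) * s) / k%:R))%:E)%E.
  have one x : (Q (covered (start_config conf V j) [fset x]%fset k s N) <=
      (3 ^+ d * expR (2 * (1 + lambda) * s) / k%:R)%:E)%E.
    have x1 : 1 <= exp_weight x x by rewrite exp_weight_self.
    have kk : 0 < k%:R * expR (- (2 * (1 + lambda) * s)) by rewrite mulr_gt0 ?expR_gt0 ?ltr0n.
    have : ((k%:R * expR (- (2 * (1 + lambda) * s)))%:E * Q (covered (start_config conf V j) [fset x]%fset k s N) <=
       (3 ^+ d)%:E)%E.
      apply: le_trans (covered_early fin0 k s N (exp_weight_ge0 x) x1 (exp_weight_vec x)) _.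
      by rewrite lee_fin; exact: wp.
    rewrite -lee_pdivlMl// => /le_trans; apply; rewrite -EFinM lee_fin.
    by rewrite invfM expRN invrK le_eqVlt; apply/orP; left; apply/eqP; ring.
  have mc x : [set` B] x -> measurable (covered (start_config conf V j) [fset x]%fset k s N).
    by move=> _; exact: measurable_covered.
  have := content_sub_fsum Q (finite_fset B) mc mEB (@subset_refl _ _).
  move=> /le_trans; apply.
  rewrite -fsbig_seq ?fset_uniq//; apply: (@le_trans _ _ (\sum_(x <- B)
    (3 ^+ d * expR (2 * (1 + lambda) * s) / k%:R)%:E)%E).
    by apply: lee_sum => x _; exact: one.
  by rewrite sumEFin lee_fin big_const_seq count_predT iter_addr_0 -[X in X <= _]mulr_natl.
have D : (Q C <= Q (C `\` EB) + Q EB)%E.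
  apply: (@le_trans _ _ (Q ((C `\` EB) `|` EB))); last by apply: measureU2 => //; exact: measurableD.
  apply: le_measure; rewrite ?inE//; first by apply: measurableU => //; exact: measurableD.
  by move=> w Cw; have [h|h] := pselect (EB w); [right|left].
have sub (x y z : \bar R) : y \is a fin_num -> (x <= z + y -> x - y <= z)%E by move=> fb; rewrite leeBlDr.
apply: sub => //; apply: (le_trans _ (leeD2l _ EBle)); apply: (le_trans _ D).
have := covered_coverable fin0 B k (M := M) (t := t) (N := N) (ltW th0) K1 (ltac:(by rewrite /K lerDr)) iE n01.
move=> /(_ (le_trans (ltac:(by rewrite subr_ge0) : 0 <= 1 - eps) c_ge)) => H; apply: le_trans H.
by apply: lee_wpmul2r => //; rewrite lee_fin.
Qed.

End activity.

(** * Toppling strategies *)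

Section strategies.
Context {R : realType} (d : nat).
Variables (p : site d -> R) (lambda : R).
Hypotheses (pJ : jump_distribution p) (lambda0 : 0 < lambda).
Implicit Types (x y w : site d) (h : history d) (eta : config d) (f : history d -> R).
Local Notation OM := (measurableTypeR R).
Local Notation P := (@unif R).
Local Notation istack := (instr_stack p lambda).
Local Notation iprob := (iprob p lambda).

(* [ach eta0 f h v]: after the topplings [h] one may go on with a bounded
   number of legal topplings, each chosen according to the instructions read
   before, in such a way that [f] of the final history has mean at least [v]. *)
Inductive ach eta0 f : history d -> R -> Prop :=
| ach_stop h v : v <= f h -> ach eta0 f h v
| ach_topple h v x (g : instr d -> R) : (0 < act (run eta0 h) x)%N ->
    (forall i, ach eta0 f (rcons h (x, i)) (g i)) ->
    v <= \sum_i iprob i * g i -> ach eta0 f h v.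

Lemma ach_le eta0 f h v (w : R) : ach eta0 f h w -> v <= w -> ach eta0 f h v.
Proof.
case=> {}h {}w; first by move=> wf vw; apply: ach_stop; exact: le_trans wf.
by move=> x g ax ag wg vw; apply: (ach_topple ax ag); exact: le_trans wg.
Qed.

Lemma ach_comp eta0 f f' h v : legal eta0 h -> ach eta0 f h v ->
  (forall h', legal eta0 h' -> ach eta0 f' h' (f h')) -> ach eta0 f' h v.
Proof.
move=> lh A H; elim: A lh => {h v} [h v vf|h v x g ax _ IH vg] lh.
  by apply: ach_le vf; exact: H.
by apply: (ach_topple ax _ vg) => i; apply: IH; rewrite legal_rcons lh.
Qed.

Lemma ach_scale eta0 f h v (c : R) : 0 <= c -> ach eta0 f h v ->
  ach eta0 (fun h => c * f h) h (c * v).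
Proof.
move=> c0; elim=> {h v} [h v vf|h v x g ax _ IH vg].
  by apply: ach_stop; rewrite ler_wpM2l.
apply: (ach_topple ax IH); apply: le_trans (ler_wpM2l c0 vg) _.
by rewrite mulr_sumr le_eqVlt; apply/orP; left; apply/eqP; apply: eq_bigr => i _; rewrite mulrCA.
Qed.

(* The same strategy is used for all the objectives [F t]. *)
Lemma ach_sum eta0 (T : eqType) (s : seq T) (F : T -> history d -> R) h v :
  ach eta0 (fun h => \sum_(t <- s) F t h) h v ->
  exists2 c : T -> R, v <= \sum_(t <- s) c t & forall t, ach eta0 (F t) h (c t).
Proof.
elim=> {h v} [h v vF|h v x g ax _ IH vg].
  by exists (fun t => F t h) => // t; exact: ach_stop.
have /choice[c cP] : forall i, exists c : T -> R, g i <= \sum_(t <- s) c t /\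
    forall t, ach eta0 (F t) (rcons h (x, i)) (c t).
  by move=> i; have [c ? ?] := IH i; exists c.
exists (fun t => \sum_i iprob i * c i t).
  rewrite exchange_big /=; apply: le_trans vg _; apply: ler_sum => i _.
  by rewrite -mulr_sumr ler_wpM2l ?iprob_ge0//; case: (cP i).
by move=> t; apply: (@ach_topple _ _ _ _ x (fun i => c i t)) => // i; case: (cP i).
Qed.

Definition reach eta0 (S : history d -> Prop) M : set OM :=
  [set u | exists h, [/\ legal eta0 h, consistent (istack u) zero_count h, (size h <= M)%N & S h]].

Lemma measurable_reach eta0 S M : measurable (reach eta0 S M).
Proof.
have -> : reach eta0 S M = \bigcup_(h in [set: history d])
   (consistent_set p lambda h `&` [set _ | [/\ legal eta0 h, (size h <= M)%N & S h]]).
  by apply/seteqP; split => [u [h [? ? ? ?]]|u [h _ [? []]]]; exists h.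
apply: countable_bigcupT_measurable; first exact: countableP.
move=> h; apply: measurableI; first exact: measurable_consistent.
exact: measurable_cst_set.
Qed.

Lemma reach_le eta0 S M M' : (M <= M')%N -> reach eta0 S M `<=` reach eta0 S M'.
Proof. by move=> MM' u [h [lh ch hM Sh]]; exists h; split => //; exact: leq_trans MM'. Qed.

(** The branches of a strategy read distinct instructions at the same place of a stack, so they are
    disjoint events whose probabilities add up; as there are finitely many instructions, the lengths
    of the branches have a maximum. *)
Lemma ach_sound eta0 S f h v : (forall h', f h' <= (`[< S h' >])%:R) ->
  legal eta0 h -> ach eta0 f h v ->
  exists M, ((history_prob p lambda h * v)%:E <= P (consistent_set p lambda h `&` reach eta0 S M))%E.
Proof.
move=> fS lh A.
have hp0 g : 0 <= history_prob p lambda g by apply: prodr_ge0 => xi _; exact: iprob_ge0.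
elim: A lh => {h v} [h v vf|h v x g ax _ IH vg] lh.
  exists (size h); have := fS h; case: asboolP => [Sh f1|_ f0].
    have -> : consistent_set p lambda h `&` reach eta0 S (size h) = consistent_set p lambda h.
      by apply: setIidl => u ch; exists h.
    rewrite [leRHS](probability_consistent pJ lambda0) lee_fin -[leRHS]mulr1 ler_wpM2l//.
    exact: le_trans f1.
  apply: (@le_trans _ _ 0%E) => //; rewrite lee_fin mulr_ge0_le0//.
  exact: le_trans vf f0.
have /choice[M MP] : forall i, exists M, ((history_prob p lambda (rcons h (x, i)) * g i)%:E <=
    P (consistent_set p lambda (rcons h (x, i)) `&` reach eta0 S M))%E.
  by move=> i; apply: IH; rewrite legal_rcons lh.
exists (\max_i M i); set Rm := reach _ _ _.
pose A i := consistent_set p lambda (rcons h (x, i)) `&` Rm.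
have mR : measurable Rm by exact: measurable_reach.
have mA i : measurable (A i) by apply: measurableI => //; exact: measurable_consistent.
have -> : consistent_set p lambda h `&` Rm = \bigcup_(i in [set: instr d]) A i.
  rewrite /A -setI_bigcupl; congr (_ `&` _); apply/seteqP; split => u.
    by move=> ch; exists (istack u x (cnt h x)) => //; rewrite /consistent_set /= consistent_rcons ch eqxx.
  by move=> [i _]; rewrite /consistent_set /= consistent_rcons => /andP[].
rewrite [leRHS](@measure_fin_bigcup _ _ _ P _ [set: instr d] A)//; last 2 first.
- exact: finite_finset.
- apply/trivIsetP => i j _ _ ij; rewrite -subset0 => u [[+ _] [+ _]].
  rewrite /consistent_set /= !consistent_rcons => /andP[_ /eqP->] /andP[_ /eqP E].
  by rewrite E eqxx in ij.
rewrite fsbig_finite/=; last exact: finite_finset.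
rewrite [leRHS](_ : _ = \sum_i P (A i))%E; last first.
  rewrite -[RHS](big_enum _ _ predT); apply: perm_big; apply: uniq_perm => //.
  - exact: fset_uniq.
  - exact: enum_uniq.
  - by move=> i; rewrite in_fset_set; [rewrite mem_enum in_setT|exact: finite_finset].
apply: (@le_trans _ _ (\sum_i (history_prob p lambda h * iprob i * g i)%:E)%E).
  rewrite sumEFin lee_fin; under eq_bigr => i _ do rewrite -mulrA.
  by rewrite -mulr_sumr ler_wpM2l.
apply: lee_sum => i _; have := MP i; rewrite history_prob_rcons => /le_trans; apply.
apply: le_measure; rewrite ?inE//.
  by apply: measurableI; [exact: measurable_consistent|exact: measurable_reach].
by apply: setIS; apply: reach_le; exact: leq_bigmax.
Qed.

Definition shift_history w h : history d := [seq (xi.1 + w, xi.2) | xi <- h].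

Definition shift_config w eta : config d := fun y => eta (y - w).

Lemma apply_instr_shift w x i eta :
  apply_instr (x + w) i (shift_config w eta) = shift_config w (apply_instr x i eta).
Proof.
apply/funext => z; have E y : (z == y + w) = (z - w == y) by rewrite subr_eq.
case: i => [e|] /=; rewrite /jump /sleep_at /shift_config.
  by rewrite (addrAC x w (vec e)) !E !addrK.
by rewrite E addrK.
Qed.

Lemma run_shift w h eta : run (shift_config w eta) (shift_history w h) = shift_config w (run eta h).
Proof. by elim: h eta => [|[x i] h IH] eta //=; rewrite apply_instr_shift IH. Qed.

(** Instructions have the same law at all sites, so a strategy may be translated. This brings the
    site of the pile to the source given by [ach_source]. *)
Lemma ach_shift w eta0 f f' h v : (forall g, f g = f' (shift_history w g)) ->
  ach eta0 f h v -> ach (shift_config w eta0) f' (shift_history w h) v.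
Proof.
move=> ff'; elim=> {h v} [h v vf|h v x g ax _ IH vg].
  by apply: ach_stop; rewrite -ff'.
apply: (@ach_topple _ _ _ _ (x + w) g) => //.
  by rewrite run_shift /act /shift_config addrK.
by move=> i; have := IH i; rewrite /shift_history map_rcons.
Qed.

(** * Sending particles from a pile along paths *)

Section pile.

Definition positive_path (s : seq (dir d)) := all (fun e => 0 < p (vec e)) s.

Definition endpoint x (s : seq (dir d)) : site d := x + \sum_(e <- s) vec e.

Definition path_prob (s : seq (dir d)) : R := \prod_(e <- s) iprob (Some e).

Lemma path_prob_gt0 s : positive_path s -> 0 < path_prob s.
Proof.
move=> /allP ps; rewrite /path_prob big_seq; apply: prodr_gt0 => e es.
by rewrite divr_gt0 ?ps// (lambda1_gt0 lambda0).
Qed.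

Lemma path_prob_le1 s : path_prob s <= 1.
Proof.
apply: prodr_ile1 => e _; rewrite iprob_ge0// andTb.
rewrite -[leRHS](sum_iprob pJ lambda0) (bigD1 (Some e))//= lerDl.
by apply: sumr_ge0 => i _; exact: iprob_ge0.
Qed.

Lemma act_apply_ge x i eta y : (act eta y <= (act (apply_instr x i eta) y).+1)%N.
Proof.
rewrite /act; case: i => [e|] /=; rewrite /jump /sleep_at.
  case: eqP => [->|_]; first by case: (eta x) => [[|n]|].
  by case: eqP => [->|_]; [case: (eta _) => [n|] //=; lia|].
by case: eqP => [->|_] //; case: (eta x) => [[|[|n]]|].
Qed.

Lemma act_target_gt0 x e eta : (0 < act (apply_instr x (Some e) eta) (x + vec e))%N.
Proof. by rewrite /act /= /jump addvec_neq eqxx; case: (eta _). Qed.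

Variables (eta0 : config d) (xs : site d).

Definition visited (c0 : site d -> nat) y K h : bool :=
  `[< [/\ forall z, (c0 z <= cnt h z)%N, (c0 y < cnt h y)%N & (K <= act (run eta0 h) xs)%N] >].

(** One attempt: a particle follows [s] as long as the instructions agree with it, and at the first
    deviation the attempt is given up for the fallback value [phi]. A toppling removes at most one
    active particle from the pile, so an attempt costs at most [(size s).+1], including the toppling
    at the end point. *)
Lemma ach_path c0 y K (phi : R) : 0 <= phi <= 1 ->
  forall s h z K', (K' >= K)%N ->
  (forall h', (forall z, (c0 z <= cnt h' z)%N) -> (K' <= act (run eta0 h') xs)%N ->
     ach eta0 (fun h => (visited c0 y K h)%:R) h' phi) ->
  positive_path s -> y = endpoint z s -> (0 < act (run eta0 h) z)%N ->
  (forall z, (c0 z <= cnt h z)%N) -> (K' + (size s).+1 <= act (run eta0 h) xs)%N ->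
  ach eta0 (fun h => (visited c0 y K h)%:R) h (path_prob s + (1 - path_prob s) * phi).
Proof.
move=> /andP[phi0 phi1]; elim=> [|e s IH] h z K' KK' fb ps yE az cz ax.
  rewrite /path_prob big_nil subrr mul0r addr0.
  have yz : y = z by rewrite yE /endpoint big_nil addr0.
  apply: (@ach_topple _ _ _ _ y (fun=> 1)); first by rewrite yz.
    move=> i; apply: ach_stop; rewrite /visited asboolT//; split.
    - by move=> t; rewrite cnt_rcons /bump (leq_trans (cz t))// leq_addr.
    - by rewrite cnt_rcons /bump eqxx addn1 ltnS.
    - rewrite run_rcons; have := act_apply_ge y i (run eta0 h) xs.
      by move: ax => /=; lia.
  by rewrite -mulr_suml (sum_iprob pJ lambda0) mul1r.
move: ps => /= /andP[pe ps].
pose g i := if i == Some e then path_prob s + (1 - path_prob s) * phi else phi.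
apply: (@ach_topple _ _ _ _ z g) => //.
  have cz' i t : (c0 t <= cnt (rcons h (z, i)) t)%N.
    by rewrite cnt_rcons /bump (leq_trans (cz t))// leq_addr.
  have ax' i : (K' + (size s).+1 <= act (run eta0 (rcons h (z, i))) xs)%N.
    by rewrite run_rcons; have := act_apply_ge z i (run eta0 h) xs; move: ax => /=; lia.
  move=> i; rewrite /g; case: eqP => [->|_].
    apply: (IH _ (z + vec e) K') => //.
      by rewrite yE /endpoint big_cons addrA.
    by rewrite run_rcons; exact: act_target_gt0.
  apply: fb => //; apply: leq_trans (ax' i); exact: leq_addr.
rewrite (bigD1 (Some e))//= /g eqxx.
rewrite (eq_bigr (fun i => iprob i * phi)); last by move=> i /negbTE ->.
rewrite -mulr_suml.
have -> : \sum_(i | i != Some e) iprob i = 1 - iprob (Some e).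
  by rewrite -[X in _ = X - _](sum_iprob pJ lambda0) [in RHS](bigD1 (Some e))//= addrAC subrr add0r.
rewrite /path_prob big_cons -/(path_prob s) /=; set a := _ / _; set b := path_prob s.
by rewrite le_eqVlt; apply/orP; left; apply/eqP; ring.
Qed.

Lemma ach_attempts s K A c0 h : positive_path s ->
  (forall z, (c0 z <= cnt h z)%N) -> (K + A * (size s).+1 <= act (run eta0 h) xs)%N ->
  ach eta0 (fun h => (visited c0 (endpoint xs s) K h)%:R) h (1 - (1 - path_prob s) ^+ A).
Proof.
move=> ps; have := path_prob_le1 s; have := path_prob_gt0 ps; move=> p0 p1.
elim: A h => [|A IH] h cz ax.
  by apply: ach_stop; rewrite expr0 subrr.
have q0 : 0 <= 1 - path_prob s by rewrite subr_ge0.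
have q1 : 1 - path_prob s <= 1 by rewrite gerBl ltW.
have hphi : 0 <= 1 - (1 - path_prob s) ^+ A <= 1.
  by rewrite subr_ge0 exprn_ile1//= gerBl exprn_ge0.
have a0 : (0 < act (run eta0 h) xs)%N by move: ax; rewrite mulSn; lia.
have a1 : (K + A * (size s).+1 + (size s).+1 <= act (run eta0 h) xs)%N by move: ax; rewrite mulSn; lia.
apply: (ach_le (ach_path hphi (leq_addr (A * (size s).+1) K) IH ps erefl a0 cz a1)).
by rewrite exprS le_eqVlt; apply/orP; left; apply/eqP; ring.
Qed.

End pile.

(** Half of [eps] is allotted to the first path and half to the others. The pile must still have the
    height needed for the other paths after all the attempts along the first one, whence the sum
    that defines [K]. *)
Lemma pile_cover xs (T : seq (seq (dir d))) (eps : R) : all positive_path T -> 0 < eps ->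
  exists K, forall eta0 h, legal eta0 h -> (K <= act (run eta0 h) xs)%N ->
  ach eta0 (fun g => (`[< forall y, (cnt h y + count_mem y [seq endpoint xs s | s <- T] <= cnt g y)%N >])%:R)
    h (1 - eps).
Proof.
elim: T eps => [|s T IH] eps /= pT e0.
  exists 0%N => eta0 h _ _; apply: ach_stop; rewrite asboolT; last by move=> y; rewrite addn0.
  by rewrite gerBl ltW.
have [e1|e1] := leP 1 eps.
  by exists 0%N => eta0 h _ _; apply: ach_stop; rewrite (@le_trans _ _ 0)// subr_le0.
move: pT => /andP[ps pT]; have e20 : 0 < eps / 2 by rewrite divr_gt0.
have [K' HK'] := IH _ pT e20.
have p0 := path_prob_gt0 ps; have p1 := path_prob_le1 s.
have [A HA] : exists A, (1 - path_prob s) ^+ A <= eps / 2.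
  have : `|1 - path_prob s| < 1 by rewrite ger0_norm ?subr_ge0// gtrBl.
  move=> /cvg_expr /cvgrPdist_le /(_ _ e20) [A _ /(_ A (leqnn A))].
  rewrite sub0r normrN ger0_norm ?exprn_ge0 ?subr_ge0// => H.
  by exists A.
exists (K' + A * (size s).+1)%N => eta0 h lh aK.
have := @ach_attempts eta0 xs s K' A (cnt h) h ps (fun=> leqnn _) aK.
have e2 : 0 <= 1 - eps / 2 by rewrite subr_ge0; move: e1; lra.
move=> /(ach_scale e2) S1; apply: ach_le.
  apply: (ach_comp lh S1) => h' lh'; rewrite /visited.
  case: asboolP => [[c1 c2 c3]|_]; last by rewrite mulr0; apply: ach_stop.
  rewrite mulr1; apply: (ach_comp lh' (HK' eta0 h' lh' c3)) => g lg; apply: ach_stop.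
  case: asboolP => // H; rewrite asboolT// => y; apply: leq_trans (H y).
  rewrite addnA leq_add2r; case: eqP => [<-|_] /=; first by rewrite addn1.
  by rewrite addn0.
set q := _ ^+ A in HA *; have : 0 <= q by rewrite exprn_ge0// subr_ge0.
by move=> q0; have := mulr_ge0 (ltW e20) q0; move: (eps / 2) (divfK (ltac:(by []) : 2 != 0 :> R) eps) HA => e' <- HA; lra.
Qed.

(** The support of [p] generates the lattice only as a group, and a walk may be unable to go back,
    as when it is totally asymmetric. So sites are written as differences of two paths, and the
    source is moved backwards each time a site is added. *)
Lemma ach_source (B : seq (site d)) :
  exists xs, forall y, y \in B -> exists2 s, positive_path s & y = endpoint xs s.
Proof.
pose S : {pred site d} := fun y => `[< exists s1 s2, [/\ positive_path s1, positive_path s2 &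
  y = \sum_(e <- s1) vec e - \sum_(e <- s2) vec e] >].
have SP y : y \in S -> exists s1 s2, [/\ positive_path s1, positive_path s2 &
    y = \sum_(e <- s1) vec e - \sum_(e <- s2) vec e] by move/asboolP.
have SZ : zmod_closed S.
  split; first by apply/asboolP; exists [::], [::]; split; rewrite ?big_nil ?subrr.
  move=> y z /SP[s1 [s2 [p1 p2 ->]]] /SP[s3 [s4 [p3 p4 ->]]]; apply/asboolP.
  exists (s1 ++ s4), (s2 ++ s3); rewrite /positive_path !all_cat.
  split; [exact/andP|exact/andP|].
  by rewrite !big_cat /= opprB opprD addrACA [- _ + _]addrC addrACA.
have Sp y : p y != 0 -> y \in S.
  move=> py; have py0 : 0 < p y by rewrite lt0r py (jump_ge0 pJ).
  have [i [yE|yE]] := jump_nearest pJ py; apply/asboolP.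
    exists [:: (i, true)], [::]; split => //; first by rewrite /positive_path /= andbT /vec /= -yE.
    by rewrite big_seq1 big_nil subr0.
  exists [:: (i, false)], [::]; split => //; first by rewrite /positive_path /= andbT /vec /= -yE.
  by rewrite big_seq1 big_nil subr0.
have Sall := jump_generates pJ SZ Sp.
elim: B => [|y B [xs IH]]; first by exists 0.
have [s1 [s2 [p1 p2 E]]] := SP _ (Sall (y - xs)).
(* Since [y - xs] is the displacement of [s1] minus that of [s2], this site leads to [y] along [s1]
   and to the former source along [s2]. *)
exists (y - \sum_(e <- s1) vec e) => z; rewrite in_cons => /orP[/eqP->|zB].
  by exists s1 => //; rewrite /endpoint subrK.
have [s ps ->] := IH z zB; exists (s2 ++ s); first by rewrite /positive_path all_cat; exact/andP.
rewrite /endpoint big_cat /= addrA; congr (_ + _).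
have -> : y = xs + (\sum_(e <- s1) vec e - \sum_(e <- s2) vec e) by rewrite -E addrC subrK.
by rewrite [X in xs + X]addrC addrA addrK subrK.
Qed.

End strategies.

(** * Killed walks *)

Lemma NegzB1 n : Negz n - 1 = Negz n.+1. Proof. lia. Qed.

Lemma NegzSD1 n : Negz n.+1 + 1 = Negz n. Proof. lia. Qed.

Section height.
Variables (d : nat) (up : dir d).
Local Notation down := (up.1, ~~ up.2).
Implicit Types (z : site d) (e : dir d).

Definition height z : int := if up.2 then z 0 up.1 else - z 0 up.1.

Definition climb (e : dir d) : int := if e == up then 1 else if e == down then -1 else 0.

Lemma heightD z e : height (z + vec e) = height z + climb e.
Proof.
rewrite /height /climb /vec; case: up e => [i c] [j c'] /=; rewrite !xpair_eqE.
have [ji|ji] := eqVneq j i.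
  by rewrite ji; case: c; case: c'; rewrite !mxE !eqxx /=; lia.
by case: c; case: c'; rewrite !mxE /= [i == j]eq_sym !(negbTE ji) ?andbF /=; lia.
Qed.

Lemma down_up : (down == up) = false.
Proof. by case: up => [i [|]]; rewrite xpair_eqE /= ?andbF. Qed.

Lemma climb_le1 e : climb e <= 1.
Proof. by rewrite /climb; case: ifP => // _; case: ifP. Qed.

Lemma height_surj (j : nat) : exists x, height x = j%:Z.
Proof.
elim: j => [|j [x hx]]; first by exists 0; rewrite /height; case: up.2; rewrite mxE ?oppr0.
by exists (x + vec up); rewrite heightD hx /climb eqxx; lia.
Qed.

End height.

Section walks.
Context {R : realType} (d : nat).
Variables (p : site d -> R) (lambda : R).
Hypotheses (pJ : jump_distribution p) (lambda0 : 0 < lambda).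
Variables (up : dir d).
Local Notation down := (up.1, ~~ up.2).
Local Notation height := (height up).
Local Notation climb := (climb up).
Local Notation a := (p (vec up)).
Local Notation b := (p (vec down)).
Hypothesis ab : b < a.
Implicit Types (x y z : site d) (h : history d) (k : int).
Local Notation iprob := (iprob p lambda).

Let b0 : 0 <= b. Proof. exact: jump_ge0 pJ _. Qed.
Let a0 : 0 < a. Proof. exact: le_lt_trans b0 ab. Qed.
Let l1 : 0 < 1 + lambda. Proof. exact: lambda1_gt0. Qed.

Lemma sum_updown (F : dir d -> R) :
  \sum_e F e = F up + (F down + \sum_(e | (e != up) && (e != down)) F e).
Proof. by rewrite (bigD1 up)//= (bigD1 down)//= down_up. Qed.

Lemma sum_climb (phi : int -> R) k :
  \sum_e p (vec e) * phi (k + climb e) = a * phi (k + 1) + b * phi (k - 1) + (1 - a - b) * phi k.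
Proof.
have := sum_jump pJ; rewrite !sum_updown => E.
have Ec e : (e != up) && (e != down) -> climb e = 0.
  by rewrite /climb => /andP[/negbTE-> /negbTE->].
rewrite (eq_bigr (fun e => p (vec e) * phi k)); last by move=> e /Ec->; rewrite addr0.
rewrite -mulr_suml /climb eqxx down_up eqxx addrA; congr (_ + _ * _).
by move: E; set S := \sum_(e | _) _ => E; lra.
Qed.

Lemma jump_ab_le1 : a + b <= 1.
Proof.
rewrite -(sum_jump pJ) sum_updown addrA lerDl.
by apply: sumr_ge0 => e _; exact: jump_ge0 pJ _.
Qed.

(* The probability that a walk killed at rate [lambda] on the nonpositive
   levels, and not elsewhere, is never killed is at least [escape k] when it
   starts from level [k]. *)
Definition kill_ratio : R := (1 + lambda / (a - b))^-1.
Definition escape0 : R := (a - b) / (lambda + a - b * kill_ratio).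
Definition escape (k : int) : R :=
  match k with
  | Posz n => 1 - (1 - escape0) * (b / a) ^+ n
  | Negz n => escape0 * kill_ratio ^+ n.+1
  end.

Let dab : 0 < a - b. Proof. by rewrite subr_gt0. Qed.

Lemma kill_ratio_gt0 : 0 < kill_ratio.
Proof. by rewrite invr_gt0 addr_gt0// divr_gt0. Qed.

Lemma kill_ratio_le1 : kill_ratio <= 1.
Proof. by rewrite invf_le1 ?lerDl ?addr_gt0 ?divr_ge0 ?ltW ?divr_gt0. Qed.

Let bk : b * kill_ratio <= b.
Proof. by rewrite -[leRHS]mulr1 ler_wpM2l// kill_ratio_le1. Qed.

Lemma escape0_gt0 : 0 < escape0.
Proof. by rewrite divr_gt0//; move: bk ab lambda0; lra. Qed.

Lemma escape0_lt1 : escape0 < 1.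
Proof.
have q : 0 < lambda + a - b * kill_ratio by move: bk ab lambda0; lra.
by rewrite ltr_pdivrMr// mul1r; move: bk lambda0; lra.
Qed.

Let t0 : 0 <= b / a. Proof. by rewrite divr_ge0// ltW. Qed.
Let t1 : b / a <= 1. Proof. by rewrite ler_pdivrMr// mul1r ltW. Qed.

Lemma escape_ge0 k : 0 <= escape k.
Proof.
have c0 := ltW escape0_gt0; have c1 := ltW escape0_lt1; have k0 := ltW kill_ratio_gt0.
case: k => n /=; last by rewrite mulr_ge0// exprn_ge0.
by rewrite subr_ge0 mulr_ile1 ?exprn_ge0 ?exprn_ile1 ?subr_ge0// gerBl.
Qed.

Lemma escape_le1 k : escape k <= 1.
Proof.
have c0 := ltW escape0_gt0; have c1 := ltW escape0_lt1; have k0 := ltW kill_ratio_gt0.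
case: k => n /=; first by rewrite gerBl mulr_ge0 ?exprn_ge0// subr_ge0.
by rewrite mulr_ile1 ?exprn_ge0 ?exprn_ile1// kill_ratio_le1.
Qed.

Lemma escape_killed k : k <= 0 ->
  (lambda + a + b) * escape k <= a * escape (k + 1) + b * escape (k - 1).
Proof.
have k0 : kill_ratio != 0 by rewrite gt_eqF// kill_ratio_gt0.
case: k => [[|n]|n] // _.
  have -> : 0%:Z - 1 = Negz 0 by [].
  have -> : 0%:Z + 1 = 1%:Z by [].
  rewrite /= !expr0 !expr1 mulr1.
  have q : lambda + a - b * kill_ratio != 0 by rewrite gt_eqF//; move: bk ab lambda0; lra.
  (* [escape0] is the value that turns the inequality at level 0 into an equality. *)
  have Ec : escape0 * (lambda + a - b * kill_ratio) = a - b by rewrite mulfVK.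
  have Et : a * (1 - (1 - escape0) * (b / a)) = a - (1 - escape0) * b.
    by field; rewrite gt_eqF.
  rewrite Et; move: Ec; move: (escape0) (kill_ratio) (p _) (p _) => c q' v u Ec.
  have -> : (lambda + u + v) * (1 - (1 - c)) = c * (lambda + u - v * q') + c * v + v * (c * q') by ring.
  by rewrite Ec le_eqVlt; apply/orP; left; apply/eqP; ring.
(* The exact ratio would be a root of this quadratic; a rational ratio at which the inequality holds
   avoids the square root. *)
have key : (lambda + a + b) * kill_ratio <= a + b * kill_ratio ^+ 2.
  have E : kill_ratio * (1 + lambda / (a - b)) = 1 by rewrite mulVf// -invr_eq0.
  have E2 : kill_ratio * lambda = (1 - kill_ratio) * (a - b).
    have -> : 1 - kill_ratio = kill_ratio * (lambda / (a - b)).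
      by rewrite -[in LHS]E mulrDr mulr1 addrAC subrr add0r.
    by rewrite mulrA mulfVK// gt_eqF.
  have : 0 <= (1 - kill_ratio) * (b - b * kill_ratio).
    by rewrite mulr_ge0// subr_ge0// kill_ratio_le1.
  by move: E2; move: (kill_ratio) (p _) (p _) => q u v; rewrite expr2; nra.
rewrite NegzB1.
have step : escape (Negz n + 1) = escape0 * kill_ratio ^+ n.
  case: n => [|n]; first by rewrite (_ : Negz 0 + 1 = 0%:Z)//= expr0 !mulr1 subKr.
  by rewrite NegzSD1.
rewrite step /=.
have -> : (lambda + a + b) * (escape0 * kill_ratio ^+ n.+1) =
  escape0 * kill_ratio ^+ n * ((lambda + a + b) * kill_ratio) by rewrite exprS; ring.
have -> : a * (escape0 * kill_ratio ^+ n) + b * (escape0 * kill_ratio ^+ n.+2) =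
  escape0 * kill_ratio ^+ n * (a + b * kill_ratio ^+ 2) by rewrite !exprS; ring.
by rewrite ler_wpM2l// mulr_ge0 ?exprn_ge0 ?ltW ?escape0_gt0 ?kill_ratio_gt0.
Qed.

Lemma escape_free k : (a + b) * escape k <= a * escape (k + 1) + b * escape (k - 1).
Proof.
have [k0|k0] := leP k 0.
  apply: le_trans (escape_killed k0); rewrite ler_wpM2r ?escape_ge0//.
  by rewrite -addrA lerDr ltW.
case: k k0 => [[|n]|n] // _.
have -> : n.+1%:Z - 1 = n%:Z by lia.
have -> : n.+1%:Z + 1 = n.+2%:Z by lia.
rewrite /= le_eqVlt; apply/orP; left; apply/eqP; rewrite !exprS.
by field; rewrite gt_eqF.
Qed.

Section killed_walk.
Variables (stop free : pred (site d)).

(* The mean of [phi] at the site where the walk stops, for a walk which stops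
   on [stop], is killed by an instruction to sleep except on [free], and is
   abandoned after [M] instructions. *)
Fixpoint walk M (phi : site d -> R) z : R :=
  if stop z then phi z else
  if M is M'.+1 then \sum_i iprob i *
    (if i is Some e then walk M' phi (z + vec e) else if free z then walk M' phi z else 0)
  else 0.

Lemma walk_ge0 M phi z : (forall y, 0 <= phi y) -> 0 <= walk M phi z.
Proof.
move=> phi0; elim: M z => [|M IH] z /=; case: (stop z) => //.
by apply: sumr_ge0 => i _; rewrite mulr_ge0 ?iprob_ge0//; case: i => [e|] //; case: ifP.
Qed.

Lemma walk_linear M (c c' : R) phi phi' z :
  walk M (fun y => c * phi y + c' * phi' y) z = c * walk M phi z + c' * walk M phi' z.
Proof.
elim: M z => [|M IH] z /=; case: (stop z) => //; first by rewrite !mulr0 addr0.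
rewrite !mulr_sumr -big_split /=; apply: eq_bigr => i _.
rewrite mulrCA [c' * _]mulrCA -mulrDr; congr (_ * _).
by case: i => [e|]; rewrite ?IH//; case: ifP => _; rewrite ?IH// !mulr0 addr0.
Qed.

Lemma walk_sum M (s : seq (site d)) (w : site d -> R) (phi : site d -> site d -> R) z :
  walk M (fun y => \sum_(x <- s) w x * phi x y) z = \sum_(x <- s) w x * walk M (phi x) z.
Proof.
elim: s => [|x s IH].
  rewrite big_nil -[RHS](mul0r (walk M (fun=> 0) z)) -[RHS]addr0 -[X in _ + X](mul0r (walk M (fun=> 0) z)).
  rewrite -walk_linear; congr walk; apply/funext => y; by rewrite big_nil !mul0r addr0.
rewrite big_cons -IH -[X in _ + X]mul1r -walk_linear.
by congr walk; apply/funext => y; rewrite big_cons mul1r.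
Qed.

(** As [escape] is a subsolution for the killed walk, mass is lost only by abandonment. The mean
    climb per instruction is [(a - b) / (1 + lambda)], so [bd] bounds the mean number of
    instructions needed to pass [Hmax], and Markov's inequality bounds the loss by [bd] over [M]. *)
Lemma walk_lower (H Hmax : int) : (forall z, ~~ stop z -> height z <= Hmax) ->
  (forall z, ~~ stop z -> ~~ free z -> height z <= H) ->
  forall M z, height z <= Hmax + 1 ->
  M%:R * (escape (height z - H) - walk M (fun=> 1) z) <=
  (1 + lambda) / (a - b) * (Hmax + 1 - height z)%:~R.
Proof.
move=> sH fH; pose bd z := (1 + lambda) / (a - b) * (Hmax + 1 - height z)%:~R : R.
have bd0 z : height z <= Hmax + 1 -> 0 <= bd z.
  by move=> zH; rewrite mulr_ge0 ?ler0z ?subr_ge0// divr_ge0// ltW.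
elim=> [|M IH] z zH; first by rewrite mul0r; exact: bd0.
rewrite /=; case: ifP => [_|/negbT sz].
  by apply: le_trans (bd0 _ zH); rewrite mulr_ge0_le0// subr_le0 escape_le1.
pose u z := escape (height z - H).
pose ui (i : instr d) := if i is Some e then u (z + vec e) else if free z then u z else 0.
pose Wi (i : instr d) := if i is Some e then walk M (fun=> 1) (z + vec e) else if free z then walk M (fun=> 1) z else 0.
pose Bi (i : instr d) := if i is Some e then bd (z + vec e) else bd z.
have umean : u z <= \sum_i iprob i * ui i.
  set k := height z - H.
  have -> : \sum_i iprob i * ui i = (lambda * ui None + (a * escape (k + 1) + b * escape (k - 1) +
      (1 - a - b) * escape k)) / (1 + lambda).
    rewrite big_option mulrDl; congr (_ + _); first exact: mulrAC.
    rewrite -(sum_climb escape) mulr_suml; apply: eq_bigr => e _.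
    by rewrite /ui /u heightD addrAC [LHS]mulrAC.
  rewrite ler_pdivlMr// /u -/k /ui; have [fz|fz] := ifPn.
    have := escape_free k; rewrite /u -/k.
    by move: (escape k) (escape _) (escape _) (p _) (p _) => U U1 U2 v w; lra.
  have := escape_killed (k := k) (ltac:(by rewrite subr_le0 fH)); rewrite mulr0.
  by move: (escape k) (escape _) (escape _) (p _) (p _) => U U1 U2 v w; lra.
have Bmean : \sum_i iprob i * Bi i = bd z - 1.
  rewrite big_option /=.
  have E e : p (vec e) / (1 + lambda) * bd (z + vec e) =
     (p (vec e) * ((fun k => (Hmax + 1 - k)%:~R : R) (height z + climb e))) / (a - b).
    by rewrite /bd heightD; field; rewrite !gt_eqF.
  under eq_bigr => e _ do rewrite E.
  rewrite -mulr_suml (sum_climb (fun k => (Hmax + 1 - k)%:~R)) /bd.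
  have -> : (Hmax + 1 - (height z + 1))%:~R = (Hmax + 1 - height z)%:~R - 1 :> R.
    by rewrite -[X in _ = _ - X]/(1%:~R) -rmorphB; congr (_%:~R); ring.
  have -> : (Hmax + 1 - (height z - 1))%:~R = (Hmax + 1 - height z)%:~R + 1 :> R.
    by rewrite -[X in _ = _ + X]/(1%:~R) -rmorphD; congr (_%:~R); ring.
  by field; rewrite !gt_eqF.
have zH' : height z <= Hmax by exact: sH.
(* [M.+1] is split into [M], for the induction, and 1, as each difference is at most 1; the extra 1
   is compensated by the mean decrease of [bd]. *)
have step i : M.+1%:R * (ui i - Wi i) <= Bi i + 1.
  rewrite -natr1 mulrDl mul1r; apply: lerD; rewrite /ui /Wi /Bi.
    case: i => [e|]; first by apply: IH; rewrite heightD lerD// climb_le1.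
    case: ifP => _; first exact: IH.
    by rewrite subrr mulr0 bd0.
  have w0 y : 0 <= walk M (fun=> 1) y by exact: walk_ge0.
  have uw y : u y - walk M (fun=> 1) y <= 1 by rewrite lerBlDr (le_trans (escape_le1 _))// lerDl.
  by case: i => [e|] //; case: ifP => _ //; rewrite subrr.
apply: (@le_trans _ _ (\sum_i iprob i * (M.+1%:R * (ui i - Wi i)))).
  have -> : \sum_i iprob i * (M.+1%:R * (ui i - Wi i)) = M.+1%:R * (\sum_i iprob i * ui i - \sum_i iprob i * Wi i).
    by rewrite -sumrB mulr_sumr; apply: eq_bigr => i _; rewrite mulrCA mulrBr.
  by rewrite ler_wpM2l// lerB.
apply: (@le_trans _ _ (\sum_i iprob i * (Bi i + 1))).
  by apply: ler_sum => i _; rewrite ler_wpM2l ?iprob_ge0.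
under eq_bigr => i _ do rewrite mulrDr mulr1.
by rewrite big_split /= Bmean (sum_iprob pJ lambda0) subrK.
Qed.

(* The mean number of visits to [x] of the walk started from [y], before time
   [M]. *)
Fixpoint green x M y : R :=
  (y == x)%:R + if M is M'.+1 then \sum_e p (vec e) * green x M' (y + vec e) else 0.

Lemma green_ge0 x M y : 0 <= green x M y.
Proof.
elim: M y => [|M IH] y /=; first by rewrite addr0.
by rewrite addr_ge0// sumr_ge0// => e _; rewrite mulr_ge0// (jump_ge0 pJ).
Qed.

Lemma green_le x M y : green x M y <= green x M.+1 y.
Proof.
elim: M y => [|M IH] y.
  by rewrite /= lerD2l sumr_ge0// => e _; rewrite mulr_ge0 ?(jump_ge0 pJ)// addr0.
by rewrite /= lerD2l; apply: ler_sum => e _; rewrite ler_wpM2l ?(jump_ge0 pJ).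
Qed.

(** The probability of stopping at [x] is at most the mean number of visits, and an instruction to
    sleep either kills the walk or leaves it in place, so it creates no new visit. *)
Lemma walk_upper x M z : walk M (fun y => (y == x)%:R) z <= green x M z.
Proof.
elim: M z => [|M IH] z /=; case: (stop z); rewrite ?addr0//.
  by rewrite lerDl sumr_ge0// => e _; rewrite mulr_ge0 ?green_ge0// (jump_ge0 pJ).
rewrite -/(green x M.+1 z); set G := green x M.+1 z.
have G0 : 0 <= G by exact: green_ge0.
apply: (@le_trans _ _ (iprob None * G + (1 + lambda)^-1 * G)); last first.
  by rewrite -mulrDl /= -[X in _ / _ + X]mul1r -mulrDl addrC divff ?mul1r// gt_eqF.
rewrite big_option; apply: lerD.
  rewrite ler_wpM2l ?iprob_ge0//; case: ifP => // _.
  by apply: le_trans (IH _) _; exact: green_le.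
apply: (@le_trans _ _ ((1 + lambda)^-1 * \sum_e p (vec e) * green x M (z + vec e))).
  rewrite mulr_sumr; apply: ler_sum => e _ /=.
  by rewrite mulrAC [leLHS]mulrC !ler_wpM2l ?invr_ge0 ?(jump_ge0 pJ)// ltW.
by rewrite ler_wpM2l ?invr_ge0 ?(ltW l1)// /G /= lerDr.
Qed.

End killed_walk.

(* The Green function summed over the starting points of a level depends only
   on the height of that level relative to [x]. *)
Definition level_bound (k : int) : R :=
  (a - b)^-1 * (if k is Posz n then (b / a) ^+ n else 1).

Lemma level_bound_ge0 k : 0 <= level_bound k.
Proof. by rewrite mulr_ge0 ?invr_ge0 ?(ltW dab)//; case: k => n; rewrite ?exprn_ge0. Qed.

Lemma level_bound_le k : level_bound k <= (a - b)^-1.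
Proof.
rewrite -[leRHS]mulr1 ler_wpM2l ?invr_ge0 ?(ltW dab)//; case: k => n //.
exact: exprn_ile1.
Qed.

(** Equality holds: constants and powers of [b / a] are harmonic for the height, and the factor
    [(a - b)^-1] produces the unit source at level 0. *)
Lemma level_bound_super k : (k == 0)%:R + (a * level_bound (k + 1) + b * level_bound (k - 1) +
  (1 - a - b) * level_bound k) <= level_bound k.
Proof.
rewrite le_eqVlt; apply/orP; left; apply/eqP; case: k => [[|n]|[|n]].
- have -> : 0%:Z - 1 = Negz 0 by [].
  have -> : 0%:Z + 1 = 1%:Z by [].
  by rewrite eqxx /level_bound /=; field; rewrite !gt_eqF.
- have -> : n.+1%:Z - 1 = n%:Z by lia.
  have -> : n.+1%:Z + 1 = n.+2%:Z by lia.
  by rewrite (_ : (n.+1%:Z == 0) = false)// /level_bound /= mulr0n !exprS; field; rewrite !gt_eqF.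
- have -> : Negz 0 - 1 = Negz 1 by [].
  have -> : Negz 0 + 1 = 0%:Z by [].
  by rewrite (_ : (Negz 0 == 0) = false)// /level_bound /= mulr0n expr0; field; rewrite !gt_eqF.
- rewrite NegzB1 NegzSD1.
  by rewrite (_ : (Negz n.+1 == 0) = false)// /level_bound /= mulr0n; field; rewrite !gt_eqF.
Qed.

Lemma green_level x M (Y : seq (site d)) k : uniq Y -> (forall y, y \in Y -> height y = k) ->
  \sum_(y <- Y) green x M y <= level_bound (k - height x).
Proof.
elim: M Y k => [|M IH] Y k uY Yk.
  have E : \sum_(y <- Y) (y == x)%:R <= (k - height x == 0)%:R :> R.
    have [xY|xY] := boolP (x \in Y).
      rewrite (bigD1_seq x)//= eqxx big1 ?addr0; last by move=> y /negbTE->.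
      by rewrite (Yk x xY) subrr.
    by rewrite big_seq big1// => y yY; case: eqP => // yx; rewrite -yx yY in xY.
  apply: (@le_trans _ _ (\sum_(y <- Y) (y == x)%:R)).
    by apply: ler_sum => y _ /=; rewrite addr0.
  apply: le_trans E _; apply: le_trans (level_bound_super _); rewrite lerDl.
  by rewrite !addr_ge0// mulr_ge0 ?level_bound_ge0// ?(ltW a0)//; have := jump_ab_le1; lra.
apply: le_trans (level_bound_super _).
rewrite /= big_split /=; apply: lerD.
  have [xY|xY] := boolP (x \in Y).
    rewrite (bigD1_seq x)//= eqxx big1 ?addr0; last by move=> y /negbTE->.
    by rewrite (Yk x xY) subrr.
  by rewrite big_seq big1// => y yY; case: eqP => // yx; rewrite -yx yY in xY.
rewrite -(sum_climb level_bound) exchange_big /=; apply: ler_sum => e _.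
rewrite -mulr_sumr ler_wpM2l ?(jump_ge0 pJ)//.
have := IH [seq y + vec e | y <- Y] (k + climb e); rewrite big_map addrAC; apply.
  by rewrite map_inj_uniq//; exact: addIr.
by move=> y /mapP[z zY ->]; rewrite heightD (Yk z zY).
Qed.

End walks.

(** * Moving the particles of a region one by one *)

Lemma sum_update (R : zmodType) (T : eqType) (s : seq T) (z : T) (G G' : T -> R) :
  uniq s -> z \in s -> (forall y, y \in s -> y != z -> G y = G' y) ->
  \sum_(y <- s) G y = \sum_(y <- s) G' y + (G z - G' z).
Proof.
move=> us zs E; rewrite (bigD1_seq z)//= [in RHS](bigD1_seq z)//= addrC addrAC.
rewrite [G' z + _]addrC subrK addrC; congr (_ + _).
by rewrite big_seq_cond [RHS]big_seq_cond; apply: eq_bigr => y /andP[]; exact: E.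
Qed.

Section stages.
Context {R : realType} (d : nat).
Variables (p : site d -> R) (lambda : R).
Hypotheses (pJ : jump_distribution p) (lambda0 : 0 < lambda).
Variables (up : dir d).
Local Notation down := (up.1, ~~ up.2).
Local Notation a := (p (vec up)).
Local Notation b := (p (vec down)).
Hypothesis ab : b < a.
Implicit Types (x y z : site d) (h : history d) (U : seq (site d)).
Local Notation iprob := (iprob p lambda).
Local Notation ach := (ach p lambda).
Local Notation height := (height up).
Local Notation escape0 := (escape0 p lambda up).

Variables (V Sh : seq (site d)).
Hypothesis Sh_uniq : uniq Sh.
Hypothesis Sh_V : forall z, z \in Sh -> z \notin V.
Hypothesis exit_Sh : forall z e, z \in V -> z + vec e \notin V -> z + vec e \in Sh.
Variable eta0 : config d.

Local Notation N h y := (act (run eta0 h) y).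

Definition awake U h := forall y, (y \in U) || (y \in Sh) -> run eta0 h y = Active (N h y).

Definition stop_site U (m : site d -> nat) z := (z \notin V) || ((z \in U) && (m z == 0%N)).

(* A particle is moved from [z] until it leaves [V] or meets an empty site of
   [U]; [m] counts the other particles at the sites of [U] and [Sh]. *)
Lemma ach_walk U (m : site d -> nat) (f : history d -> R) (psi : R) (D : site d -> R) :
  (forall z, z \in U -> z \in V) ->
  (forall h, legal eta0 h -> (forall y, (y \in U) || (y \in Sh) -> run eta0 h y = Active (m y)) ->
     psi <= f h) ->
  (forall h z, legal eta0 h -> ~~ stop_site U m z ->
     (forall y, (y \in U) || (y \in Sh) -> run eta0 h y = Active (m y + (y == z))) -> psi <= f h) ->
  (forall h z, legal eta0 h -> stop_site U m z -> (z \in U) || (z \in Sh) ->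
     (forall y, (y \in U) || (y \in Sh) -> run eta0 h y = Active (m y + (y == z))) ->
     psi + D z <= f h) ->
  forall M h z, legal eta0 h -> (z \in V) || (z \in Sh) ->
   (forall y, (y \in U) || (y \in Sh) -> run eta0 h y = Active (m y + (y == z))) ->
   (z \in V -> z \notin U -> 0 < N h z)%N ->
   ach eta0 f h (psi + walk p lambda (stop_site U m) (mem U) M D z).
Proof.
move=> UV f1 f2 f3; elim=> [|M IH] h z lh zVS cz az /=; case: ifPn => sz.
- apply: ach_stop; apply: (f3 h z) => //.
  move: sz zVS; rewrite /stop_site; case: (z \in V) => /=; last by move=> _ ->; rewrite orbT.
  by move=> /andP[-> _].
- by rewrite addr0; apply: ach_stop; apply: (f2 h z).
- apply: ach_stop; apply: (f3 h z) => //.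
  move: sz zVS; rewrite /stop_site; case: (z \in V) => /=; last by move=> _ ->; rewrite orbT.
  by move=> /andP[-> _].
have zV : z \in V by move: sz; rewrite /stop_site negb_or negbK => /andP[].
have zS : z \notin Sh by apply/negP => /Sh_V; rewrite zV.
pose W := walk p lambda (stop_site U m) (mem U) M D.
pose g (i : instr d) := psi + (if i is Some e then W (z + vec e) else if z \in U then W z else 0).
have Nz : (0 < N h z)%N.
  have [zU|zU] := boolP (z \in U); last exact: az.
  by rewrite /act cz ?zU//= eqxx addn1.
apply: (@ach_topple _ _ _ _ _ _ _ _ z g) => //; last first.
  rewrite [leRHS](eq_bigr (fun i => iprob i * psi + iprob i * (if i is Some e then W (z + vec e) else if z \in U then W z else 0))); last first.
    by move=> i _; rewrite /g mulrDr.
  by rewrite big_split /= -mulr_suml (sum_iprob pJ lambda0) mul1r.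
move=> [e|]; rewrite /g.
- apply: IH.
  + by rewrite legal_rcons lh.
  + by have [//|zeV] := boolP (z + vec e \in V); rewrite (exit_Sh zV zeV) orbT.
  + move=> y yUS; rewrite run_rcons /= /jump.
    have [yz|yz] := eqVneq y z.
      by rewrite yz in yUS *; rewrite cz// eqxx addn1 eq_sym addvec_neq addn0.
    have [E|yze] := eqVneq y (z + vec e); last by rewrite cz// (negbTE yz).
    by rewrite -E cz// (negbTE yz) addn0 addn1.
  + by move=> _ _; rewrite run_rcons; exact: act_target_gt0.
have [zU|zU] := boolP (z \in U).
  have mz : (0 < m z)%N by move: sz; rewrite /stop_site negb_or negbK zV zU /= lt0n.
  apply: IH; rewrite ?legal_rcons ?lh//; last by rewrite zU.
  move=> y yUS; rewrite run_rcons /= /sleep_at; have [->|yz] := eqVneq y z.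
    by rewrite cz ?zU// eqxx addn1; case: (m z) mz.
  by rewrite cz// (negbTE yz).
(* Told to sleep at a treated site, the particle is given up: it lies outside [U] and [Sh], where
   nothing is counted. *)
rewrite addr0; apply: ach_stop; apply: f1; first by rewrite legal_rcons lh.
move=> y yUS; rewrite run_rcons /= /sleep_at; have [E|yz] := eqVneq y z.
  by move: yUS; rewrite E (negbTE zU) (negbTE zS).
by rewrite cz// (negbTE yz) addn0.
Qed.

Variables (eps : R) (M : nat) (Hmax : int) (scale : R).
Hypotheses (eps0 : 0 < eps) (scale0 : 0 < scale).
Hypothesis V_le : forall z, z \in V -> height z <= Hmax.
Hypothesis M_large : forall z, z \in V ->
  (1 + lambda) / (a - b) * (Hmax + 1 - height z)%:~R <= M%:R * eps.
Hypothesis M0 : (0 < M)%N.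

(* [potential U] does not decrease on average when the first site of [U] is
   treated: treating a site succeeds with probability at least [1 - kappa], and
   [second_moment] bounds the square of [n] plus a sum of indicators of total
   mean [q].  Once all sites are treated, [2 y - y ^ 2], with [y] the number of
   particles over [scale], is at most 1. *)
Definition kappa : R := 1 - escape0 + eps.

Definition flow U x : R := \sum_(y <- U) green p x M y.

Definition second_moment (n q : R) : R := n ^+ 2 + 2 * n * q + q ^+ 2 + q.

Definition potential U h : R :=
  2 / scale * (\sum_(x <- Sh) (N h x)%:R + \sum_(y <- U) (minn (N h y) 1)%:R - kappa * (size U)%:R) -
  (scale ^+ 2)^-1 * \sum_(x <- Sh) second_moment (N h x)%:R (flow U x).

Let kappa0 : 0 <= kappa.
Proof. by have := escape0_lt1 pJ lambda0 ab; move: eps0; rewrite /kappa; lra. Qed.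

Lemma flow_ge0 U x : 0 <= flow U x.
Proof. by apply: sumr_ge0 => y _; exact: green_ge0. Qed.

(** The sites are treated by increasing height, so those already treated, where alone the walk can
    be killed, are never above the current one. The walk thus starts at level 0 relative to the
    killing region and succeeds with probability at least [escape0 - eps]. *)
Lemma ach_potential U h : legal eta0 h -> uniq U -> (forall z, z \in U -> z \in V) ->
  pairwise (fun x y => height x <= height y) U ->
  (forall z y, z \in V -> z \notin U -> y \in U -> height z <= height y) ->
  awake U h -> ach eta0 (potential [::]) h (potential U h).
Proof.
have s2 : 0 <= (scale ^+ 2)^-1 by rewrite invr_ge0 exprn_ge0// ltW.
have s1 : 0 <= 2 / scale by rewrite divr_ge0// ltW.
elim: U h => [|x U IH] h lh uU UV pU VU aw; first exact: ach_stop.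
move: uU pU => /= /andP[xU uU] /andP[/allP xle pU].
have UV' z : z \in U -> z \in V by move=> zU; apply: UV; rewrite in_cons zU orbT.
have xV : x \in V by apply: UV; rewrite mem_head.
have low z : z \in V -> z \notin U -> height z <= height x.
  move=> zV zU; have [->//|zx] := eqVneq z x.
  by apply: VU => //; [rewrite in_cons negb_or zx|rewrite mem_head].
have VU' z y : z \in V -> z \notin U -> y \in U -> height z <= height y.
  by move=> zV zU yU; apply: le_trans (low _ zV zU) (xle y yU).
have xS : x \notin Sh by apply/negP => /Sh_V; rewrite xV.
have aw' : awake U h by move=> y yUS; apply: aw; rewrite in_cons -orbA yUS orbT.
have flowS z : flow (x :: U) z = green p z M x + flow U z by rewrite /flow big_cons.
have [Nx|Nx] := posnP (N h x).
  (* There is nothing to move: dropping [x] saves the charge [kappa] and lowers the flow, so the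
     potential does not decrease. *)
  apply: ach_le (IH h lh uU UV' pU VU' aw') _.
  rewrite /potential big_cons Nx min0n add0r; apply: lerB.
    by apply: ler_wpM2l => //; rewrite lerD2l lerN2 ler_wpM2l// ler_nat.
  apply: ler_wpM2l => //; apply: ler_sum => z _; rewrite flowS /second_moment.
  have := green_ge0 pJ z M x; have := flow_ge0 U z; have : 0 <= (N h z)%:R :> R by [].
  by move: (N h z)%:R (flow U z) (green p z M x) => n q g n0 q0 g0; nra.
pose m y := N h y.
(* Where the configuration is not [awake] the objective is already the final one, so the induction
   hypothesis is needed only where it applies. *)
pose F h' := if `[< awake U h' >] then potential U h' else potential [::] h'.
(* The change of the potential when the particle stops at [z]; the sum is the increment of
   [second_moment] at a boundary site and vanishes when [z] lies in [U]. *)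
pose Dl (z : site d) := 2 / scale - \sum_(y <- Sh) ((2 * (m y)%:R + 1 + 2 * flow U y) / scale ^+ 2) * (z == y)%:R.
have sets h' (c : nat) z : (forall y, (y \in U) || (y \in Sh) -> run eta0 h' y = Active (m y + (y == z) * c)) ->
    awake U h' /\ (forall y, (y \in U) || (y \in Sh) -> N h' y = (m y + (y == z) * c)%N).
  by move=> E; split => y yUS; rewrite /act E.
have sumS (G G' : site d -> R) : (forall y, y \in Sh -> G y = G' y) -> \sum_(y <- Sh) G y = \sum_(y <- Sh) G' y.
  by move=> GG; rewrite !big_seq; apply: eq_bigr.
have sumU (G G' : site d -> R) : (forall y, y \in U -> G y = G' y) -> \sum_(y <- U) G y = \sum_(y <- U) G' y.
  by move=> GG; rewrite !big_seq; apply: eq_bigr.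
have A : ach eta0 F h (potential U h + walk p lambda (stop_site U m) (mem U) M Dl x).
  apply: ach_walk => //.
  - move=> h' lh' E; have [aw2 E2] := sets h' 0%N x (ltac:(by move=> y yUS; rewrite muln0 addn0; exact: E)).
    rewrite /F asboolT// /potential le_eqVlt; apply/orP; left; apply/eqP; congr (_ * (_ + _ - _) - _ * _).
    + by apply: sumS => y yS; rewrite E2 ?yS ?orbT// muln0 addn0.
    + by apply: sumU => y yU; rewrite E2 ?yU// muln0 addn0.
    + by apply: sumS => y yS; rewrite E2 ?yS ?orbT// muln0 addn0.
  - move=> h' z lh' sz E; have [aw2 E2] := sets h' 1%N z (ltac:(by move=> y yUS; rewrite muln1; exact: E)).
    have zV : z \in V by move: sz; rewrite /stop_site negb_or negbK => /andP[].
    have yz y : y \in Sh -> (y == z) = false.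
      by move=> yS; apply/negP => /eqP yz; move: (Sh_V yS); rewrite yz zV.
    rewrite /F asboolT// /potential le_eqVlt; apply/orP; left; apply/eqP; congr (_ * (_ + _ - _) - _ * _).
    + by apply: sumS => y yS; rewrite E2 ?yS ?orbT// yz// addn0.
    + apply: sumU => y yU; rewrite E2 ?yU// muln1; case: eqP => [yz'|_]; last by rewrite addn0.
      have mz : (0 < m y)%N by move: sz; rewrite /stop_site negb_or negbK zV -yz' yU /= lt0n.
      by move: mz; rewrite /m; case: (N h y) => // n _; rewrite !minnSS !minn0.
    + by apply: sumS => y yS; rewrite E2 ?yS ?orbT// yz// addn0.
  - move=> h' z lh' sz zUS E; have [aw2 E2] := sets h' 1%N z (ltac:(by move=> y yUS; rewrite muln1; exact: E)).
    rewrite /F asboolT//.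
    have [zU|zU] := boolP (z \in U).
      have zV := UV' z zU.
      have yz y : y \in Sh -> (y == z) = false.
        by move=> yS; apply/negP => /eqP yz; move: (Sh_V yS); rewrite yz zV.
      have mz : m z = 0%N by move: sz; rewrite /stop_site zV zU /= => /eqP.
      have -> : Dl z = 2 / scale.
        rewrite /Dl big_seq big1 ?subr0// => y yS.
        by rewrite eq_sym yz// mulr0.
      rewrite /potential.
      rewrite (sumS (fun y => (N h' y)%:R) (fun y => (N h y)%:R)); last first.
        by move=> y yS; rewrite E2 ?yS ?orbT// yz// addn0.
      rewrite (sumS (fun y => second_moment (N h' y)%:R (flow U y)) (fun y => second_moment (N h y)%:R (flow U y))); last first.
        by move=> y yS; rewrite E2 ?yS ?orbT// yz// addn0.
      have -> : \sum_(y <- U) (minn (N h' y) 1)%:R = \sum_(y <- U) (minn (N h y) 1)%:R + 1 :> R.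
        rewrite (sum_update (z := z) (G' := fun y => (minn (N h y) 1)%:R))//.
          by rewrite E2 ?zU// -[N h z]/(m z) mz eqxx min0n subr0.
        by move=> y yU /negbTE yz'; rewrite E2 ?yU// yz' addn0.
      by rewrite le_eqVlt; apply/orP; left; apply/eqP; ring.
    have zS : z \in Sh by move: zUS; rewrite (negbTE zU).
    have yz y : y \in U -> (y == z) = false.
      by move=> yU; apply/negP => /eqP yz; rewrite -yz yU in zU.
    have -> : Dl z = 2 / scale - (2 * (m z)%:R + 1 + 2 * flow U z) / scale ^+ 2.
      rewrite /Dl (bigD1_seq z)//= eqxx mulr1 big1 ?addr0// => y /negbTE; rewrite eq_sym => ->.
      by rewrite mulr0.
    rewrite /potential (sumU (fun y => (minn (N h' y) 1)%:R) (fun y => (minn (N h y) 1)%:R)); last first.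
      by move=> y yU; rewrite E2 ?yU// yz// addn0.
    have -> : \sum_(y <- Sh) (N h' y)%:R = \sum_(y <- Sh) (N h y)%:R + 1 :> R.
      rewrite (sum_update (z := z) (G' := fun y => (N h y)%:R))//.
        by rewrite E2 ?zS ?orbT// eqxx muln1 natrD -/(m z) addrAC subrr add0r.
      by move=> y yS /negbTE yz'; rewrite E2 ?yS ?orbT// yz' addn0.
    have -> : \sum_(y <- Sh) second_moment (N h' y)%:R (flow U y) =
       \sum_(y <- Sh) second_moment (N h y)%:R (flow U y) + (2 * (m z)%:R + 1 + 2 * flow U z).
      rewrite (sum_update (z := z) (G' := fun y => second_moment (N h y)%:R (flow U y)))//.
        rewrite E2 ?zS ?orbT// eqxx muln1 natrD /second_moment /m; congr (_ + _); move: (N h z) (flow U z) (erefl : true%:R = 1 :> R) => n q ->; ring.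
      by move=> y yS /negbTE yz'; rewrite E2 ?yS ?orbT// yz' addn0.
    by rewrite le_eqVlt; apply/orP; left; apply/eqP; ring.
  - by rewrite xV.
  - move=> y yUS; have -> : (y == x) = false.
      by apply/negP => /eqP yx; move: yUS; rewrite yx (negbTE xU) (negbTE xS).
    by rewrite addn0; exact: aw'.
apply: ach_le (ach_comp lh A _) _.
  move=> h' lh'; rewrite /F; case: asboolP => [aw2|_]; last exact: ach_stop.
  exact: IH.
pose st := stop_site U m.
have DlE : Dl = fun z => 2 / scale * 1 + (-1) * \sum_(y <- Sh) ((2 * (m y)%:R + 1 + 2 * flow U y) / scale ^+ 2) * (z == y)%:R.
  by apply/funext => z; rewrite /Dl mulr1 mulN1r.
(* [walk_lower] with [H] the height of [x], where [escape] takes the value [escape0]; [M_large]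
   turns its error into [eps]. *)
have W_ge : escape0 - eps <= walk p lambda st (mem U) M (fun=> 1) x.
  have sV z : ~~ st z -> z \in V by rewrite /st /stop_site negb_or negbK => /andP[].
  have := @walk_lower _ _ p lambda pJ lambda0 up ab st (mem U) (height x) Hmax _ _ M x _.
  rewrite subrr /= expr0 mulr1 subKr => /(_ (fun z sz => V_le (sV z sz))).
  move=> /(_ (fun z sz fz => low z (sV z sz) fz)) H.
  have xH : height x <= Hmax + 1 by rewrite (le_trans (V_le xV))// lerDl.
  have := le_trans (H xH) (M_large xV); rewrite ler_pM2l ?ltr0n// => ?.
  by rewrite lerBlDr -lerBlDl.
rewrite DlE walk_linear walk_sum -/st.
have G_ge : \sum_(y <- Sh) (2 * (m y)%:R + 1 + 2 * flow U y) / scale ^+ 2 * walk p lambda st (mem U) M (fun z => (z == y)%:R) x <=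
   (scale ^+ 2)^-1 * \sum_(y <- Sh) (2 * (m y)%:R + 1 + 2 * flow U y) * green p y M x.
  rewrite mulr_sumr; apply: ler_sum => y _; rewrite mulrAC [leRHS]mulrC; apply: ler_wpM2r => //.
  apply: ler_wpM2l; last exact: walk_upper.
  by rewrite !addr_ge0 ?mulr_ge0 ?flow_ge0.
have H1 : 2 / scale * (escape0 - eps) <= 2 / scale * walk p lambda st (mem U) M (fun=> 1) x.
  exact: ler_wpM2l.
apply: (@le_trans _ _ (potential U h + 2 / scale * (escape0 - eps) -
   (scale ^+ 2)^-1 * \sum_(y <- Sh) (2 * (m y)%:R + 1 + 2 * flow U y) * green p y M x)); last first.
  by rewrite mulN1r addrA; apply: lerB => //; rewrite lerD2l.
rewrite /potential big_cons (_ : minn (N h x) 1 = 1%N); last by apply/minn_idPr.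
(* Raising the flow by [g] increases [second_moment] by at least [g] times the increment due to one
   arrival: the flow removed with [x] pays for the arrivals. *)
have H2 : \sum_(y <- Sh) second_moment (N h y)%:R (flow U y) + \sum_(y <- Sh) (2 * (m y)%:R + 1 + 2 * flow U y) * green p y M x <=
    \sum_(y <- Sh) second_moment (N h y)%:R (flow (x :: U) y).
  rewrite -big_split /=; apply: ler_sum => y _; rewrite flowS /second_moment /m.
  have := green_ge0 pJ y M x.
  by move: (N h y)%:R (flow U y) (green p y M x) => n q g g0; nra.
have := ler_wpM2l s2 H2.
rewrite mulrDr [X in 2 / scale * X](_ : _ = (\sum_(x0 <- Sh) (N h x0)%:R + \sum_(y <- U) (minn (N h y) 1)%:R - kappa * (size U)%:R) + (escape0 - eps)).
  by rewrite [2 / scale * (_ + (escape0 - eps))]mulrDr; lra.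
by rewrite /kappa -[(size (x :: U))%:R]natr1; ring.
Qed.

End stages.

(** * Piles at the boundary of a box *)

Lemma int_gap (n : nat) (k : int) : - n%:Z <= k -> n%:Z + 1 - k <= (2 * n.+1)%:Z.
Proof. lia. Qed.

(** * Periodic layers of particles *)

Section periodic.
Variables (d : nat) (up : dir d) (L q : nat).
Hypothesis qL : (q <= L.+1)%N.
Implicit Types (x y z : site d).
Local Notation height := (height up).

(** Of every [L.+1] consecutive levels, [q] are full. The phases [j] are the translates of one
    another, and the density is rational. *)
Definition occupied (j : nat) x : nat := nat_of_bool (modz (height x + j%:Z) L.+1%:Z < q%:Z).

Lemma occupied_le1 j x : (occupied j x <= 1)%N.
Proof. by rewrite /occupied; case: (_ < _). Qed.

Lemma occupied_add x : exists k : 'I_L.+1, forall (j : 'I_L.+1) y,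
  occupied (k + j)%R y = occupied j (x + y).
Proof.
exists (inord (absz ((height x) %% L.+1%:Z)%Z)) => j y; set k := inord _.
have kE : (height x = k%:Z %[mod L.+1%:Z])%Z.
  rewrite /k inordK; last by have := ltz_pmod (height x) (ltac:(by []) : 0 < L.+1%:Z); have := modz_ge0 (height x) (ltac:(by []) : L.+1%:Z != 0); lia.
  by rewrite gez0_abs ?modz_ge0// modz_mod.
rewrite /occupied; congr (nat_of_bool (_ < _)).
have -> : ((k + j)%R : nat)%:Z = ((k%:Z + j%:Z) %% L.+1%:Z)%Z by rewrite -PoszD modz_nat.
have -> : height (x + y) = height x + height y.
  by rewrite /height; case: up.2; rewrite !mxE ?opprD.
rewrite modzDmr addrCA -addrA -[RHS]modzDml kE modzDml.
by congr modz; rewrite addrCA [j%:Z + _]addrC.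
Qed.

Lemma sum_occupied x : (\sum_(j < L.+1) occupied j x = q)%N.
Proof.
have [k kE] := occupied_add x.
rewrite (eq_bigr (fun j : 'I_L.+1 => occupied (k + j)%R 0)); last by move=> j _; rewrite kE addr0.
transitivity (\sum_(j < L.+1) occupied j 0)%N; first by rewrite [RHS](reindex_inj (addrI k)).
rewrite -[RHS]card_ord -sum1_card (big_ord_widen _ (fun=> 1%N) qL).
rewrite [RHS]big_mkcond /=; apply: eq_bigr => j _; rewrite /occupied.
have -> : height 0 = 0 by rewrite /height; case: up.2; rewrite mxE ?oppr0.
by rewrite add0r modz_nat ltz_nat modn_small//; case: ltnP.
Qed.

Lemma occupied_shift j w : (j < L.+1)%N ->
  exists2 j', (j' < L.+1)%N & forall x, occupied j (x - w) = occupied j' x.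
Proof.
move=> jL; have [k kE] := occupied_add (- w).
by exists (k + Ordinal jL)%R => // x; rewrite kE addrC.
Qed.

(** Averaged over the phases, every site is occupied with frequency [q / L.+1], so some phase
    reaches the average in a region of any shape. *)
Lemma occupied_average (s : seq (site d)) : exists2 j, (j < L.+1)%N &
  (size s * q <= L.+1 * \sum_(x <- s) occupied j x)%N.
Proof.
have [j jP] : exists j : 'I_L.+1, (size s * q <= L.+1 * \sum_(x <- s) occupied j x)%N.
  apply/existsP; rewrite -[X in is_true X]negbK negb_exists; apply/negP => /forallP H.
  have S : (\sum_(j < L.+1) L.+1 * \sum_(x <- s) occupied j x = L.+1 * (size s * q))%N.
    rewrite -big_distrr /= exchange_big /=; congr (_ * _)%N.
    by under eq_bigr => x _ do rewrite sum_occupied; rewrite big_const_seq count_predT iter_addn_0 mulnC.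
  have : (\sum_(j < L.+1) (L.+1 * \sum_(x <- s) occupied j x).+1 <= \sum_(j < L.+1) size s * q)%N.
    by apply: leq_sum => j _; have := H j; rewrite -ltnNge.
  rewrite sum_nat_const card_ord (eq_bigr (fun j : 'I_L.+1 => (L.+1 * \sum_(x <- s) occupied j x) + 1)%N); last by move=> j _; rewrite addn1.
  by rewrite big_split /= S sum_nat_const card_ord muln1; lia.
by exists j.
Qed.

End periodic.

(** * Boxes and the outflow through their boundary *)

Section box.
Context {R : realType} (d : nat).
Variables (p : site d -> R) (lambda : R).
Hypotheses (pJ : jump_distribution p) (lambda0 : 0 < lambda).
Variables (up : dir d).
Local Notation down := (up.1, ~~ up.2).
Local Notation a := (p (vec up)).
Local Notation b := (p (vec down)).
Hypothesis ab : b < a.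
Implicit Types (x y z : site d) (h : history d).
Local Notation ach := (ach p lambda).
Local Notation height := (height up).
Local Notation escape0 := (escape0 p lambda up).
Local Notation OM := (measurableTypeR R).
Local Notation P := (@unif R).

Definition point n (f : {ffun 'I_d -> 'I_n}) : site d := \row_i (f i)%:Z.

Lemma point_inj n : injective (@point n).
Proof.
move=> f g /rowP E; apply/ffunP => i; have := E i; rewrite !mxE => -[].
exact: ord_inj.
Qed.

Definition box n : seq (site d) :=
  sort (fun x y => height x <= height y) [seq point f | f <- enum {: {ffun 'I_d -> 'I_n}}].

Lemma box_uniq n : uniq (box n).
Proof. by rewrite sort_uniq map_inj_uniq ?enum_uniq//; exact: point_inj. Qed.

Lemma mem_box n z : (z \in box n) = [forall i, (0 <= z 0 i) && (z 0 i < n%:Z)].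
Proof.
rewrite mem_sort; apply/mapP/forallP => [[f _ -> i]|H].
  by rewrite mxE /= ltz_nat ltn_ord.
have lt i : (absz (z 0%R i) < n)%N by have := H i; case: (z 0 i) => m // /andP[].
exists [ffun i => Ordinal (lt i)]; rewrite ?mem_enum//; apply/rowP => i.
by rewrite mxE ffunE /=; have := H i => /andP[+ _]; case: (z 0 i).
Qed.

Lemma sum_box n (F : site d -> R) : \sum_(z <- box n) F z = \sum_(f : {ffun 'I_d -> 'I_n}) F (point f).
Proof.
rewrite (perm_big [seq point f | f <- enum {: {ffun 'I_d -> 'I_n}}]) ?big_map ?big_enum//.
by rewrite perm_sort.
Qed.

Lemma size_box n : size (box n) = (n ^ d)%N.
Proof. by rewrite size_sort size_map -cardE card_ffun !card_ord. Qed.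

Lemma box_pairwise n : pairwise (fun x y => height x <= height y) (box n).
Proof.
rewrite -sorted_pairwise; last by move=> y x z; exact: le_trans.
by apply: sort_sorted => x y; exact: le_total.
Qed.

Lemma box_height n z : z \in box n -> `|height z| <= n%:Z.
Proof.
rewrite mem_box => /forallP/(_ up.1) /andP[z0 zn]; rewrite /height.
by case: up.2; rewrite ?normrN ger0_norm// ltW.
Qed.

Definition face n (e : dir d) := [set f : {ffun 'I_d -> 'I_n} | point f + vec e \notin box n]%SET.

Definition shell n : seq (site d) :=
  undup [seq point f + vec e | e <- enum {: dir d}, f <- enum (face n e)].

Lemma shell_uniq n : uniq (shell n). Proof. exact: undup_uniq. Qed.

Lemma mem_shell n z : z \in shell n -> z \notin box n.
Proof. by rewrite mem_undup => /allpairsPdep[e [f [_ + ->]]]; rewrite mem_enum inE. Qed.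

Lemma shell_exit n z e : z \in box n -> z + vec e \notin box n -> z + vec e \in shell n.
Proof.
rewrite mem_sort => /mapP[f _ ->] fe; rewrite mem_undup; apply/allpairsPdep.
by exists e, f; split; rewrite ?mem_enum ?inE.
Qed.

(** On a face the coordinate along [e] is forced; letting it vary freely embeds the product of the
    face and an edge into the cube. *)
Lemma card_face n e : (#|face n e| * n <= n ^ d)%N.
Proof.
case: n => [|n]; first by rewrite muln0.
pose t0 : 'I_n.+1 := if e.2 then ord_max else ord0.
have fE f : f \in face n.+1 e -> f e.1 = t0.
  rewrite inE mem_box negb_forall => /existsP[i].
  have [ie|ie] := eqVneq i e.1; last first.
    rewrite (_ : (point f + vec e) 0 i = (f i)%:Z) ?ltz_nat ?ltn_ord//.
    by rewrite /vec; case: e.2; rewrite !mxE (negbTE ie) andbF ?subr0 ?addr0.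
  rewrite ie /vec /t0; have := ltn_ord (f e.1); case: e.2; rewrite !mxE !eqxx /= => fn H.
    by apply: ord_inj => /=; lia.
  by apply: ord_inj => /=; lia.
pose G (ft : {ffun 'I_d -> 'I_n.+1} * 'I_n.+1) := [ffun j => if j == e.1 then ft.2 else ft.1 j].
have Ginj : {in [predX face n.+1 e & 'I_n.+1] &, injective G}.
  move=> [f t] [g s] /andP[/= ff _] /andP[/= gg _] E.
  have {}E j : (if j == e.1 then t else f j) = (if j == e.1 then s else g j).
    by have := congr1 (fun u : {ffun _} => u j) E; rewrite !ffunE.
  have ts : t = s by have := E e.1; rewrite eqxx.
  rewrite ts; congr (_, _); apply/ffunP => j; have := E j; case: eqP => [->|//] _.
  by rewrite (fE f)// (fE g).
have -> : (#|face n.+1 e| * n.+1)%N = #|[predX face n.+1 e & 'I_n.+1]|.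
  by rewrite cardX card_ord.
rewrite -(card_in_image Ginj) (leq_trans (max_card _))//.
by rewrite card_ffun !card_ord.
Qed.

Lemma size_shell n : (size (shell n) * n <= d * 2 * n ^ d)%N.
Proof.
apply: (@leq_trans ((\sum_(e : dir d) #|face n e|) * n)%N).
  rewrite leq_mul2r; apply/orP; right; apply: leq_trans (size_undup _) _.
  rewrite size_allpairs_dep sumnE big_map big_enum /=.
  by apply: leq_sum => e _; rewrite -cardE.
rewrite big_distrl /=; apply: (@leq_trans (\sum_(e : dir d) n ^ d)%N).
  by apply: leq_sum => e _; exact: card_face.
by rewrite sum_nat_const card_prod card_ord card_bool.
Qed.

Let dab : 0 < a - b. Proof. by rewrite subr_gt0. Qed.

(** The box has [n] levels, and by [green_level] each sends a mean of at most [(a - b)^-1] visits to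
    [x], whatever its size: this gain over the volume comes from the drift. *)
Lemma flow_box n M x : flow p M (box n) x <= (a - b)^-1 * n%:R.
Proof.
rewrite /flow sum_box (partition_big (fun f : {ffun 'I_d -> 'I_n} => f up.1) xpredT)//=.
apply: (@le_trans _ _ (\sum_(t < n) (a - b)^-1)); last first.
  by rewrite sumr_const card_ord mulr_natr.
apply: ler_sum => t _.
have := @green_level _ _ p lambda pJ lambda0 up ab x M [seq point f | f <- enum [pred f : {ffun 'I_d -> 'I_n} | f up.1 == t]]
  (if up.2 then t%:Z else - t%:Z).
rewrite big_map big_enum /= => H; apply: le_trans (H _ _) (level_bound_le pJ ab _).
  by rewrite map_inj_uniq ?enum_uniq//; exact: point_inj.
move=> y /mapP[f]; rewrite mem_enum inE => /eqP ft ->.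
by rewrite /height; case: up.2; rewrite mxE ft.
Qed.

Lemma ach_const eta0 (f f' : history d -> R) h v C : ach eta0 f h v ->
  (forall g, f g <= f' g + C) -> ach eta0 f' h (v - C).
Proof.
move=> A ff'; elim: A => {h v} [h v vf|h v x g ax _ IH vg].
  by apply: ach_stop; rewrite lerBlDr (le_trans vf).
apply: (ach_topple ax IH); under eq_bigr => i _ do rewrite mulrBr.
by rewrite sumrB -mulr_suml (sum_iprob pJ lambda0) mul1r lerB.
Qed.

(** With [y] the number of particles over [scale], the term [2 y - y ^ 2] is at most 1, and at most
    [2 * K / scale] at a site without a pile. *)
Lemma potential_nil Sh eta0 eps M scale K h : 0 < scale ->
  potential p lambda up Sh eta0 eps M scale [::] h <=
  \sum_(x <- Sh) ((K < act (run eta0 h) x)%N)%:R + (size Sh)%:R * (2 * K%:R / scale).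
Proof.
move=> s0; rewrite /potential big_nil mulr0 subr0 addr0.
rewrite !mulr_sumr.
rewrite [X in _ <= _ + X](_ : _ = \sum_(x <- Sh) 2 * K%:R / scale); last first.
  by rewrite big_const_seq count_predT iter_addr_0 -[RHS]mulr_natl.
rewrite -sumrB -big_split /=; apply: ler_sum => x _.
rewrite /flow big_nil /second_moment; set N := act _ _.
set n := N%:R; have n0 : 0 <= n by rewrite /n.
have -> : 2 / scale * n - (scale ^+ 2)^-1 * (n ^+ 2 + 2 * n * 0 + 0 ^+ 2 + 0) = 2 * (n / scale) - (n / scale) ^+ 2.
  by field; rewrite gt_eqF.
have [KN|NK] := ltnP K N.
  have : 0 <= 2 * K%:R / scale by rewrite divr_ge0// ltW.
  have : 0 <= (1 - n / scale) ^+ 2 by rewrite sqr_ge0.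
  by move: (n / scale) (2 * _ / scale) => u v; rewrite sqrrB expr1n mul1r /=; lra.
have : n / scale <= K%:R / scale by rewrite ler_pM2r ?invr_gt0// ler_nat.
have : 0 <= (n / scale) ^+ 2 by rewrite sqr_ge0.
by rewrite -mulrA add0r; move: (n / scale) (K%:R / scale) => u v; lra.
Qed.

(** A second-moment argument summed over the boundary. The mean is split among the boundary sites by
    [ach_sum], which yields one deterministic site for the pile; the constant [v] is fixed before
    [K]. *)
Lemma ach_pile L q : (q <= L.+1)%N -> 1 - escape0 < q%:R / L.+1%:R -> exists2 v : R, 0 < v & forall K : nat,
  exists (V : seq (site d)) (j : nat) (x : site d), (j < L.+1)%N /\
  ach (fun z => Active (if z \in V then occupied up L q j z else 0%N))
    (fun h => ((K < act (run (fun z => Active (if z \in V then occupied up L q j z else 0%N)) h) x)%N)%:R) [::] v.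
Proof.
move=> qL; set zeta := q%:R / L.+1%:R => zc.
(* Half of the gap is spent on abandoned walks; the other half, [del], is the net outflow per site
   of the box. *)
pose eps := (zeta - (1 - escape0)) / 2; have e0 : 0 < eps by rewrite divr_gt0// subr_gt0.
pose del := eps; have del0 : 0 < del by [].
pose C := (a - b)^-1; have C1 : 1 <= C.
  by rewrite invf_ge1//; have := jump_ab_le1 pJ up; have := jump_ge0 pJ (vec down); lra.
pose sg : R := (d * 2)%:R.
have sg0 : 0 < sg by rewrite ltr0n; case: (d) up => [[[]]|].
(* Chosen so that the second-moment term is at most half of the first-moment term. *)
pose rho := 2 * C ^+ 2 * sg / del.
have C0 : 0 < C by lra.
have rho0 : 0 < rho by rewrite divr_gt0// !mulr_gt0// exprn_gt0.
exists (del / (4 * rho * sg)); first by rewrite divr_gt0// mulr_gt0// mulr_gt0.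
move=> K.
(* The mean number of exits per boundary site is at least of order [n]; for such [n] a height [K] is
   negligible on that scale. *)
pose n := (Num.truncn (4 * K%:R * sg / del)).+1.
have n0 : 0 < n%:R :> R by [].
have nK : 4 * K%:R * sg <= del * n%:R.
  by rewrite -ler_pdivrMl// mulrC ltW// truncnS_gt.
pose scale := rho * n%:R; have s0 : 0 < scale by rewrite mulr_gt0.
have [j jL jP] := occupied_average up qL (box n).
set eta0 : config d := fun z => Active (if z \in box n then occupied up L q j z else 0%N).
pose M := (Num.truncn ((1 + lambda) / (a - b) * (2 * n.+1)%:R / eps)).+1.
have l1 := lambda1_gt0 lambda0.
have V_le z : z \in box n -> height z <= n%:Z.
  by move=> /box_height; apply: le_trans; exact: ler_norm.
have M_large z : z \in box n ->
    (1 + lambda) / (a - b) * (n%:Z + 1 - height z)%:~R <= M%:R * eps.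
  move=> zV; apply: (@le_trans _ _ ((1 + lambda) / (a - b) * (2 * n.+1)%:R)).
    apply: ler_wpM2l; first by rewrite divr_ge0// ltW.
    rewrite -[X in _ <= X]/((2 * n.+1)%:~R) ler_int.
    by apply: int_gap; have := box_height zV; rewrite ler_norml => /andP[].
  by rewrite -ler_pdivrMr// ltW// truncnS_gt.
have aw : awake (shell n) eta0 (box n) [::] by [].
have A := @ach_potential _ _ p lambda pJ lambda0 up ab (box n) (shell n) (shell_uniq n)
  (@mem_shell n) (@shell_exit n) eta0 eps M n%:Z scale e0 s0 V_le M_large isT (box n) [::] isT
  (box_uniq n) (fun z zV => zV) (box_pairwise n) (fun z y zV zU => False_ind _ (negP zU zV)) aw.
have {}A := ach_const A (fun g => potential_nil _ _ _ _ K g s0).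
have [c cS cA] := ach_sum pJ lambda0 A.
exists (box n), j.
(* If every boundary site stayed below this value, the sum of the [c x] would be too small for the
   initial potential. *)
suff [x xS cx] : exists2 x, x \in shell n & del / (4 * rho * sg) <= c x.
  by exists x; split => //; exact: ach_le (cA x) cx.
apply/not_exists2P => H.
have cle x : x \in shell n -> c x <= del / (4 * rho * sg).
  by move=> xS; have [//|/negP] := H x; rewrite -ltNge => /ltW.
set S := (size (shell n))%:R : R in cS.
have {}H : \sum_(t <- shell n) c t <= S * (del / (4 * rho * sg)).
  rewrite big_seq; apply: (@le_trans _ _ (\sum_(t <- shell n | t \in shell n) del / (4 * rho * sg))).
    by apply: ler_sum => t; exact: cle.
  by rewrite -big_seq big_const_seq count_predT iter_addr_0 -[leLHS]mulr_natl.
have := le_trans cS H.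
have Snd : S * n%:R <= sg * n%:R ^+ d.
  by rewrite /S /sg -natrX -!natrM ler_nat; exact: size_shell.
have S0 : 0 <= S by rewrite /S.
have nd0 : 0 < n%:R ^+ d :> R by rewrite exprn_gt0.
set pot := potential _ _ _ _ _ _ _ _ _ _.
suff : (2 / scale) * (del * n%:R ^+ d) - (scale ^+ 2)^-1 * (S * (2 * C ^+ 2 * n%:R ^+ 2)) <= pot.
  set nd := n%:R ^+ d in Snd nd0 *; rewrite /scale => Hp Hq.
  have := le_trans (lerB Hp (lexx (S * (2 * K%:R / (rho * n%:R))))) Hq.
  have r1 : rho * del = 2 * C ^+ 2 * sg by rewrite mulfVK// gt_eqF.
  clear -rho0 n0 r1 sg0 del0 nK Snd nd0 S0 C0; clearbody rho sg del nd S C.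
  pose A' := nd / (rho * n%:R); pose B' := S / (rho * sg).
  have A0 : 0 < A' by rewrite divr_gt0// mulr_gt0.
  have B0 : 0 <= B' by rewrite divr_ge0// ltW// mulr_gt0.
  have BA : B' <= A'.
    have -> : B' = (S * n%:R) / (rho * sg * n%:R).
      by rewrite /B'; move: (n%:R) n0 => n' n0; field; rewrite !gt_eqF.
    have -> : A' = (sg * nd) / (rho * sg * n%:R).
      by rewrite /A'; move: (n%:R) n0 => n' n0; field; rewrite !gt_eqF.
    by rewrite ler_pM2r// invr_gt0 mulr_gt0// mulr_gt0.
  have -> : 2 / (rho * n%:R) * (del * nd) = 2 * (del * A').
    by rewrite /A'; move: (n%:R) n0 => n' n0; field; rewrite !gt_eqF.
  have -> : ((rho * n%:R) ^+ 2)^-1 * (S * (2 * C ^+ 2 * n%:R ^+ 2)) = del * B'.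
    have -> : del = 2 * C ^+ 2 * sg / rho by rewrite -r1 [rho * del]mulrC mulfK// gt_eqF.
    by rewrite /B'; move: (n%:R) n0 => n' n0; field; rewrite !gt_eqF.
  have -> : S * (del / (4 * rho * sg)) = del * B' / 4.
    by rewrite /B'; field; rewrite !gt_eqF.
  have : S * (2 * K%:R / (rho * n%:R)) <= del * B' / 2.
    have -> : S * (2 * K%:R / (rho * n%:R)) = B' / 2 * (4 * K%:R * sg / n%:R).
      by rewrite /B'; move: (n%:R) n0 => n' n0; field; rewrite !gt_eqF.
    have -> : del * B' / 2 = B' / 2 * del by ring.
    by apply: ler_wpM2l; [rewrite divr_ge0|rewrite ler_pdivrMr].
  have := mulr_gt0 del0 A0; have : del * B' <= del * A' by rewrite ler_pM2l.
  by move: (del * A') (del * B') (S * _) => X Y Z; lra.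
have actE y : act (run eta0 [::]) y = if y \in box n then occupied up L q j y else 0%N by [].
rewrite /pot /potential; apply: lerB; last first.
  apply: ler_wpM2l; first by rewrite invr_ge0 exprn_ge0// ltW.
  apply: (@le_trans _ _ (\sum_(x <- shell n) 2 * C ^+ 2 * n%:R ^+ 2)); last first.
    by rewrite big_const_seq count_predT iter_addr_0 -[leLHS]mulr_natl.
  rewrite big_seq [leRHS]big_seq; apply: ler_sum => x xS.
  rewrite actE (negbTE (mem_shell xS)) /second_moment.
  have := flow_box n M x; have := flow_ge0 pJ M (box n) x; rewrite -/C.
  have n1 : 1 <= n%:R :> R by rewrite ler1n.
  have : 1 <= C * n%:R by rewrite mulr_ege1.
  have -> : 2 * C ^+ 2 * n%:R ^+ 2 = 2 * (C * n%:R) ^+ 2 by ring.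
  by move: (C * _) (flow _ _ _ _) => X f; nra.
apply: ler_wpM2l; first by rewrite divr_ge0// ltW.
rewrite [X in _ <= X + _ - _]big_seq big1 ?add0r; last first.
  by move=> x xS; rewrite actE (negbTE (mem_shell xS)).
have -> : \sum_(y <- box n) (minn (act (run eta0 [::]) y) 1)%:R = (\sum_(y <- box n) occupied up L q j y)%:R :> R.
  rewrite natr_sum big_seq [RHS]big_seq; apply: eq_bigr => y yB.
  by rewrite actE yB (minn_idPl (occupied_le1 up L q j y)).
rewrite size_box natrX.
have : zeta * n%:R ^+ d <= (\sum_(y <- box n) occupied up L q j y)%:R.
  rewrite /zeta mulrAC ler_pdivrMr ?ltr0n// -natrX -!natrM ler_nat.
  by rewrite mulnC -size_box [leqRHS]mulnC.
have -> : kappa p lambda up eps = zeta - del.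
  by rewrite /kappa /del /eps; field.
by rewrite mulrBl; move: (zeta * _) (del * _) => X Y; lra.
Qed.

End box.

(** * Periodic initial conditions *)

Section periodic_law.
Context {R : realType} (d : nat).
Variables (up : dir d) (L q : nat).
Hypothesis qL : (q <= L.+1)%N.
Implicit Types (x y : site d).
Local Notation height := (height up).
Local Notation occ := (occupied up L q).

Definition periodic_config (j : nat) : config d := fun x => Active (occ j x).

Definition periodic_law : probability (configM d) R := @mixture R d L periodic_config.

(** Translations permute the phases transitively: the uniform mixture is invariant, and an invariant
    event contains all the phases or none. *)
Lemma periodic_ergodic : translation_ergodic periodic_law.
Proof.
split=> [x A mA|A mA tA].
  rewrite [LHS](mixtureE L periodic_config) [RHS](mixtureE L periodic_config).
  have [k kE] := occupied_add up qL x.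
  rewrite [RHS](reindex_inj (addrI k))/=; apply: eq_bigr => j _; congr (_ * _%:E)%E.
  rewrite !indicE; congr (nat_of_bool _)%:R; apply/idP/idP; rewrite !inE /=;
  suff -> : translate x (periodic_config j) = periodic_config (k + j)%R by [].
  - by apply/funext => y; rewrite /translate /periodic_config kE.
  - by apply/funext => y; rewrite /translate /periodic_config kE.
rewrite [periodic_law A](mixtureE L periodic_config).
have E j : \1_A (periodic_config j) = \1_A (periodic_config 0) :> R.
  have [x hx] := height_surj up j.
  have -> : periodic_config j = translate x (periodic_config 0).
    apply/funext => y; rewrite /translate /periodic_config /occupied; congr (Active (nat_of_bool (modz _ _ < _))).
    have -> : height (x + y) = height x + height y.
      by rewrite /height; case: up.2; rewrite !mxE ?opprD.
    by rewrite hx addr0 addrC.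
  rewrite !indicE; set c0 := periodic_config 0.
  have -> : (translate x c0 \in A) = (c0 \in A); last by [].
  by rewrite -[in RHS](tA x); apply/idP/idP; rewrite !inE.
rewrite (eq_bigr (fun=> ((L.+1%:R^-1) * \1_A (periodic_config 0))%:E)); last first.
  by move=> j _; rewrite E EFinM.
rewrite sumEFin big_const_ord iter_addr_0 -mulrnAl -[_^-1 *+ _]mulr_natr mulVf// mul1r indicE.
by case: (_ \in _); [right|left].
Qed.

Lemma periodic_active : supported_on_active periodic_law.
Proof.
rewrite /supported_on_active [LHS](mixtureE L periodic_config).
rewrite (eq_bigr (fun=> (L.+1%:R^-1)%:E)); last first.
  by move=> j _; rewrite indicE mem_set ?mule1.
by rewrite sumEFin big_const_ord iter_addr_0 -[_ *+ _]mulr_natr mulVf.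
Qed.

Lemma measurable_particles x :
  measurable_fun setT (fun eta : configM d => ((nb_particles (eta x))%:R)%:E : \bar R).
Proof.
have mc (k : occupation) : measurable ([set eta | eta x = k] : set (configM d)).
  by apply: sub_sigma_algebra; exists x, k.
apply: (measurable_countable_choice (X := fun eta : configM d => nb_particles (eta x))
  (G := fun n (eta : configM d) => (n%:R)%:E : \bar R)) => n; last exact: measurable_cst.
rewrite (_ : [set _ | _] = [set eta | eta x = Active n] `|`
    (if n == 1%N then [set eta | eta x = Sleeping] else set0)).
  by apply: measurableU => //; case: ifP.
apply/seteqP; split => eta /=; first by case E : (eta x) => [m|] /= <-; [left|right].
case=> [->//|]; case: eqP => [->|//] /= ->; done.
Qed.

Lemma periodic_density : density periodic_law = (q%:R / L.+1%:R)%:E.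
Proof.
rewrite /density.
have mf := measurable_particles 0.
have w0 : 0 <= (L.+1%:R^-1 : R) by rewrite invr_ge0.
transitivity (\int[mscale (NngNum w0) (msum (fun j => \d_(periodic_config j : configM d)) L.+1)]_eta
  ((nb_particles (eta (0 : site d)))%:R)%:E)%E; first by [].
rewrite ge0_integral_mscale//= ge0_integral_measure_sum//.
rewrite (eq_bigr (fun j : 'I_L.+1 => ((occ j 0)%:R)%:E)); last first.
  by move=> j _; rewrite integral_dirac// diracT mul1e.
rewrite sumEFin -EFinM -natr_sum sum_occupied//.
by rewrite mulrC.
Qed.

End periodic_law.

(** * Late activity from periodic initial conditions *)

Section periodic_activity.
Context {R : realType} (d : nat).
Variables (p : site d -> R) (lambda : R).
Hypotheses (pJ : jump_distribution p) (lambda0 : 0 < lambda).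
Variables (up : dir d).
Local Notation down := (up.1, ~~ up.2).
Local Notation a := (p (vec up)).
Local Notation b := (p (vec down)).
Hypothesis ab : b < a.
Implicit Types (x y z : site d) (h : history d).
Local Notation ach := (ach p lambda).
Local Notation height := (height up).
Local Notation escape0 := (escape0 p lambda up).
Local Notation P := (@unif R).
Local Notation Q := (P \x P)%E.
Variables (L q : nat).
Hypothesis qL : (q <= L.+1)%N.
Local Notation occ := (occupied up L q).

(** A sufficient height [K] depends on [B] and [k], but the probability [v0] of a pile does not
    depend on [K]; from such a pile, covering succeeds with probability one half. *)
Lemma coverable_lower : 1 - escape0 < q%:R / L.+1%:R -> exists2 v : R, 0 < v &
  forall (B : {fset site d}) k, exists (V0 : {fset site d}) j M, (j < L.+1)%N /\
   (v%:E <= P (coverable p lambda (fun x => if x \in V0 then occ j x else 0%N) B k M))%E.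
Proof.
move=> zc; have [v0 v00 H] := ach_pile pJ lambda0 ab qL zc.
exists (v0 / 2); first by rewrite divr_gt0.
move=> B k; have [xs src] := ach_source pJ B.
have /choice[path pathP] : forall y, exists s, y \in B -> positive_path p s /\ y = endpoint xs s.
  move=> y; have [yB|yB] := boolP (y \in B); last by exists [::].
  by have [s ? ?] := src y yB; exists s.
(* Each path is taken [k] times, so that every site of [B] is toppled at least [k] times. *)
pose T := flatten [seq nseq k (path y) | y <- B].
have pT : all (positive_path p) T.
  apply/allP => s /flatten_mapP[y yB]; rewrite mem_nseq => /andP[_ /eqP->].
  by have [] := pathP y yB.
have kT y : y \in B -> (k <= count_mem y [seq endpoint xs s | s <- T])%N.
  move=> yB; rewrite count_map /T count_flatten -map_comp.
  have E : count (preim (endpoint xs) (pred1 y)) (nseq k (path y)) = k.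
    by rewrite count_nseq /= -(pathP y yB).2 eqxx mul1n.
  rewrite -[leqLHS]E sumnE big_map (bigD1_seq y) ?fset_uniq//= leq_addr//.
have [K HK] := pile_cover pJ lambda0 xs pT (ltac:(by rewrite invr_gt0) : 0 < 2^-1 :> R).
have [V [j [x [jL A]]]] := H K.
(* The translation that takes the site of the pile to the source; it changes the phase to [j']. *)
pose w := xs - x.
have [j' j'L occE] := occupied_shift up qL w jL.
pose Vw : seq (site d) := [seq z + w | z <- V].
pose V0 : {fset site d} := [fset y in Vw]%fset.
have V0E z : (z \in V0) = (z - w \in V).
  rewrite /V0 !inE; apply/mapP/idP => [[y yV ->]|zV]; first by rewrite addrK.
  by exists (z - w) => //; rewrite subrK.
set eta0 : config d := fun z => Active (if z \in V then occ j z else 0%N) in A.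
pose n0 z := if z \in V0 then occ j' z else 0%N.
have shE : shift_config w eta0 = fun z => Active (n0 z).
  by apply/funext => z; rewrite /shift_config /eta0 /n0 V0E occE.
have {}A := @ach_shift _ _ p lambda w eta0 _ (fun h => (K < act (run (shift_config w eta0) h) xs)%N%:R) [::] v0 _ A.
rewrite shE in A.
have {}A : ach (fun z => Active (n0 z)) (fun h => (K < act (run (fun z => Active (n0 z)) h) xs)%N%:R) [::] v0.
  by apply: A => g; rewrite -shE run_shift /act /shift_config /w subKr.
have h0 : 0 <= (2^-1 : R) by rewrite invr_ge0.
have {}A := ach_scale h0 A.
pose S h := forall y, y \in B -> (k <= cnt h y)%N.
have {}A : ach (fun z => Active (n0 z)) (fun h => (`[< S h >])%:R) [::] (2^-1 * v0).
  apply: (ach_comp _ A) => // h lh; case: ltnP => [Kh|_]; last first.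
    by rewrite mulr0; exact: ach_stop.
  rewrite mulr1; have := HK _ h lh (ltnW Kh).
  have -> : 1 - 2^-1 = 2^-1 :> R by field.
  move=> B1; apply: (ach_comp lh B1) => g lg; apply: ach_stop.
  case: asboolP => // Hg; rewrite asboolT// => y yB.
  by apply: leq_trans (kT y yB) _; apply: leq_trans (Hg y); exact: leq_addl.
have [M] := ach_sound pJ lambda0 (S := S) (fun=> lexx _) (isT : legal (fun z => Active (n0 z)) [::]) A.
rewrite /history_prob big_nil mul1r [2^-1 * _]mulrC => Mle.
exists V0, j', M; split => //; apply: le_trans Mle _; apply: le_measure.
- by rewrite inE; apply: measurableI; [exact: measurable_consistent|exact: measurable_reach].
- by rewrite inE; exact: measurable_coverable.
- by move=> u [_].
Qed.

Lemma active_during_lower : 1 - escape0 < q%:R / L.+1%:R -> exists2 v : R, 0 < v &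
  forall (B : {fset site d}) s, 0 <= s -> exists2 t : R, 0 <= t & exists V0 : {fset site d},
    forall V, (V0 `<=` V)%fset ->
    (v%:E <= Q [set w | active_during B s t (process p lambda L (periodic_config up L q) V ^~ w)])%E.
Proof.
move=> zc; have [v v0 H] := coverable_lower zc.
exists (L.+1%:R^-1 * (v / 4)); first by rewrite mulr_gt0 ?invr_gt0 ?divr_gt0.
move=> B s s0.
pose X : R := #|` B|%:R * (3 ^+ d * expR (2 * (1 + lambda) * s)).
have X0 : 0 <= X by rewrite !mulr_ge0 ?expR_ge0.
(* With [eps] one half, covering is worth [v / 2]; this [k] limits to [v / 4] the probability that
   some site of [B] has [k] topplings by time [s]. *)
pose k := (Num.truncn (X * 4 / v)).+1.
have kX : X / k%:R <= v / 4.
  rewrite ler_pdivrMr// mulrC -ler_pdivrMr ?divr_gt0//.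
  by rewrite invf_div mulrA ltW// truncnS_gt.
have [V0 [j [M [jL Mle]]]] := H B k.
have h0 : 0 < (2^-1 : R) by rewrite invr_gt0.
have [t t0 Ht] := process_active pJ lambda0 M B s h0 (ltac:(by rewrite invf_le1 ?ler1n) : 2^-1 <= 1 :> R) (ltn0Sn _ : 0 < k)%N.
exists t => //; exists V0 => V V0V.
have := Ht L occ j V0 V jL (fun i x => occupied_le1 up L q i x) V0V.
apply: le_trans; rewrite EFinM; apply: lee_wpmul2l; first by rewrite lee_fin invr_ge0.
apply: (@le_trans _ _ ((1 - 2^-1)%:E * v%:E - (X / k%:R)%:E)%E).
  by rewrite -EFinM -EFinB lee_fin; move: kX; move: (X / _) => Y; lra.
rewrite [X / _](_ : _ = #|` B|%:R * (3 ^+ d * expR (2 * (1 + lambda) * s) / k%:R)); last first.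
  by rewrite /X -mulrA.
apply: leeB => //; apply: lee_wpmul2l => //.
by rewrite lee_fin subr_ge0 invf_le1 ?ler1n.
Qed.

End periodic_activity.

(** * The infinite volume limit *)

Section infinite_volume.
Context {R : realType} (d : nat).
Variables (p : site d -> R) (lambda : R).
Hypotheses (pJ : jump_distribution p) (lambda0 : 0 < lambda).
Implicit Types (x y z : site d) (B V : {fset site d}) (u : R -> config d).

Lemma local_event_active_during B (s t : R) : 0 <= s -> local_event B t (active_during B s t).
Proof.
move=> s0.
pose G : set (set (R -> config d)) := [set A | exists s x k,
  [/\ 0 <= s <= t, x \in B & A = [set u : R -> config d | u s x = k]]].
suff H : measurable (active_during B s t : set (g_sigma_algebraType G)) by exact: H.
have -> : active_during B s t = \bigcap_(x in [set` B])
   \bigcup_(q in [set: rat]) ((if s <= ratr q <= t then setT else set0) `&`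
     \bigcup_(k in [set: nat]) [set u : R -> config d | u (ratr q) x = Active k.+1]).
  apply/seteqP; split => u H x xB.
    have [q qst] := H x xB; case E : (u _ _) => [[|n]|] //= _.
    by exists q => //; split; [rewrite qst|exists n].
  have [q _ [+ [k _ /= E]]] := H x xB; case: ifP => // qst _.
  by exists q => //; rewrite E.
apply: fin_bigcap_measurable => // x xB; apply: countable_bigcupT_measurable.
  exact: countableP.
move=> q; case: ifP => [/andP[sq qt]|_]; last by rewrite set0I.
rewrite setTI; apply: bigcup_measurable => k _; apply: sub_sigma_algebra.
by exists (ratr q), x, (Active k.+1); split => //; rewrite (le_trans s0 sq) qt.
Qed.

Definition first_sites (m : nat) : {fset site d} :=
  [fset x in pmap (@choice.pickle_inv (site d)) (iota 0 m)]%fset.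

Lemma mem_first_sites m x : (x \in first_sites m) = (choice.pickle x < m)%N.
Proof.
rewrite !inE mem_pmap; apply/mapP/idP => [[n]|xm].
  rewrite mem_iota => /= nm nx; rewrite (_ : choice.pickle x = n)//.
  by have := @choice.pickle_invK (site d) n; rewrite -nx.
by exists (choice.pickle x); rewrite ?mem_iota ?choice.pickleK_inv.
Qed.

Definition active_after (m : nat) u : Prop := forall x, x \in first_sites m ->
  exists2 q : rat, m%:R <= ratr q :> R & (1 <= nb_active (u (ratr q) x))%N.

Variables (nu : probability (configM d) R) (disp : measure_display)
  (Omega : measurableType disp) (P : probability Omega R) (eta : R -> Omega -> config d).
Hypothesis etaP : arw_process p lambda nu P eta.

Lemma measurable_active_after m : measurable [set w | active_after m (eta^~ w)].
Proof.
have -> : [set w | active_after m (eta^~ w)] = \bigcap_(x in [set` first_sites m])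
   \bigcup_(q in [set: rat]) (if m%:R <= ratr q :> R then
     \bigcup_(k in [set: nat]) [set w | eta (ratr q) w x = Active k.+1] else set0).
  apply/seteqP; split => w H x xB.
    have [q qst] := H x xB; case E : (eta _ _ _) => [[|n]|] //= _.
    by exists q => //; rewrite qst; exists n.
  have [q _] := H x xB; case: ifP => // qst [k _ /= E].
  by exists q => //; rewrite E.
apply: fin_bigcap_measurable => // x xB; apply: countable_bigcupT_measurable.
  exact: countableP.
move=> q; case: ifP => // mq; apply: bigcup_measurable => k _.
by apply: (arw_measurable etaP); exact: le_trans mq.
Qed.

Lemma measurable_limit_active_during B (s t : R) : 0 <= s ->
  measurable [set w | active_during B s t (eta^~ w)].
Proof.
move=> s0.
have -> : [set w | active_during B s t (eta^~ w)] = \bigcap_(x in [set` B])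
   \bigcup_(q in [set: rat]) (if s <= ratr q <= t then
     \bigcup_(k in [set: nat]) [set w | eta (ratr q) w x = Active k.+1] else set0).
  apply/seteqP; split => w H x xB.
    have [q qst] := H x xB; case E : (eta _ _ _) => [[|n]|] //= _.
    by exists q => //; rewrite qst; exists n.
  have [q _] := H x xB; case: ifP => // qst [k _ /= E].
  by exists q => //; rewrite E.
apply: fin_bigcap_measurable => // x xB; apply: countable_bigcupT_measurable.
  exact: countableP.
move=> q; case: ifP => // /andP[sq _]; apply: bigcup_measurable => k _.
by apply: (arw_measurable etaP); exact: le_trans sq.
Qed.

(** Right-continuity replaces a real time of activity by a rational one just after it; since [m]
    bounds both the sites and the time, the intersection covers all sites and arbitrarily late
    times. *)
Lemma stays_activeE : [set w | stays_active (eta^~ w)] =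
  \bigcap_m [set w | active_after m (eta^~ w)].
Proof.
apply/seteqP; split => w H.
  move=> m _ x _; have [t [t0 mt] ax] := H x m%:R.
  have := arw_right_continuous etaP w x t0; rewrite near_withinE => /nbhs_ballP[e /= e0 He].
  have [q] : exists q : rat, ratr q \in `]t, t + e[%R by apply: rat_in_itvoo; rewrite ltrDl.
  rewrite in_itv /= => /andP[tq qt]; exists q; first by rewrite (le_trans mt)// ltW.
  rewrite He//= /ball /= ltr_distlC; apply/andP; split; last by [].
  by rewrite (lt_trans _ tq)// gtrBl.
move=> x t0; pose m := maxn (choice.pickle x).+1 (Num.truncn t0).+1.
have xm : x \in first_sites m by rewrite mem_first_sites leq_max ltnSn.
have [q mq ax] := H m I x xm; exists (ratr q) => //; split; first exact: le_trans mq.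
apply: le_trans mq; apply: le_trans (ltW (truncnS_gt t0)) _.
by rewrite ler_nat leq_max leqnn orbT.
Qed.

Lemma measurable_stays_active : measurable [set w | stays_active (eta^~ w)].
Proof.
by rewrite stays_activeE; apply: bigcap_measurable => // m _; exact: measurable_active_after.
Qed.

(** The events [active_after] decrease. Each contains a local event, whose probability passes to the
    limit of volumes with an error of at most [v / 2]; continuity from above concludes. *)
Lemma stays_active_gt0 (v : R) : 0 < v ->
  (forall B (s : R), 0 <= s -> exists2 t : R, 0 <= t & exists V0, forall V, (V0 `<=` V)%fset ->
     exists (disp' : measure_display) (Omega' : measurableType disp')
       (P' : probability Omega' R) (X : R -> Omega' -> config d),
       finite_system p lambda nu V P' X /\ (v%:E <= P' [set w | active_during B s t (X^~ w)])%E) ->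
  (0 < P [set w | stays_active (eta^~ w)])%E.
Proof.
move=> v0 H; have v20 : 0 < v / 2 by rewrite divr_gt0.
apply: (@lt_le_trans _ _ (v / 2)%:E); first by rewrite lte_fin.
have Em m : ((v / 2)%:E <= P [set w | active_after m (eta^~ w)])%E.
  have [t t0 [V0 HV]] := H (first_sites m) m%:R (ler0n _ _).
  have [V1 HV1] := arw_limit etaP t0 (@local_event_active_during (first_sites m) m%:R t (ler0n R m)) v20.
  have [disp' [Om [P' [X [fs vP]]]]] := HV (V0 `|` V1)%fset (fsubsetUl _ _).
  have := HV1 (V0 `|` V1)%fset (fsubsetUr _ _) _ _ _ _ fs.
  set A' := P' _ in vP *; set A := P _ => AA.
  apply: (@le_trans _ _ A).
    have : A \is a fin_num by apply: fin_num_measure; exact: measurable_limit_active_during.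
    move: A A' vP AA => [A| |] [A'| |] //=; rewrite ?lee_fin => vP AA _.
    by move: AA; rewrite lte_fin ltr_distlC => /andP[+ _]; lra.
  apply: le_measure; rewrite ?inE.
  - exact: measurable_limit_active_during.
  - exact: measurable_active_after.
  by move=> w H1 x xB; have [q /andP[mq _] ax] := H1 x xB; exists q.
rewrite stays_activeE.
have cv := @nonincreasing_cvg_mu _ _ _ P (fun m => [set w | active_after m (eta^~ w)]).
have {}cv := cv _ measurable_active_after _ _.
have : P \o (fun m => [set w | active_after m (eta^~ w)]) @ \oo -->
    P (\bigcap_m [set w | active_after m (eta^~ w)]).
  apply: cv.
  - by rewrite ltey_eq fin_num_measure//; exact: measurable_active_after.
  - by rewrite -stays_activeE; exact: measurable_stays_active.
  apply/nonincreasing_seqP => n; rewrite subsetEset => w Hw x xB.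
  have [|q nq ax] := Hw x; first by move: xB; rewrite !mem_first_sites => /ltnW.
  by exists q => //; apply: le_trans nq; rewrite ler_nat.
move=> cvP; rewrite -(cvg_lim _ cvP)//; apply: lime_ge; first exact: cvgP cvP.
by apply: nearW => m; exact: Em.
Qed.

Lemma stays_active_eq0 :
  (forall V, exists (disp' : measure_display) (Omega' : measurableType disp')
       (P' : probability Omega' R) (X : R -> Omega' -> config d),
       finite_system p lambda nu V P' X /\ forall t w x, X t w x = Active 0) ->
  P [set w | stays_active (eta^~ w)] = 0%E.
Proof.
move=> H; apply: measure_negligible; first exact: measurable_stays_active.
pose B : {fset site d} := [fset (0 : site d)]%fset.
pose A n := [set w | active_during B 0 (n%:R : R) (eta^~ w)].
apply: (@negligibleS _ _ _ _ (\bigcup_n A n)).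
  move=> w; rewrite stays_activeE => Hw.
  have x1 : (0 : site d) \in first_sites (choice.pickle (0 : site d)).+1 by rewrite mem_first_sites.
  have [q mq ax] := Hw _ I _ x1.
  exists (Num.truncn (ratr q : R)).+1 => // x; rewrite inE => /eqP->; exists q => //.
  by rewrite (le_trans _ mq)//= ltW// truncnS_gt.
apply: negligible_bigcup => n; apply/negligibleP; first exact: measurable_limit_active_during.
apply/eqP; rewrite eq_le measure_ge0 andbT; apply/lee_addgt0Pr => e e0; rewrite add0e.
have [V0 HV0] := arw_limit etaP (ler0n R n) (@local_event_active_during B 0 n%:R (lexx 0)) e0.
have [disp' [Om [P' [X [fs X0]]]]] := H V0.
have := HV0 V0 (fsubset_refl V0) _ _ _ _ fs.
have -> : [set w | active_during B 0 (n%:R : R) (X^~ w)] = set0.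
  rewrite -subset0 => w /(_ (0 : site d)); rewrite inE eqxx => /(_ isT)[q _].
  by rewrite X0.
by rewrite measure0 sub0e abseN gee0_abs// => /ltW.
Qed.

End infinite_volume.

(** * Bounds on the critical density *)

Section critical.
Context {R : realType} (d : nat).
Variables (p : site d -> R).
Hypotheses (pJ : jump_distribution p).

(** Were [zc] negative, density 0 would be supercritical and the vacant configuration would have to
    stay active. *)
Lemma critical_density_ge0 lambda (up : dir d) zc :
  0 < lambda -> critical_density p lambda zc -> 0 <= zc.
Proof.
move=> l0 crit; rewrite leNgt; apply/negP => z0.
pose conf := @periodic_config d up 0 0.
have confE j x : conf j x = Active 0.
  rewrite /conf /periodic_config /occupied ltNge (modz_ge0 _ (ltac:(by []) : 1%:Z != 0)); done.
have den : density (@periodic_law R d up 0 0) = 0%:E.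
  by rewrite (@periodic_density R d up 0 0)// mul0r.
have [_ /(_ z0)[disp [Om [P [eta [etaP]]]]]] := crit _ _ (periodic_ergodic up (leq0n 1))
  (periodic_active up 0 0) den.
rewrite (stays_active_eq0 etaP) => [/eqP|V]; first by rewrite eqe eq_sym oner_eq0.
pose X := process p lambda 0 conf V.
exists _, (measurableTypeR R * measurableTypeR R)%type, (@unif R \x @unif R)%E, X.
split=> [|t w x]; first exact: finite_system_process.
rewrite /X /process; case: pselect => // e; rewrite /chain_config.
have iE j : start_config conf V j = conf 0%N.
  by apply/funext => y; rewrite /start_config /restrict confE; case: ifP; rewrite ?confE.
rewrite iE; elim: (xchoose e) (start w) => //= n IH v; rewrite {1}/next_history.
rewrite (_ : total_rate lambda (run (conf 0%N) [::]) == 0) ?IH//.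
by rewrite /total_rate fsbig1// => y _; rewrite /clock_rate (confE 0%N y : run (conf 0%N) [::] y = Active 0) mulr0.
Qed.

(** Were the density of the layers subcritical, activity would have probability 0, against
    [stays_active_gt0]. *)
Lemma critical_density_le lambda up zc L q : 0 < lambda -> p (vec (up.1, ~~ up.2)) < p (vec up) ->
  critical_density p lambda zc -> (q <= L.+1)%N ->
  1 - escape0 p lambda up < q%:R / L.+1%:R -> zc <= q%:R / L.+1%:R.
Proof.
move=> l0 ab crit qL zq; rewrite leNgt; apply/negP => zc_gt.
have [/(_ zc_gt)[disp [Om [P [eta [etaP PE]]]]] _] := crit _ _ (periodic_ergodic up qL)
  (periodic_active up L q) (periodic_density up qL).
have [v v0 H] := active_during_lower pJ l0 ab qL zq.
suff : (0 < P [set w | stays_active (eta^~ w)])%E by rewrite PE ltxx.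
apply: (stays_active_gt0 etaP v0) => B s s0; have [t t0 [V0 HV]] := H B s s0.
exists t => //; exists V0 => V V0V.
exists _, (measurableTypeR R * measurableTypeR R)%type, (@unif R \x @unif R)%E,
  (process p lambda L (periodic_config up L q) V); split; last exact: HV.
exact: finite_system_process.
Qed.

Lemma critical_density_le_escape lambda up zc : 0 < lambda ->
  p (vec (up.1, ~~ up.2)) < p (vec up) -> critical_density p lambda zc ->
  zc <= 1 - escape0 p lambda up.
Proof.
move=> l0 ab crit; rewrite leNgt; apply/negP => lt.
have e0 := escape0_gt0 pJ l0 ab; have e1 := escape0_lt1 pJ l0 ab.
set c := 1 - escape0 p lambda up in lt *; have c0 : 0 < c by rewrite subr_gt0.
(* A rational density is sought between [c] and [zc], but also at most 1, since layers hold at most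
   one particle per site. *)
pose r := Num.min zc 1.
have cr : c < r by rewrite lt_min lt /c gtrBl.
have g0 : 0 < r - c by rewrite subr_gt0.
pose L := Num.truncn (r - c)^-1; have LL : 1 < (r - c) * L.+1%:R.
  by rewrite -ltr_pdivrMl// mulr1 truncnS_gt.
pose q := (Num.truncn (c * L.+1%:R)).+1.
have L0 : 0 < L.+1%:R :> R by [].
have q1 : c * L.+1%:R < q%:R by exact: truncnS_gt.
have q2 : q%:R < r * L.+1%:R.
  rewrite /q -natr1; have := truncn_le (c * L.+1%:R) => T.
  have {}T : (Num.truncn (c * L.+1%:R))%:R <= c * L.+1%:R by rewrite T// mulr_ge0// ltW.
  by move: LL T; rewrite mulrBl; lra.
have cq : c < q%:R / L.+1%:R by rewrite ltr_pdivlMr.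
have qr : q%:R / L.+1%:R < r by rewrite ltr_pdivrMr.
have qL : (q <= L.+1)%N.
  rewrite -(ler_nat R) -[leRHS]mul1r (le_trans (ltW q2))// ler_pM2r//.
  by rewrite ge_min lexx orbT.
have := lt_le_trans qr (ltac:(by rewrite ge_min lexx) : r <= zc).
by rewrite ltNge (critical_density_le l0 ab crit qL cq).
Qed.

(** The numerator of [1 - escape0] is [lambda + b * (1 - kill_ratio)], and [1 - kill_ratio] is
    itself of order [lambda]. *)
Lemma escape0_le lambda up : 0 < lambda -> p (vec (up.1, ~~ up.2)) < p (vec up) ->
  1 - escape0 p lambda up <= lambda * (p (vec up) / (p (vec up) - p (vec (up.1, ~~ up.2))) ^+ 2).
Proof.
move=> l0 ab; have b0 : 0 <= p (vec (up.1, ~~ up.2)) by exact: jump_ge0 pJ _.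
have k0 := kill_ratio_gt0 l0 ab; have k1 := kill_ratio_le1 l0 ab.
rewrite /escape0; set k := kill_ratio p lambda up in k0 k1 *.
set a := p (vec up) in ab *; set b := p (vec _) in ab b0 *.
have dab : 0 < a - b by rewrite subr_gt0.
have kE : (1 - k) * (a - b) = k * lambda.
  have K : k * (1 + lambda / (a - b)) = 1 by rewrite /k mulVf// gt_eqF// addr_gt0// divr_gt0.
  by rewrite -[X in (X - _) * _]K [k * (1 + _)]mulrDr mulr1 addrAC subrr add0r mulrA mulfVK// gt_eqF.
have bk : b * k <= b by rewrite -[leRHS]mulr1 ler_wpM2l.
have q0 : 0 < lambda + a - b * k by move: bk dab l0; lra.
have -> : 1 - (a - b) / (lambda + a - b * k) = (lambda + b * (1 - k)) / (lambda + a - b * k).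
  by field; rewrite gt_eqF.
have num : (lambda + b * (1 - k)) * (a - b) <= lambda * a.
  have -> : (lambda + b * (1 - k)) * (a - b) = lambda * (a - b) + b * ((1 - k) * (a - b)) by ring.
  rewrite kE; have : b * (k * lambda) <= b * lambda by rewrite ler_wpM2l// ger_pMl.
  by lra.
rewrite ler_pdivrMr// -(ler_pM2r dab); apply: (le_trans num).
have -> : lambda * (a / (a - b) ^+ 2) * (lambda + a - b * k) * (a - b) =
   lambda * a * ((lambda + a - b * k) / (a - b)) by field; rewrite gt_eqF.
have a0 : 0 < a by exact: le_lt_trans ab.
rewrite -[leLHS]mulr1; apply: ler_wpM2l; first by rewrite mulr_ge0// ltW.
by rewrite ler_pdivlMr// mul1r; move: bk l0; lra.
Qed.

Lemma biased_direction : biased p -> exists up, p (vec (up.1, ~~ up.2)) < p (vec up).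
Proof.
move=> bias; apply: contrapT => H.
have pe (i : 'I_d) : p (vec (i, true)) = p (vec (i, false)).
  apply/eqP; rewrite eq_le !leNgt; apply/andP; split; apply/negP => lt; apply: H.
    by exists (i, true).
  by exists (i, false).
move/eqP: bias; apply; rewrite /drift (fsum_vec pJ (F := fun y => p y *: map_mx intr y)); last first.
  by move=> y ->; rewrite scale0r.
rewrite (eq_bigr (fun e => p (vec (e.1, e.2)) *: map_mx intr (vec (e.1, e.2)))); last by case.
rewrite -(pair_bigA _ (fun i c => p (vec (i, c)) *: map_mx intr (vec (i, c)))) /=.
rewrite big1// => i _; rewrite big_bool /= pe -scalerDr.
rewrite (_ : _ + _ = 0) ?scaler0//; apply/rowP => j; rewrite !mxE /= rmorphN /=.
by rewrite subrr.
Qed.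

End critical.

Theorem theorem3p3 (R : realType) (d : nat) (p : 'rV[int]_d -> R)
    (zeta_c : R -> R) :
  (1 <= d)%N ->
  jump_distribution p ->
  biased p ->
  (forall lambda : R, 0 < lambda ->
     critical_density p lambda (zeta_c lambda)) ->
  (forall lambda : R, 0 < lambda -> zeta_c lambda < 1) /\
  zeta_c lambda @[lambda --> 0^'+] --> (0 : R).
Proof.
move=> _ pJ bias crit; have [up ab] := biased_direction pJ bias.
split=> [lambda l0|].
  apply: le_lt_trans (critical_density_le_escape pJ l0 ab (crit _ l0)) _.
  by rewrite gtrBl; exact: escape0_gt0.
apply/cvgrPdist_le => e e0.
pose C := p (vec up) / (p (vec up) - p (vec (up.1, ~~ up.2))) ^+ 2.
have C0 : 0 < C.
  rewrite divr_gt0 ?exprn_gt0 ?subr_gt0//; apply: le_lt_trans ab; exact: jump_ge0 pJ _.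
near=> lambda.
have l0 : 0 < lambda by near: lambda; exact: nbhs_right_gt.
have z0 : 0 <= zeta_c lambda := critical_density_ge0 pJ up l0 (crit lambda l0).
rewrite sub0r normrN ger0_norm//.
apply: le_trans (critical_density_le_escape pJ l0 ab (crit _ l0)) _.
apply: le_trans (escape0_le pJ l0 ab) _; rewrite -ler_pdivlMr//.
by near: lambda; apply: nbhs_right_le; rewrite divr_gt0.
Unshelve. all: by end_near.
Qed.
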